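(* Let $\Sigma$ be an immersed minimal surface in $\mathbb{R}^n$ with at most exponential area growth. Suppose that one end of $\Sigma$ is asymptotic to a plane exponentially, in the sense that this end can be viewed as a graph of a vector valued function $u$ over the plane such that $$\limsup_{r=|x|\to\infty}|e^{\sigma r}u(x)|=0\quad\text{for all }\sigma>0.$$ Then $\Sigma$ is just the plane.
   Context: A surface is $2$-dimensional and a plane is a $2$-dimensional plane in $\mathbb{R}^n$. $B_r$ is the ball of radius $r$ centered at the origin of $\mathbb{R}^n$, and $r=|x|$ is the Euclidean distance to the origin. ''At most exponential area growth'' means that there are constants $t$ and $R_0$ such that $\mathrm{Area}(\Sigma\cap B_r)\le e^{tr}$ for every $r>R_0$.
   Formalization: The surface Σ is additionally assumed connected and complete in its induced metric; without this the claim fails (the exterior of a disc in a plane, or two parallel planes). *)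

(* Defs.v *)
From HB Require Import structures.
From mathcomp Require Import all_boot all_order all_algebra.
From mathcomp Require Import all_classical all_reals all_analysis.

Set Implicit Arguments.
Unset Strict Implicit.
Unset Printing Implicit Defensive.

Import Order.TTheory GRing.Theory Num.Theory.
Import numFieldNormedType.Exports.

Local Open Scope classical_set_scope.
Local Open Scope ring_scope.

Section EuclideanSpace.
Context {R : realType} {n : nat}.
Implicit Types (x y p : 'rV[R]_n) (V : 'M[R]_(2, n)).

Definition dot x y : R := (x *m y^T) 0 0.

(* The library norm on 'rV[R]_n is the sup norm; its topology is the
   Euclidean one. *)
Definition enorm x : R := Num.sqrt (dot x x).

(* The affine plane through p spanned by the rows of V (when \rank V = 2). *)
Definition plane p V : set 'rV[R]_n := [set x | (x - p <= V)%MS].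

Definition plane_param p V (z : R * R) : 'rV[R]_n :=
  p + z.1 *: row 0 V + z.2 *: row 1 V.

(* The filter on the plane of r = |x| --> +oo. *)
Definition plane_infty p V : set_system 'rV[R]_n :=
  filter_from [set: R] (fun r => [set x | plane p V x /\ r < enorm x]).

End EuclideanSpace.

(* All iterated directional derivatives exist and are differentiable on the
   open set U: f is C^oo on U. *)
Definition smooth_on {R : realType} {V W : normedModType R}
    (U : set V) (f : V -> W) : Prop :=
  forall (vs : seq V) (x : V), U x ->
    differentiable (foldr (fun v g => 'D_v g) f vs) x.

Section Surface.
Context {R : realType}.

(* Local parametrizations, i.e. inverses of coordinate charts. *)
Record chart (M : topologicalType) := Chart {
  chart_dom : set (R * R);
  chart_map :> R * R -> M }.

Definition topological_chart (M : topologicalType) (c : chart M) : Prop :=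
  [/\ open (chart_dom c),
      {within chart_dom c, continuous c},
      {in chart_dom c &, injective c} &
      forall O : set (R * R), open O -> O `<=` chart_dom c -> open (c @` O)].

(* tau is the transition map c2^-1 \o c1 on its domain of definition. *)
Definition smooth_compatible (M : topologicalType) (c1 c2 : chart M) : Prop :=
  let U := chart_dom c1 `&` c1 @^-1` (c2 @` chart_dom c2) in
  forall tau : R * R -> R * R,
    (forall z, U z -> chart_dom c2 (tau z) /\ c2 (tau z) = c1 z) ->
    smooth_on U tau.

Definition smooth_surface (M : topologicalType) (A : set (chart M)) : Prop :=
  [/\ hausdorff_space M,
      @second_countable M,
      (forall c, A c -> topological_chart c),
      (forall q : M, exists2 c, A c & (c @` chart_dom c) q) &
      (forall c1 c2, A c1 -> A c2 -> smooth_compatible c1 c2)].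

(* An end in the sense of Freudenthal: a coherent choice of a connected
   component of the complement of every compact set. *)
Definition is_end (M : topologicalType) (e : set M -> set M) : Prop :=
  (forall K, compact K ->
     exists2 q, ~ K q & e K = connected_component (~` K) q) /\
  (forall K L, compact K -> compact L -> K `<=` L -> e L `<=` e K).

End Surface.
Arguments chart R M : clear implicits.

Section LocalGeometry.
Context {R : realType} {n : nat}.
Implicit Types (X : R * R -> 'rV[R]_n) (z : R * R).

Definition basis2 (i : 'I_2) : R * R := if i == 0 then (1, 0) else (0, 1).

Definition partial (i : 'I_2) X : R * R -> 'rV[R]_n := 'D_(basis2 i) X.

Definition first_form X z : 'M[R]_2 :=
  \matrix_(i, j) dot (partial i X z) (partial j X z).

(* Component of w orthogonal to the tangent plane spanned by the partial
   derivatives of X at z. *)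
Definition normal_part X z (w : 'rV[R]_n) : 'rV[R]_n :=
  w - \sum_i \sum_j
        (invmx (first_form X z) i j * dot w (partial i X z)) *: partial j X z.

(* Trace of the second fundamental form A_ij = (d_i d_j X)^perp. *)
Definition mean_curvature X z : 'rV[R]_n :=
  \sum_i \sum_j
    invmx (first_form X z) i j *: normal_part X z (partial i (partial j X) z).

Definition area_density X z : R := Num.sqrt (\det (first_form X z)).

End LocalGeometry.

Section ImmersedSurface.
Context {R : realType} {n : nat} {M : topologicalType}.
Implicit Types (A : set (chart R M)) (F : M -> 'rV[R]_n).

Definition immersion A F : Prop :=
  forall c, A c -> smooth_on (chart_dom c) (F \o c) /\
    forall z, chart_dom c z -> injective ('d (F \o c) z : R * R -> 'rV[R]_n).

Definition minimal A F : Prop :=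
  forall c z, A c -> chart_dom c z -> mean_curvature (F \o c) z = 0.

(* Area of E for the metric induced by F, counted with multiplicity: supremum
   over finite families of disjoint pieces of E, each measured in a chart. *)
Definition area A F (E : set M) : \bar R :=
  ereal_sup [set a | exists (k : nat) (c : 'I_k -> chart R M)
      (D : 'I_k -> set (measurableTypeR R * measurableTypeR R)),
    [/\ forall i, A (c i),
        forall i, measurable (D i) /\ D i `<=` chart_dom (c i),
        forall i, c i @` D i `<=` E,
        trivIset [set: 'I_k] (fun i => c i @` D i) &
        a = (\sum_(i < k)
               \int[@lebesgue_measure R \x @lebesgue_measure R]_(z in D i)
                 (area_density (F \o c i) z)%:E)%E]].

Definition exp_area_growth A F : Prop :=
  exists t R0 : R, forall r, R0 < r ->
    (area A F (F @^-1` [set x | (enorm x < r)%R]) <= (expR (t * r))%:E)%E.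

(* When F is an immersion, a continuous curve g in M is C^1 exactly when F \o g
   is C^1, and |(F \o g)'| is its speed in the induced metric.  Curves may be
   slowed down to rest at parameters 0 and 1, so taking g defined on all of R
   does not change the infimum in intrinsic_dist. *)
Definition C1_curve F (g : R -> M) : Prop :=
  [/\ continuous g, (forall t : R, derivable (F \o g) t 1) &
      continuous (derive1 (F \o g))].

Definition curve_length F (g : R -> M) : \bar R :=
  (\int[@lebesgue_measure R]_(t in `[0%R, 1%R]) (enorm (derive1 (F \o g) t))%:E)%E.

Definition intrinsic_dist F (q1 q2 : M) : \bar R :=
  ereal_inf [set l | exists g : R -> M,
    [/\ C1_curve F g, g 0 = q1, g 1 = q2 & l = curve_length F g]].

(* Completeness of M for the metric induced by F. *)
Definition complete_surface F : Prop :=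
  forall q : nat -> M,
    (forall eps : R, 0 < eps -> exists N : nat, forall i j : nat,
       (N <= i)%N -> (N <= j)%N -> (intrinsic_dist F (q i) (q j) < eps%:E)%E) ->
    exists l : M, q @ \oo --> l.

(* The part E of the surface is the graph {x + u x} of a smooth normal-valued
   function u over the plane outside some ball. *)
Definition is_graph_outside_ball F (E : set M) (p : 'rV[R]_n)
    (V : 'M[R]_(2, n)) (u : 'rV[R]_n -> 'rV[R]_n) (rho : R) : Prop :=
  let P := [set x | plane p V x /\ rho < enorm x] in
  [/\ smooth_on (plane_param p V @^-1` P) (u \o plane_param p V),
      (forall x, P x -> u x *m V^T = 0) &
      set_bij E ((fun x => x + u x) @` P) F].

End ImmersedSurface.

(* Main.v *)
(* Every linear function of the position vector is harmonic on a minimal surface.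
   If x, y are two of them with dx /\ dy > 0, the forms dxi = dx - *dy and
   deta = dy + *dx are closed and conformal, i.e. zeta = xi + i eta is a local
   isothermal parameter; only the dual frame D1, D2 of commuting vector fields is
   needed, so that no integration takes place and every estimate follows from the
   maximum principle.  A third linear function v gives the holomorphic function
   f = D1 v - i D2 v, and |f|^2 e^psi is subharmonic when psi is.

   On the end let x, y be Cartesian coordinates of the plane and v a normal
   component.  The frame is contracting for (x, y), so Bernstein's method bounds
   |f|^2 by 7 sup v^2 over unit discs, without any bound on the gradient of the
   graph.  Hence f decays faster than every exponential in all directions, and the
   weights psi = 2 N (x + e^(c-x)) on the half plane x >= c give
   |f|^2 <= 7 e^(2N(c+1-x)) for all N, that is f = 0 and v = 0 for x > c + 1.
   The Hopf barriers psi = N e^(-a rho), with rho a squared distance, yield unique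
   continuation for f, so v = 0 on the whole connected surface.

   The surface is now immersed in the plane as a complete flat surface.  Its
   projection to the plane is a local homeomorphism along which segments lift by
   completeness; sections over larger and larger squares exhaust the plane and
   their union is open and closed. *)
Require Import Defs.
From HB Require Import structures.
From mathcomp Require Import all_boot all_order all_algebra.
From mathcomp Require Import all_classical all_reals all_analysis.
From mathcomp Require Import measurable_realfun ring lra.

Set Implicit Arguments.
Unset Strict Implicit.
Unset Printing Implicit Defensive.

Import Order.TTheory GRing.Theory Num.Theory.
Import numFieldNormedType.Exports.

Local Open Scope classical_set_scope.
Local Open Scope ring_scope.

(** * Smooth scalar functions *)

(** Isothermal coordinates would require solving an elliptic system. Two linear functions avoid
    this: the determinant of their coframe is twice the Jacobian of (x, y) plus a nonnegative term,
    and deta = *dxi makes the frame conformal wherever the Jacobian is positive. The matrix of frame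
    derivatives of (x, y) is symmetric with trace 1 and positive determinant, so its eigenvalues lie
    between 0 and 1 and the cut-off 1 - |x - x0|^2 has frame derivatives bounded by absolute
    constants; this is where 7 comes from. The maximum principle is used only in its elementary
    form, at points with strictly positive Laplacian. The weight x is merely harmonic, and e^(c-x)
    supplies the strictness. The half plane is not compact, but for each N the decay of f beats the
    weight and confines the maximum to a bounded set depending on N, while the bound 7 on the
    boundary line does not depend on N. Flatness alone leaves a local homeomorphism to the plane
    that could be many-to-one or miss points. It is inverted over squares rather than discs because
    pairwise intersecting squares have a common point. *)

Section Derivations.
Context {R : realType} {V : normedModType R}.
Implicit Types (f g : V -> R) (z v : V).

Lemma derive_comp1 (h : R -> R) f z v : differentiable f z ->
  derivable h (f z) 1 -> 'D_v (h \o f) z = 'D_1 h (f z) * 'D_v f z.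
Proof.
move=> df /derivable1_diffP dh.
rewrite deriveE; last exact: differentiable_comp.
rewrite diff_comp //= -(deriveE v df).
by rewrite deriv1E ?derive1E; [exact: mulrC|apply/derivable1_diffP].
Qed.

Lemma derive_eq_on (W : normedModType R) (U : set V) (f g : V -> W) z v :
  open U -> U z -> (forall y, U y -> f y = g y) -> 'D_v f z = 'D_v g z.
Proof.
move=> oU Uz fg.
have [->|v0] := eqVneq v 0; first by rewrite !derive0.
apply: near_eq_derive => //.
by near=> y; apply: fg; near: y; apply: open_nbhs_nbhs.
Unshelve. all: by end_near. Qed.

Lemma differentiable_eq_on (W : normedModType R) (U : set V) (f g : V -> W) z :
  open U -> U z -> (forall y, U y -> f y = g y) ->
  differentiable g z -> differentiable f z.
Proof.
move=> oU Uz fg /diff_locallyP[cg eg].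
(* The differential of [g] serves as first-order term for [f]; [diff_unique] then identifies it with
   ['d f z]. *)
have ef : f \o shift z = cst (f z) + 'd g z +o_ (0 : V) id.
  apply/eqaddoP => eps eps0.
  move/eqaddoP : eg => /(_ _ eps0) eg; near=> h.
  suff E : f (shift z h) = g (shift z h).
    have -> : (f \o shift z - (cst (f z) + 'd g z)) h =
              (g \o shift z - (cst (g z) + 'd g z)) h.
      by rewrite !fctE /= E fg.
    by near: h.
  apply: fg; near: h.
  have : (h + z) @[h --> (0 : V)] --> z.
    by rewrite -{2}(add0r z); apply: cvgD; [exact: cvg_id|exact: cvg_cst].
  by apply; apply: open_nbhs_nbhs.
apply/diff_locallyP; rewrite (diff_unique cg ef); split => //.
Unshelve. all: by end_near. Qed.

End Derivations.

Section SmoothFunctions.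
Context {R : realType} {V : normedModType R}.
Implicit Types (U : set V) (f g : V -> R) (z v : V).

(* The closure conditions make the scalar functions that occur below smooth by
   construction; [Cinf_derive] shows that nothing is lost. *)
Inductive Cinf U : (V -> R) -> Prop :=
| Cinf_smooth f : smooth_on U f -> Cinf U f
| Cinf_cst (a : R) : Cinf U (fun=> a)
| CinfD f g : Cinf U f -> Cinf U g -> Cinf U (fun z => f z + g z)
| CinfN f : Cinf U f -> Cinf U (fun z => - f z)
| CinfM f g : Cinf U f -> Cinf U g -> Cinf U (fun z => f z * g z)
| CinfV f : Cinf U f -> (forall z, U z -> f z != 0) -> Cinf U (fun z => (f z)^-1)
| Cinf_sqrt f : Cinf U f -> (forall z, U z -> 0 < f z) ->
    Cinf U (fun z => Num.sqrt (f z))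
| Cinf_exp f : Cinf U f -> Cinf U (fun z => expR (f z))
| Cinf_eq f g : (forall z, U z -> f z = g z) -> Cinf U g -> Cinf U f.

Section Rules.
Variables (f g : V -> R) (z v : V).
Hypotheses (df : differentiable f z) (dg : differentiable g z).

Lemma derive_add : 'D_v (fun y => f y + g y) z = 'D_v f z + 'D_v g z.
Proof. by apply: deriveD; apply: diff_derivable. Qed.

Lemma derive_opp : 'D_v (fun y => - f y) z = - 'D_v f z.
Proof. by apply: deriveN; apply: diff_derivable. Qed.

Lemma derive_mul :
  'D_v (fun y => f y * g y) z = f z * 'D_v g z + g z * 'D_v f z.
Proof. by apply: deriveM; apply: diff_derivable. Qed.

Lemma derive_inv : f z != 0 ->
  'D_v (fun y => (f y)^-1) z = - (f z ^- 2 * 'D_v f z).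
Proof.
by move=> f0; rewrite (deriveV f0); [exact: mulNr|exact: diff_derivable].
Qed.

Lemma derive_sqrtf : 0 < f z ->
  'D_v (fun y => Num.sqrt (f y)) z = (2 * Num.sqrt (f z))^-1 * 'D_v f z.
Proof.
move=> f0; have := @is_derive1_sqrt _ _ f0 => -[d1 d2].
by rewrite (derive_comp1 v df d1) d2.
Qed.

Lemma derive_expf : 'D_v (fun y => expR (f y)) z = expR (f z) * 'D_v f z.
Proof.
by have [d1 d2] := is_derive_expR (f z); rewrite (derive_comp1 v df d1) d2.
Qed.

End Rules.

Lemma Cinf_differentiable U f z : open U -> Cinf U f -> U z ->
  differentiable f z.
Proof.
move=> oU; elim=> {f}.
- by move=> f sf Uz; have := sf [::] z Uz.
- by move=> a _; apply: differentiable_cst.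
- by move=> f g _ IHf _ IHg Uz; apply: differentiableD; [exact: IHf|exact: IHg].
- by move=> f _ IHf Uz; apply: differentiableN; exact: IHf.
- by move=> f g _ IHf _ IHg Uz; apply: differentiableM; [exact: IHf|exact: IHg].
- by move=> f _ IHf f0 Uz; apply: differentiableV; [exact: IHf|exact: f0].
- move=> f _ IHf f0 Uz; apply: (@differentiable_comp _ _ _ _ f); first exact: IHf.
  by apply/derivable1_diffP; have [] := @is_derive1_sqrt _ _ (f0 _ Uz).
- move=> f _ IHf Uz; apply: (@differentiable_comp _ _ _ _ f); first exact: IHf.
  by apply/derivable1_diffP; case: (is_derive_expR (f z)).
- by move=> f g fg _ IHg Uz; apply: (differentiable_eq_on oU Uz fg); exact: IHg.
Qed.

Lemma smooth_on_derive (W : normedModType R) U (f : V -> W) v :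
  smooth_on U f -> smooth_on U ('D_v f).
Proof. by move=> sf vs; have := sf (rcons vs v); rewrite foldr_rcons. Qed.

Lemma Cinf_derive U f v : open U -> Cinf U f -> Cinf U ('D_v f).
Proof.
move=> oU; have dC := fun f z Cf => @Cinf_differentiable U f z oU Cf.
elim=> {f}.
- by move=> f sf; apply: Cinf_smooth; exact: smooth_on_derive.
- move=> a; apply: (Cinf_eq (g := fun=> 0)); last exact: Cinf_cst.
  by move=> z _; exact: derive_cst.
- move=> f g Cf IHf Cg IHg; apply: Cinf_eq (CinfD IHf IHg) => z Uz.
  by apply: derive_add; apply: dC.
- move=> f Cf IHf; apply: Cinf_eq (CinfN IHf) => z Uz.
  by apply: derive_opp; apply: dC.
- move=> f g Cf IHf Cg IHg.
  apply: Cinf_eq (CinfD (CinfM Cf IHg) (CinfM Cg IHf)) => z Uz.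
  by apply: derive_mul; apply: dC.
- move=> f Cf IHf f0.
  have C2 := CinfV (CinfM Cf Cf) (fun z Uz => mulf_neq0 (f0 z Uz) (f0 z Uz)).
  apply: Cinf_eq (CinfN (CinfM C2 IHf)) => z Uz.
  by rewrite derive_inv ?expr2 //; [exact: dC|exact: f0].
- move=> f Cf IHf f0.
  have s0 z : U z -> 2 * Num.sqrt (f z) != 0.
    by move=> Uz; rewrite mulf_neq0 ?pnatr_eq0 // gt_eqF // sqrtr_gt0 f0.
  have C2 := CinfV (CinfM (Cinf_cst _ 2) (Cinf_sqrt Cf f0)) s0.
  apply: Cinf_eq (CinfM C2 IHf) => z Uz.
  by apply: derive_sqrtf; [exact: dC|exact: f0].
- move=> f Cf IHf.
  apply: Cinf_eq (CinfM (Cinf_exp Cf) IHf) => z Uz.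
  by apply: derive_expf; exact: dC.
- move=> f g fg _ IHg; apply: Cinf_eq IHg => z Uz.
  exact: derive_eq_on fg.
Qed.

Lemma CinfB U f g : Cinf U f -> Cinf U g -> Cinf U (fun z => f z - g z).
Proof. by move=> Cf Cg; apply: CinfD => //; exact: CinfN. Qed.

Lemma Cinf_sum U (I : Type) (r : seq I) (F : I -> V -> R) :
  (forall i, Cinf U (F i)) -> Cinf U (fun z => \sum_(i <- r) F i z).
Proof.
move=> CF; elim: r => [|i r IH].
  by apply: Cinf_eq (Cinf_cst U 0) => z _; rewrite big_nil.
by apply: Cinf_eq (CinfD (CF i) IH) => z _; rewrite big_cons.
Qed.

Lemma Cinf_continuous U f z : open U -> Cinf U f -> U z -> {for z, continuous f}.
Proof. by move=> oU Cf Uz; apply/differentiable_continuous/Cinf_differentiable/Uz. Qed.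

End SmoothFunctions.

(** * Mean values along lines, symmetry of second derivatives, second derivative test *)

Section Lines.
Context {R : realType} {V : normedModType R}.
Implicit Types (U : set V) (f g : V -> R) (z v w : V).

Lemma deriveZv f z v (k : R) : differentiable f z ->
  'D_(k *: v) f z = k * 'D_v f z.
Proof. by move=> df; rewrite !deriveE // linearZ. Qed.

Lemma deriveDv f z v w : differentiable f z ->
  'D_(v + w) f z = 'D_v f z + 'D_w f z.
Proof. by move=> df; rewrite !deriveE // linearD. Qed.

Lemma is_derive_line f z v (h : R) : differentiable f (z + h *: v) ->
  is_derive h 1 (fun k : R => f (z + k *: v)) ('D_v f (z + h *: v)).
Proof.
move=> df; have dl : is_diff h (fun k : R => z + k *: v) (fun k : R => k *: v).
  have := @is_diffD _ _ _ (cst z) (fun k : R => k *: v) (0 : R -> V)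
    (fun k : R => k *: v) h _ _.
  by rewrite add0r; apply.
have d1 : differentiable (fun k : R => z + k *: v) h by [].
have d2 : differentiable (f \o (fun k : R => z + k *: v)) h.
  exact: differentiable_comp.
split; first exact: (diff_derivable d2).
rewrite (deriveE _ d2) diff_comp //= [X in 'd f _ (X _)]diff_val.
by rewrite scale1r -deriveE.
Qed.

Lemma MVT_line f z v :
  (forall h : R, 0 <= h <= 1 -> differentiable f (z + h *: v)) ->
  exists2 h : R, 0 <= h <= 1 & f (z + v) - f z = 'D_v f (z + h *: v).
Proof.
move=> df; pose phi h := f (z + h *: v); pose dphi h := 'D_v f (z + h *: v).
have dphiE (h : R) : h \in `]0, 1[%R -> is_derive h 1 phi (dphi h).
  rewrite in_itv /= => /andP[h0 h1]; apply: is_derive_line; apply: df.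
  by rewrite !ltW.
have cphi : {within `[(0 : R), 1], continuous phi}.
  apply: continuous_in_subspaceT => h; rewrite inE /= in_itv /= => h01.
  apply: differentiable_continuous; apply/derivable1_diffP.
  by have [] := is_derive_line (df _ h01).
have [c] := MVT (@ltr01 R) dphiE cphi.
rewrite in_itv /= => /andP[c0 c1]; rewrite subr0 mulr1 /phi /dphi.
by rewrite scale1r scale0r addr0 => E; exists c; rewrite // !ltW.
Qed.

(** The mean value theorem is applied along [v] to the increment f(. + w) - f, then along [w] to
    ['D_v f]. *)
Lemma mixed_MVT U f z v w : open U -> Cinf U f ->
  (forall a b : R, 0 <= a <= 1 -> 0 <= b <= 1 -> U (z + a *: v + b *: w)) ->
  exists a b : R, [/\ 0 <= a <= 1, 0 <= b <= 1 &
    f (z + v + w) - f (z + v) - (f (z + w) - f z) =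
    'D_w ('D_v f) (z + a *: v + b *: w)].
Proof.
move=> oU Cf HU; have dC g y : Cinf U g -> U y -> differentiable g y.
  by move=> ? ?; apply: Cinf_differentiable oU _ _.
have I0 : 0 <= (0 : R) <= 1 by lra.
have I1 : 0 <= (1 : R) <= 1 by lra.
have dsh a y : differentiable f (y + a) ->
    is_diff y (fun y => f (y + a)) ('d f (y + a)).
  move=> df; have dl : is_diff y (fun y : V => y + a) id.
    have := @is_diffD _ _ _ id (cst a) id (0 : V -> V) y _ _.
    by rewrite addr0; apply.
  have d1 : differentiable (fun y : V => y + a) y by [].
  apply: DiffDef; first exact: (@differentiable_comp _ _ _ _ (fun y : V => y + a) f).
  rewrite (@diff_comp _ _ _ _ (fun y : V => y + a) f) //=.
  by apply/funext => x /=; rewrite diff_val.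
have [a a01 Ea] : exists2 a : R, 0 <= a <= 1 &
    f (z + v + w) - f (z + v) - (f (z + w) - f z) =
    'D_v f (z + a *: v + w) - 'D_v f (z + a *: v).
  have Uw (h : R) : 0 <= h <= 1 -> U (z + h *: v + w).
    by move=> h01; have := HU h 1 h01 I1; rewrite scale1r.
  have U0 (h : R) : 0 <= h <= 1 -> U (z + h *: v).
    by move=> h01; have := HU h 0 h01 I0; rewrite scale0r addr0.
  have [h h01|h h01 ->] := @MVT_line (fun y => f (y + w) - f y) z v.
    apply: differentiableB; last by apply: dC => //; exact: U0.
    have dw := dsh w (z + h *: v) (dC _ _ Cf (Uw _ h01)); exact: ex_diff.
  exists h => //.
  have dw := dsh w (z + h *: v) (dC _ _ Cf (Uw _ h01)).
  have dw' : differentiable (fun y => f (y + w)) (z + h *: v) by exact: ex_diff.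
  rewrite derive_add; last 2 first.
  - by [].
  - by apply: differentiableN; apply: dC => //; exact: U0.
  rewrite derive_opp; last by apply: dC => //; exact: U0.
  congr (_ - _); rewrite (deriveE _ dw') diff_val deriveE //.
  by apply: dC => //; exact: Uw.
have [b b01 Eb] := @MVT_line ('D_v f) (z + a *: v) w
  (fun h h01 => dC _ _ (Cinf_derive v oU Cf) (HU a h a01 h01)).
by exists a, b; split => //; rewrite Ea Eb.
Qed.

Lemma ler_dist_half (e x y t : R) :
  `|x - y| <= e / 2 -> `|x - t| <= e / 2 -> `|y - t| <= e.
Proof. by rewrite !ler_norml => /andP[? ?] /andP[? ?]; apply/andP; split; lra. Qed.

(** The second difference of f over the parallelogram with sides h v and h w is symmetric in v and
    w. By [mixed_MVT] it is h^2 times either mixed derivative at some nearby point; continuity of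
    both at z does the rest. *)
Lemma deriveC U f z v w : open U -> Cinf U f -> U z ->
  'D_w ('D_v f) z = 'D_v ('D_w f) z.
Proof.
move=> oU Cf Uz.
have dC g y : Cinf U g -> U y -> differentiable g y.
  by move=> ? ?; apply: Cinf_differentiable oU _ _.
have C1 v' := Cinf_derive v' oU Cf.
have C2 v' w' := Cinf_derive w' oU (C1 v').
have cC v' w' := Cinf_continuous oU (C2 v' w') Uz.
apply/eqP; rewrite -subr_eq0 -normr_le0; apply/ler_addgt0Pl => e e0.
have e20 : 0 < e / 2 by rewrite divr_gt0.
have near_box v' w' : exists2 d : R, 0 < d & forall h a b : R, 0 <= h <= d ->
    0 <= a <= 1 -> 0 <= b <= 1 ->
    U (z + a *: (h *: v') + b *: (h *: w')) /\
    `|'D_w' ('D_v' f) (z + a *: (h *: v') + b *: (h *: w')) -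
      'D_w' ('D_v' f) z| <= e / 2.
  have : nbhs z [set y | U y /\ `|'D_w' ('D_v' f) y - 'D_w' ('D_v' f) z| <= e / 2].
    apply: filterI; first exact: open_nbhs_nbhs.
    have H : 'D_w' ('D_v' f) @ z --> 'D_w' ('D_v' f) z by exact: (cC v' w').
    move/cvgrPdist_le : H => /(_ _ e20) H.
    by near=> y; rewrite /= distrC; near: y; exact: H.
  move=> /nbhs_ballP[d /= d0 dB].
  (* Both displacements together then have norm at most d / 2; the summand 1 keeps the denominator
     positive when both directions vanish. *)
  exists (d / 2 / (`|v'| + `|w'| + 1)).
    by rewrite !divr_gt0 // ltr_wpDl // addr_ge0.
  move=> h a b /andP[h0 hd] /andP[a0 a1] /andP[b0 b1]; apply: dB.
  rewrite -ball_normE /= -addrA opprD addNKr normrN.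
  rewrite (@le_lt_trans _ _ (d / 2)) ?ltr_pdivrMr ?mulr_natr ?mulr2n ?ltrDl //.
  move: hd; rewrite ler_pdivlMr; last by rewrite ltr_wpDl // addr_ge0.
  apply: le_trans; rewrite (le_trans (ler_normD _ _))// !normrZ.
  rewrite (ger0_norm h0) (ger0_norm a0) (ger0_norm b0).
  have ? := normr_ge0 v'; have ? := normr_ge0 w'.
  have : a * (h * `|v'|) <= h * `|v'| by rewrite ler_piMl // mulr_ge0.
  have : b * (h * `|w'|) <= h * `|w'| by rewrite ler_piMl // mulr_ge0.
  by move=> ? ?; lra.
have [d1 d10 H1] := near_box v w; have [d2 d20 H2] := near_box w v.
pose h := Num.min d1 d2; have h0 : 0 < h by rewrite lt_min d10.
have h01 : 0 <= h <= d1 by rewrite ltW //= ge_min lexx.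
have h02 : 0 <= h <= d2 by rewrite ltW //= ge_min lexx orbT.
have [a [b [a01 b01 E1]]] := mixed_MVT oU Cf
  (fun a b a01 b01 => (H1 h a b h01 a01 b01).1).
have [a' [b' [a01' b01' E2]]] := mixed_MVT oU Cf
  (fun a b a01 b01 => (H2 h a b h02 a01 b01).1).
have [U1 B1] := H1 h a b h01 a01 b01; have [U2 B2] := H2 h a' b' h02 a01' b01'.
have sc v' w' y : U y -> 'D_(h *: w') ('D_(h *: v') f) y = h * (h * 'D_w' ('D_v' f) y).
  move=> Uy; rewrite deriveZv; last exact: (dC _ _ (Cinf_derive _ oU Cf)).
  congr (_ * _).
  rewrite (derive_eq_on w' oU Uy (g := fun y => h * 'D_v' f y)); last first.
    by move=> y' Uy'; rewrite deriveZv //; exact: dC.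
  rewrite derive_mul; [|exact: differentiable_cst|exact: dC].
  by rewrite derive_cst mulr0 addr0.
rewrite sc // in E1; rewrite sc // in E2.
have E : 'D_w ('D_v f) (z + a *: (h *: v) + b *: (h *: w)) =
         'D_v ('D_w f) (z + a' *: (h *: w) + b' *: (h *: v)).
  apply: (mulfI (lt0r_neq0 h0)); apply: (mulfI (lt0r_neq0 h0)).
  apply: etrans (esym E1) _; apply: etrans _ E2.
  by rewrite (addrAC z (h *: w) (h *: v)); ring.
by rewrite addr0; apply: ler_dist_half B2; rewrite -E.
Unshelve. all: by end_near. Qed.

Lemma exists_lt_min (a b : R) : 0 < a -> 0 < b -> exists c, [/\ 0 < c, c < a & c < b].
Proof.
move=> a0 b0; have m0 : 0 < Num.min a b by rewrite lt_min a0.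
exists (Num.min a b / 2); rewrite divr_gt0 //.
suff : Num.min a b / 2 < Num.min a b by rewrite lt_min => /andP[].
by rewrite ltr_pdivrMr // mulr_natr mulr2n ltrDl.
Qed.

(** If the second derivative were positive, ['D_v f] would be positive just after z on the line, and
    the mean value theorem would produce a larger value of f. *)
Lemma local_max_derive U f z v : open U -> Cinf U f -> U z ->
  (\forall y \near z, f y <= f z) -> 'D_v f z = 0 /\ 'D_v ('D_v f) z <= 0.
Proof.
move=> oU Cf Uz fmax.
have dC g y : Cinf U g -> U y -> differentiable g y.
  by move=> ? ?; apply: Cinf_differentiable oU _ _.
have C1 := Cinf_derive v oU Cf.
have cl : (fun h : R => z + h *: v) @ (0 : R) --> z.
  rewrite -[X in _ --> X]addr0 -(scale0r v); apply: cvgD; first exact: cvg_cst.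
  by apply: cvgZ; [exact: cvg_id|exact: cvg_cst].
have nU : nbhs z U by exact: open_nbhs_nbhs.
have /cl /nbhs_ballP[d /= d0 dB] : nbhs z [set y | U y /\ f y <= f z].
  exact: filterI.
have dBE (h : R) : - d < h < d -> U (z + h *: v) /\ f (z + h *: v) <= f z.
  by move=> hd; apply: dB; rewrite -ball_normE /= sub0r normrN ltr_norml.
have isd g (h : R) : Cinf U g -> - d < h < d ->
    is_derive h 1 (fun k : R => g (z + k *: v)) ('D_v g (z + h *: v)).
  by move=> Cg /dBE[Uh _]; apply: is_derive_line; exact: dC.
have dd0 : - d < 0 < d by rewrite d0 oppr_lt0 d0.
have E0 : 'D_v f z = 0.
  have [_] := isd f 0 Cf dd0; rewrite scale0r addr0 => <-.
  have ldd : - d <= d by rewrite ge0_cp // ltW.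
  have [||t|_ ->//] := @derive1_at_max _ (fun k : R => f (z + k *: v)) (- d) d 0 ldd.
  - by move=> t; rewrite in_itv /= => /(isd f t Cf)[].
  - by rewrite in_itv.
  - by rewrite in_itv /= scale0r addr0 => /dBE[].
split=> //; rewrite leNgt; apply/negP => D2pos.
have [dr ] := isd _ 0 C1 dd0; rewrite scale0r addr0 => dE.
pose g (h : R) := 'D_v f (z + h *: v).
have H : (fun h : R => h^-1 *: ((g \o shift 0) (h *: (1 : R)) - g 0)) @ (0 : R)^' -->
    'D_v ('D_v f) z.
  by rewrite -dE; exact: dr.
have /nbhs_ballP[d' /= d'0 d'B] : \forall h \near (0 : R),
    h != 0 -> 0 < h^-1 *: ((g \o shift 0) (h *: (1 : R)) - g 0).
  exact: (cvgr_gt _ H _ D2pos).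
clear H dr dE.
have [h [h0 hd hd']] := exists_lt_min d0 d'0.
have pos (k : R) : 0 < k <= h -> 0 < 'D_v f (z + k *: v).
  move=> /andP[k0 kh].
  have kd' : - d' < k < d'.
    apply/andP; split; last exact: le_lt_trans hd'.
    by apply: lt_trans k0; rewrite oppr_lt0.
  have /d'B /(_ (lt0r_neq0 k0)) : ball (0 : R) d' k.
    by rewrite -ball_normE /ball_ /= sub0r normrN ltr_norml.
  rewrite /= /g addr0 scale0r addr0 E0 subr0 /GRing.scale /= mulr1.
  by rewrite pmulr_rgt0 // invr_gt0.
have hdd (k : R) : 0 <= k <= h -> - d < k < d.
  move=> /andP[k0 kh]; rewrite (lt_le_trans _ k0) ?oppr_lt0 //=.
  exact: le_lt_trans hd.
have [| |c cI] := @MVT _ (fun k : R => f (z + k *: v))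
   (fun k : R => 'D_v f (z + k *: v)) 0 h h0.
- move=> k; rewrite in_itv /= => /andP[k0 kh]; apply: isd => //.
  by apply: hdd; rewrite !ltW.
- apply: continuous_in_subspaceT => k; rewrite inE /= in_itv /= => kI.
  apply: differentiable_continuous; apply/derivable1_diffP.
  by have [] := isd _ _ Cf (hdd _ kI).
move: cI; rewrite in_itv /= => /andP[c0 ch].
rewrite scale0r addr0 subr0 => E.
have /dBE[_] : - d < h < d by apply: hdd; rewrite lexx ltW.
by rewrite -subr_le0 E leNgt mulr_gt0 // pos // c0 ltW.
Qed.

End Lines.

(** * Commuting frames on plane domains *)

(* Locked, since comparing two directional derivatives by unfolding diverges. *)
HB.lock Definition ds (R : realType) (W : normedModType R) (f : R * R -> W) :
  R * R -> W := 'D_((1, 0) : R * R) f.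
HB.lock Definition dt (R : realType) (W : normedModType R) (f : R * R -> W) :
  R * R -> W := 'D_((0, 1) : R * R) f.

Section Plane.
Context {R : realType}.
Implicit Types (U : set (R * R)) (f g h : R * R -> R) (z : R * R).

Lemma derive_dsdt f z (v : R * R) : differentiable f z ->
  'D_v f z = v.1 * ds f z + v.2 * dt f z.
Proof.
move=> df; have -> : v = v.1 *: ((1, 0) : R * R) + v.2 *: ((0, 1) : R * R).
  case: v => a b; congr (_, _); rewrite /= /GRing.scale /= ?mulr0 ?mulr1 ?addr0 ?add0r //.
by rewrite ds.unlock dt.unlock deriveDv // !deriveZv //= /GRing.scale /= !mulr0 !mulr1
  addr0 add0r.
Qed.

Lemma derive_lin2 (a b c d : R * R -> R) z (v : R * R) : differentiable a z ->
  differentiable b z -> differentiable c z -> differentiable d z ->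
  'D_v (fun y => a y * b y + c y * d y : R) z =
  a z * 'D_v b z + b z * 'D_v a z + (c z * 'D_v d z + d z * 'D_v c z).
Proof.
by move=> *; rewrite derive_add ?derive_mul//; exact: differentiableM.
Qed.

Record coframe := Coframe { xs : R * R -> R; xt : R * R -> R;
                            es : R * R -> R; et : R * R -> R }.
Implicit Type k : coframe.

Definition cdet k z := xs k z * et k z - xt k z * es k z.

Definition closed_coframe U k :=
  [/\ Cinf U (xs k) /\ Cinf U (xt k), Cinf U (es k) /\ Cinf U (et k),
      forall z, U z -> dt (xs k) z = ds (xt k) z,
      forall z, U z -> dt (es k) z = ds (et k) z &
      forall z, U z -> 0 < cdet k z].

(* The frame D1 = fd k true, D2 = fd k false is dual to the coframe
   dxi = xs ds + xt dt, deta = es ds + et dt; it commutes because the coframe is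
   closed, so lap is the Laplacian of the flat metric dxi^2 + deta^2. *)
Definition fa k (i : bool) z := (if i then et k z else - xt k z) / cdet k z.
Definition fb k (i : bool) z := (if i then - es k z else xs k z) / cdet k z.
Definition fd k i f z := fa k i z * ds f z + fb k i z * dt f z.
Definition lap k f z := fd k true (fd k true f) z + fd k false (fd k false f) z.
Definition gdot k f g z :=
  fd k true f z * fd k true g z + fd k false f z * fd k false g z.
Definition gsq k f z := gdot k f f z.
Definition frame_harmonic U k f := Cinf U f /\ forall z, U z -> lap k f z = 0.

Section Frame.
Context {U : set (R * R)} {k : coframe}.
Hypotheses (oU : open U) (clk : closed_coframe U k).

Let cdet_gt0 z : U z -> 0 < cdet k z. Proof. by case: clk => _ _ _ _; apply. Qed.
Let cdet_neq0 z : U z -> cdet k z != 0.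
Proof. by move=> Uz; rewrite gt_eqF ?cdet_gt0. Qed.

Lemma Cinf_cdet : Cinf U (cdet k).
Proof. by case: clk => -[? ?] [? ?] _ _ _; apply: CinfB; apply: CinfM. Qed.

Lemma Cinf_fa i : Cinf U (fa k i).
Proof.
case: clk => -[? ?] [? ?] _ _ _; apply: CinfM; last exact: (CinfV Cinf_cdet).
by case: i => //; apply: CinfN.
Qed.

Lemma Cinf_fb i : Cinf U (fb k i).
Proof.
case: clk => -[? ?] [? ?] _ _ _; apply: CinfM; last exact: (CinfV Cinf_cdet).
by case: i => //; apply: CinfN.
Qed.

Lemma Cinf_fd i f : Cinf U f -> Cinf U (fd k i f).
Proof.
move=> Cf; apply: CinfD; apply: CinfM; [exact: Cinf_fa| |exact: Cinf_fb|];
by rewrite ?ds.unlock ?dt.unlock; exact: Cinf_derive.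
Qed.

Lemma Cinf_gdot f g : Cinf U f -> Cinf U g -> Cinf U (gdot k f g).
Proof. by move=> Cf Cg; apply: CinfD; apply: CinfM; apply: Cinf_fd. Qed.

Lemma Cinf_lap f : Cinf U f -> Cinf U (lap k f).
Proof. by move=> Cf; apply: CinfD; do 2 apply: Cinf_fd. Qed.

Let dC f z : Cinf U f -> U z -> differentiable f z.
Proof. by move=> Cf Uz; apply: Cinf_differentiable oU Cf Uz. Qed.

Lemma fd_eq i f g z : (forall y, U y -> f y = g y) -> U z -> fd k i f z = fd k i g z.
Proof. by move=> fg Uz; rewrite /fd ds.unlock dt.unlock !(derive_eq_on _ oU Uz fg). Qed.

Lemma fdD i f g z : Cinf U f -> Cinf U g -> U z ->
  fd k i (fun y => f y + g y) z = fd k i f z + fd k i g z.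
Proof.
by move=> Cf Cg Uz; rewrite /fd ds.unlock dt.unlock !derive_add; first ring; exact: dC.
Qed.

Lemma fdN i f z : Cinf U f -> U z -> fd k i (fun y => - f y) z = - fd k i f z.
Proof. by move=> Cf Uz; rewrite /fd ds.unlock dt.unlock !derive_opp; first ring; exact:
  dC. Qed.

Lemma fd_cst i (a : R) z : fd k i (fun=> a) z = 0.
Proof. by rewrite /fd ds.unlock dt.unlock !derive_cst !mulr0 addr0. Qed.

Lemma fdM i f g z : Cinf U f -> Cinf U g -> U z ->
  fd k i (fun y => f y * g y) z = f z * fd k i g z + g z * fd k i f z.
Proof.
by move=> Cf Cg Uz; rewrite /fd ds.unlock dt.unlock !derive_mul; first ring; exact: dC.
Qed.

Lemma fd_exp i f z : Cinf U f -> U z ->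
  fd k i (fun y => expR (f y)) z = expR (f z) * fd k i f z.
Proof.
by move=> Cf Uz; rewrite /fd ds.unlock dt.unlock !derive_expf; first ring; exact: dC.
Qed.

(** The coefficient of ds in df = (D1 f) dxi + (D2 f) deta. *)
Lemma dsE f z : U z -> ds f z = fd k true f z * xs k z + fd k false f z * es k z.
Proof.
move=> Uz; have := cdet_neq0 Uz; rewrite /fd /fa /fb /cdet => D0; field.
exact: D0.
Qed.

Lemma dtE f z : U z -> dt f z = fd k true f z * xt k z + fd k false f z * et k z.
Proof.
move=> Uz; have := cdet_neq0 Uz; rewrite /fd /fa /fb /cdet => D0; field.
exact: D0.
Qed.

(** Since dxi and deta are closed, d(df) = 0 reads (D1 D2 f - D2 D1 f) dxi /\ deta = 0. *)
Lemma fdC f z : Cinf U f -> U z ->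
  fd k true (fd k false f) z = fd k false (fd k true f) z.
Proof.
case: (clk) => -[Cxs Cxt] [Ces Cet] clx cle _ Cf Uz.
have C1 := Cinf_fd true Cf; have C2 := Cinf_fd false Cf.
have E : dt (ds f) z = ds (dt f) z by rewrite ds.unlock dt.unlock; exact: (deriveC _ _
  oU Cf Uz).
set g1 := fd k true f in C1 *; set g2 := fd k false f in C2 *.
have Es : dt (ds f) z = g1 z * dt (xs k) z + xs k z * dt g1 z
                      + (g2 z * dt (es k) z + es k z * dt g2 z).
  have -> : dt (ds f) z =
      'D_((0, 1) : R * R) (fun y => g1 y * xs k y + g2 y * es k y) z.
    by rewrite dt.unlock; exact: (derive_eq_on _ oU Uz (dsE f)).
  by rewrite ?ds.unlock ?dt.unlock; apply: derive_lin2; exact: dC.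
have Et : ds (dt f) z = g1 z * ds (xt k) z + xt k z * ds g1 z
                      + (g2 z * ds (et k) z + et k z * ds g2 z).
  have -> : ds (dt f) z =
      'D_((1, 0) : R * R) (fun y => g1 y * xt k y + g2 y * et k y) z.
    by rewrite ds.unlock; exact: (derive_eq_on _ oU Uz (dtE f)).
  by rewrite ?ds.unlock ?dt.unlock; apply: derive_lin2; exact: dC.
move: E; rewrite Es Et clx // cle // => E.
rewrite -/g1 -/g2; move: g1 g2 E {C1 C2 Es Et} => g1 g2 E.
have := cdet_neq0 Uz; rewrite /fd /fa /fb; move: E.
move: (ds g1 z) (ds g2 z) (dt g1 z) (dt g2 z) (ds (xt k) z) (ds (et k) z).
move: (g1 z) (g2 z) (xs k z) (xt k z) (es k z) (et k z) (cdet k z).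
move=> u1 u2 a1 a2 b1 b2 D p1 p2 q1 q2 r1 r2 E D0.
apply: (mulfI D0); transitivity (b2 * p2 - b1 * q2); first by field.
by transitivity (a1 * q1 - a2 * p1); [lra|field].
Qed.

End Frame.
End Plane.
Arguments coframe R : clear implicits.

(** * The maximum principle in a commuting frame *)

Section MaximumPrinciple.
Context {R : realType} {U : set (R * R)} {k : coframe R}.
Hypotheses (oU : open U) (clk : closed_coframe U k).
Implicit Types (f g v psi : R * R -> R) (z p : R * R).

Let Cfd i f : Cinf U f -> Cinf U (fd k i f).
Proof. exact: Cinf_fd. Qed.

Lemma fd_fdM i f g z : Cinf U f -> Cinf U g -> U z ->
  fd k i (fd k i (fun y => f y * g y)) z =
  f z * fd k i (fd k i g) z + g z * fd k i (fd k i f) z + 2 * (fd k i f z * fd k i g z).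
Proof.
move=> Cf Cg Uz; rewrite (fd_eq oU i (fun y => fdM oU i Cf Cg) Uz).
have C1 := Cfd i Cf; have C2 := Cfd i Cg.
rewrite (fdD oU i (CinfM Cf C2) (CinfM Cg C1) Uz).
by rewrite (fdM oU i Cf C2 Uz) (fdM oU i Cg C1 Uz); ring.
Qed.

Lemma lapM f g z : Cinf U f -> Cinf U g -> U z ->
  lap k (fun y => f y * g y) z = f z * lap k g z + g z * lap k f z + 2 * gdot k f g z.
Proof. by move=> Cf Cg Uz; rewrite /lap /gdot !fd_fdM //; ring. Qed.

Lemma lapD f g z : Cinf U f -> Cinf U g -> U z ->
  lap k (fun y => f y + g y) z = lap k f z + lap k g z.
Proof.
move=> Cf Cg Uz; rewrite /lap !(fd_eq oU _ (fun y => fdD oU _ Cf Cg) Uz).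
by rewrite !(fdD oU _ (Cfd _ Cf) (Cfd _ Cg) Uz); ring.
Qed.

Lemma lapN f z : Cinf U f -> U z -> lap k (fun y => - f y) z = - lap k f z.
Proof.
move=> Cf Uz; rewrite /lap !(fd_eq oU _ (fun y => fdN oU _ Cf) Uz).
by rewrite !(fdN oU _ (Cfd _ Cf) Uz); ring.
Qed.

Lemma lap_cst (a : R) z : U z -> lap k (fun=> a) z = 0.
Proof.
move=> Uz; rewrite /lap !(fd_eq oU _ (fun y _ => fd_cst _ _ _) Uz).
by rewrite !fd_cst addr0.
Qed.

Lemma lap_exp f z : Cinf U f -> U z ->
  lap k (fun y => expR (f y)) z = expR (f z) * (lap k f z + gsq k f z).
Proof.
move=> Cf Uz; rewrite /lap /gsq /gdot !(fd_eq oU _ (fun y => fd_exp oU _ Cf) Uz).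
by rewrite !(fdM oU _ (Cinf_exp Cf) (Cfd _ Cf) Uz) !(fd_exp oU _ Cf Uz); ring.
Qed.

(** At a critical point the derivatives of the frame coefficients are multiplied by 0, so D_i D_i f
    is the second derivative along the constant vector [e], to which the second derivative test
    applies. *)
Lemma local_max_frame f p : Cinf U f -> U p -> (\forall y \near p, f y <= f p) ->
  (forall i, fd k i f p = 0) /\ lap k f p <= 0.
Proof.
move=> Cf Up fmax.
have dC g z : Cinf U g -> U z -> differentiable g z.
  by move=> Cg Uz; exact: Cinf_differentiable oU Cg Uz.
have ds0 : ds f p = 0 by rewrite ds.unlock (local_max_derive _ oU Cf Up fmax).1.
have dt0 : dt f p = 0 by rewrite dt.unlock (local_max_derive _ oU Cf Up fmax).1.
have Cs : Cinf U (ds f) by rewrite ds.unlock; exact: Cinf_derive.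
have Ct : Cinf U (dt f) by rewrite dt.unlock; exact: Cinf_derive.
have fd0 i : fd k i f p = 0.
  by rewrite /fd ds0 dt0 !mulr0 addr0.
split => //.
suff H i : fd k i (fd k i f) p <= 0 by rewrite /lap -[leRHS]addr0 lerD.
pose a := fa k i p; pose b := fb k i p; pose e : R * R := (a, b).
have [_] := local_max_derive e oU Cf Up fmax; apply: le_trans.
rewrite le_eqVlt; apply/orP; left; apply/eqP.
have -> : fd k i (fd k i f) p = 'D_e (fd k i f) p.
  by rewrite derive_dsdt //; exact/dC/Up/Cfd.
have -> : 'D_e ('D_e f) p = 'D_e (fun y => a * ds f y + b * dt f y) p.
  apply: (derive_eq_on _ oU Up) => y Uy.
  by rewrite derive_dsdt //; exact: dC.
have Ca := Cinf_fa clk i; have Cb := Cinf_fb clk i.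
rewrite !derive_lin2; try exact: dC; try exact: differentiable_cst.
by rewrite ds0 dt0 !mul0r !addr0.
Qed.

Section Harmonic.
Variables (v : R * R -> R).
Hypothesis hv : frame_harmonic U k v.

Let Cv : Cinf U v. Proof. by case: hv. Qed.

(* gsq k v = |f|^2 for f = D1 v - i D2 v, a holomorphic function of xi + i eta;
   A and B are the real and (up to sign) imaginary parts of f'. *)
Lemma gsq_harmonic z : U z -> exists A B : R,
  [/\ fd k true (gsq k v) z = 2 * (fd k true v z * A + fd k false v z * B),
      fd k false (gsq k v) z = 2 * (fd k true v z * B - fd k false v z * A) &
      lap k (gsq k v) z = 4 * (A ^+ 2 + B ^+ 2)].
Proof.
move=> Uz; set v1 := fd k true v; set v2 := fd k false v.
have C1 : Cinf U v1 by exact: Cfd.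
have C2 : Cinf U v2 by exact: Cfd.
have v12 y : U y -> fd k true v2 y = fd k false v1 y by exact: (fdC oU clk Cv).
have v22 y : U y -> fd k false v2 y = - fd k true v1 y.
  by move=> Uy; have := hv.2 y Uy; rewrite /lap -/v1 -/v2 => /eqP; rewrite addrC
    addr_eq0 => /eqP.
(* [v12] and [v22] are the Cauchy-Riemann equations of f; with commutation they make both components
   harmonic. *)
have L1 : lap k v1 z = 0.
  rewrite /lap -(fd_eq oU false v12 Uz) -(fdC oU clk C2 Uz) (fd_eq oU true v22 Uz).
  by rewrite (fdN oU _ (Cfd _ C1) Uz) addrN.
have L2 : lap k v2 z = 0.
  rewrite /lap (fd_eq oU true v12 Uz) (fdC oU clk C1 Uz) (fd_eq oU false v22 Uz).
  by rewrite (fdN oU _ (Cfd _ C1) Uz) addrN.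
exists (fd k true v1 z), (fd k false v1 z).
have Cm w : Cinf U w -> Cinf U (fun y => w y * w y) by move=> ?; exact: CinfM.
have E i : fd k i (gsq k v) z = 2 * (v1 z * fd k i v1 z + v2 z * fd k i v2 z).
  rewrite (fdD oU i (Cm _ C1) (Cm _ C2) Uz).
  by rewrite (fdM oU i C1 C1 Uz) (fdM oU i C2 C2 Uz); ring.
rewrite !E v12 // v22 //; split; [ring|ring|].
rewrite (lapD (Cm _ C1) (Cm _ C2) Uz) (lapM C1 C1 Uz) (lapM C2 C2 Uz).
by rewrite L1 L2 /gdot v12 // v22 //; ring.
Qed.

(* Since log |f|^2 is subharmonic, so is |f|^2 e^psi for subharmonic psi. *)
Lemma no_local_max_weight psi (p : R * R) : Cinf U psi -> U p -> 0 < lap k psi p ->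
  0 < gsq k v p -> ~ (\forall y \near p,
    gsq k v y * expR (psi y) <= gsq k v p * expR (psi p)).
Proof.
move=> Cpsi Up psi0 w0 /local_max_frame [||_].
- by apply: CinfM; [exact: Cinf_gdot|exact: Cinf_exp].
- by [].
have Cw : Cinf U (gsq k v) by exact: Cinf_gdot.
have [A [B [w1 w2 Lw]]] := gsq_harmonic Up.
rewrite (lapM Cw (Cinf_exp Cpsi) Up) (lap_exp Cpsi Up) /gdot !(fd_exp oU _ Cpsi Up) w1
  w2 Lw.
rewrite leNgt => /negP; apply.
move: w0; rewrite /gsq /gdot.
move: (fd k true v p) (fd k false v p) (fd k true psi p) (fd k false psi p) => a b c d.
have := expR_gt0 (psi p); move: (expR _) (lap k psi p) psi0 => E L L0 E0 w0.
(* The two squares add up to |2 f' + f (D1 psi - i D2 psi)|^2, so the Laplacian is at least e^psi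
   |f|^2 times that of psi. *)
rewrite (_ : _ + _ = E * ((a * a + b * b) * L +
  ((2 * A + a * c - b * d) ^+ 2 + (2 * B + b * c + a * d) ^+ 2))); last by ring.
by rewrite mulr_gt0 // ltr_wpDr ?mulr_gt0 // addr_ge0 // sqr_ge0.
Qed.

End Harmonic.
End MaximumPrinciple.

(** * Euclidean discs in the parameter plane, compactness, exponential comparison *)

Section Coordinates.
Context {R : realType}.
Implicit Types (U : set (R * R)) (c z : R * R).

Lemma is_diff_fst z : is_diff z (fst : R * R -> R) fst.
Proof.
have cf : continuous (fst : R * R -> R) by move=> y; exact: cvg_fst.
by apply: DiffDef; [exact: linear_differentiable|rewrite diff_lin].
Qed.

Lemma is_diff_snd z : is_diff z (snd : R * R -> R) snd.
Proof.
have cf : continuous (snd : R * R -> R) by move=> y; exact: cvg_snd.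
by apply: DiffDef; [exact: linear_differentiable|rewrite diff_lin].
Qed.

Lemma smooth_on_affine (V : normedModType R) U (f : R * R -> V) (L : R * R -> V) :
  (forall z, is_diff z f L) -> smooth_on U f.
Proof.
move=> fL vs z _.
have H : foldr (fun v g => 'D_v g) f vs = f \/
    exists a : V, foldr (fun v g => 'D_v g) f vs = fun=> a.
  elim: vs => [|v vs IH] /=; first by left.
  case: IH => [->|[a ->]].
  - right; exists (L v); apply/funext => y.
    by rewrite deriveE ?diff_val //; exact: ex_diff.
  - by right; exists 0; apply/funext => y; exact: derive_cst.
by case: H => [->|[c ->]]; [exact: ex_diff|exact: differentiable_cst].
Qed.

Lemma Cinf_fst U : Cinf U fst.
Proof. by apply: Cinf_smooth; apply: smooth_on_affine => z; exact: is_diff_fst. Qed.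

Lemma Cinf_snd U : Cinf U snd.
Proof. by apply: Cinf_smooth; apply: smooth_on_affine => z; exact: is_diff_snd. Qed.

Lemma ds_fst z : ds (fst : R * R -> R) z = 1.
Proof.
have d := is_diff_fst z.
by rewrite ds.unlock deriveE ?diff_val //; exact: ex_diff.
Qed.
Lemma dt_fst z : dt (fst : R * R -> R) z = 0.
Proof.
have d := is_diff_fst z.
by rewrite dt.unlock deriveE ?diff_val //; exact: ex_diff.
Qed.
Lemma ds_snd z : ds (snd : R * R -> R) z = 0.
Proof.
have d := is_diff_snd z.
by rewrite ds.unlock deriveE ?diff_val //; exact: ex_diff.
Qed.
Lemma dt_snd z : dt (snd : R * R -> R) z = 1.
Proof.
have d := is_diff_snd z.
by rewrite dt.unlock deriveE ?diff_val //; exact: ex_diff.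
Qed.

(** The norm of [R * R] is the sup norm; barriers need a smooth function with round level sets,
    hence the square of the Euclidean distance. *)
Definition sqd c z := (z.1 - c.1) * (z.1 - c.1) + (z.2 - c.2) * (z.2 - c.2).

Lemma Cinf_sqd U c : Cinf U (sqd c).
Proof.
by apply: CinfD; apply: CinfM; apply: CinfB;
  (exact: Cinf_fst || exact: Cinf_snd || exact: Cinf_cst).
Qed.

Lemma sqd_ge0 c z : 0 <= sqd c z.
Proof. by rewrite addr_ge0 // -expr2 sqr_ge0. Qed.

Lemma Cinf_setT_continuous (f : R * R -> R) : Cinf setT f -> continuous f.
Proof. by move=> Cf z; apply: (Cinf_continuous openT Cf). Qed.

Lemma open_lt_Cinf (f : R * R -> R) (a : R) : Cinf setT f -> open [set z | f z < a].
Proof.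
move=> /Cinf_setT_continuous cf.
apply: (@open_comp _ _ f [set x | x < a]); [by move=> z _; exact: cf|exact: open_lt].
Qed.

Lemma closed_le_Cinf (f : R * R -> R) (a : R) : Cinf setT f -> closed [set z | f z <= a].
Proof.
move=> /Cinf_setT_continuous cf.
apply: (@closed_comp _ _ f [set x | x <= a]); [by move=> z _; exact: cf|exact: closed_le].
Qed.

Lemma compact_sqd c (r : R) : compact [set z | sqd c z <= r].
Proof.
(* The half-width |r| + 1 is a crude substitute for sqrt r: its square exceeds r for every real
   r. *)
pose I (a : R) := [set x : R | x \in `[a - (`|r| + 1), a + (`|r| + 1)]].
have K : compact (I c.1 `*` I c.2).
  by apply: compact_setX; exact: segment_compact.
apply: subclosed_compact K _; first exact: closed_le_Cinf (Cinf_sqd _ _).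
have key (x y : R) : x * x + y * y <= r -> `|x| <= `|r| + 1.
  move=> H; rewrite -(ler_pXn2r (n := 2)) ?nnegrE ?addr_ge0 // real_normK ?num_real //.
  have := ler_norm r; have := normr_ge0 r; have := sqr_ge0 y.
  by move: `|r| => s *; nra.
move=> z /= Hz; rewrite /I /= !in_itv /= -!lter_distl; split.
  exact: key Hz.
by apply: (key _ (z.1 - c.1)); rewrite addrC.
Qed.

Lemma compact_max U (K : set (R * R)) (f : R * R -> R) : open U -> Cinf U f ->
  compact K -> K `<=` U -> K !=set0 -> exists2 p, K p & forall z, K z -> f z <= f p.
Proof.
move=> oU Cf cK KU K0.
have [|p] := compact_EVT_max K0 cK (f := f).
  apply: continuous_in_subspaceT => z; rewrite inE => /KU Uz.
  exact: Cinf_continuous oU Cf Uz.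
rewrite inE => Kp H; exists p => // z Kz; apply: H; rewrite inE //.
Qed.

(** This carries out the passage N --> oo. If c were positive, N = C / (c d) and 1 + t <= e^t would
    give c e^(N d) >= c + C > C. *)
Lemma expR_scale_bounded (c C d : R) : 0 < d ->
  (forall N, 0 < N -> c * expR (N * d) <= C) -> c <= 0.
Proof.
move=> d0 H; rewrite leNgt; apply/negP => c0.
have C0 : 0 < C by apply: lt_le_trans (H 1 ltr01); rewrite mulr_gt0 ?expR_gt0.
have := H (C / (c * d)); rewrite divr_gt0 ?mulr_gt0 // => /(_ isT).
apply/negP; rewrite -ltNge.
have := @expR_ge1Dx R (C / (c * d) * d); rewrite -(ler_pM2l c0); apply: lt_le_trans.
have -> : c * (1 + C / (c * d) * d) = c + C; last by rewrite ltrDr.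
by field; rewrite !gt_eqF.
Qed.

End Coordinates.

(** * Gradient bound, weighted decay, unique continuation *)

Section Estimates.
Context {R : realType} {U : set (R * R)} {k : coframe R}.
Hypotheses (oU : open U) (clk : closed_coframe U k).
Implicit Types (f g v psi : R * R -> R) (z p : R * R).

Lemma gsq_ge0 f z : 0 <= gsq k f z.
Proof. by rewrite addr_ge0 // -expr2 sqr_ge0. Qed.

(* The relations D1 x + D2 y = 1 and D2 x = D1 y of the frame dual to
   dx - *dy, dy + *dx. *)
Definition expanding_frame (x y : R * R -> R) := forall z, U z ->
  [/\ fd k true x z + fd k false y z = 1, fd k false x z = fd k true y z &
      0 < fd k true x z * fd k false y z - fd k false x z * fd k true y z].

(* Completing squares in Delta (phi^2 w + 7 v^2). *)
Lemma gradient_estimate_algebra (a b A B X Y x1 x2 y1 y2 : R) :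
  let f := 1 - X * X - Y * Y in
  let f1 := - (2 * X * x1) - 2 * Y * y1 in let f2 := - (2 * X * x2) - 2 * Y * y2 in
  let w := a * a + b * b in
  0 < w -> 0 < f -> x1 + y2 = 1 -> x2 = y1 -> 0 < x1 * y2 - x2 * y1 ->
  0 < f * f * (4 * (A ^+ 2 + B ^+ 2))
    + w * (2 * (f * (- 2 * (x1 * x1 + x2 * x2 + (y1 * y1 + y2 * y2)))) + 2 * (f1 * f1 +
      f2 * f2))
    + 2 * (2 * (f * f1) * (2 * (a * A + b * B)) + 2 * (f * f2) * (2 * (a * B - b * A)))
    + 14 * w.
Proof.
move=> f f1 f2 w w0 f0 E1 E2 E3.
set S := x1 * x1 + x2 * x2 + (y1 * y1 + y2 * y2).
have f_le1 : f <= 1 by rewrite /f; nra.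
(* For a symmetric matrix the sum of the squared entries is trace^2 - 2 det; the trace is 1 and the
   determinant positive. *)
have S_le1 : S <= 1.
  have -> : S = 1 - 2 * (x1 * y2 - x2 * y1).
    by rewrite /S (_ : y2 = 1 - x1) ?E2; [ring|lra].
  lra.
have S_ge0 : 0 <= S by rewrite /S; nra.
have XY : X * X + Y * Y <= 1 by rewrite /f in f0; lra.
have XY0 : 0 <= X * X + Y * Y by nra.
(* Cauchy-Schwarz for the gradient of the cut-off, with |(X, Y)| <= 1 and [S] <= 1. *)
have fS : f1 * f1 + f2 * f2 <= 4.
  have CS : f1 * f1 + f2 * f2 <= 4 * ((X * X + Y * Y) * S).
    rewrite -subr_ge0 (_ : _ - _ = 4 * ((X * y1 - Y * x1) ^+ 2 + (X * y2 - Y * x2) ^+ 2)).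
      by rewrite mulr_ge0 // addr_ge0 // sqr_ge0.
    by rewrite /S /f1 /f2; ring.
  apply: le_trans CS _; rewrite -[leRHS]mulr1 ler_pM2l //.
  by rewrite -[leRHS]mulr1 ler_pM.
(* Besides the squares there remains w times 14 - 4 f S - 2 |grad f|^2, at least 14 - 4 - 8 = 2; the
   14 is twice the constant 7 of the estimate. *)
rewrite (_ : _ + _ = 4 * ((f * A + (f1 * a - f2 * b)) ^+ 2
                         + (f * B + (f1 * b + f2 * a)) ^+ 2)
   + w * (14 - 4 * (f * S) - 2 * (f1 * f1 + f2 * f2))); last first.
  by rewrite /w -/S; ring.
have fS1 : f * S <= 1 by rewrite -[leRHS]mulr1 ler_pM // ltW.
apply: ltr_wpDl; first by rewrite mulr_ge0 // addr_ge0 // sqr_ge0.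
by rewrite mulr_gt0 //; lra.
Qed.

(** Bernstein's method: maximize phi^2 |f|^2 + 7 v^2 over D. Where phi and f are nonzero the point
    is interior and the Laplacian is positive, which is impossible at a maximum; so the maximum
    value is 7 v^2 alone, and it dominates the value |f|^2 + 7 v^2 at [z0]. *)
Lemma gradient_estimate (x y : R * R -> R) v (D : set (R * R)) z0 :
  frame_harmonic U k x -> frame_harmonic U k y -> frame_harmonic U k v ->
  expanding_frame x y ->
  let phi z := 1 - (x z - x z0) * (x z - x z0) - (y z - y z0) * (y z - y z0) in
  compact D -> D `<=` U -> D z0 -> (forall z, D z -> 0 <= phi z) ->
  (forall z, D z -> 0 < phi z -> \forall z' \near z, D z') ->
  exists2 p, D p & gsq k v z0 <= 7 * (v p * v p).
Proof.
move=> hx hy hv fxy phi cD DU Dz0 phi0 Dopen.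
have [[Cx Lx] [Cy Ly] [Cv Lv]] := And3 hx hy hv.
have Cx0 : Cinf U (fun z => x z - x z0) by apply: CinfB => //; exact: Cinf_cst.
have Cy0 : Cinf U (fun z => y z - y z0) by apply: CinfB => //; exact: Cinf_cst.
have C1 := Cinf_cst U (1 : R).
have Cxx := CinfM Cx0 Cx0; have Cyy := CinfM Cy0 Cy0.
have CNx := CinfN Cxx; have CNy := CinfN Cyy.
have Cp1 := CinfD C1 CNx.
have Cphi : Cinf U phi := CinfD Cp1 CNy.
have Cphi2 := CinfM Cphi Cphi.
have Cw : Cinf U (gsq k v) by exact: Cinf_gdot.
have Cpw := CinfM Cphi2 Cw; have Cvv := CinfM Cv Cv.
have C7 := Cinf_cst U (7 : R); have C7v := CinfM C7 Cvv.
pose Psi z := phi z * phi z * gsq k v z + 7 * (v z * v z).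
have CPsi : Cinf U Psi := CinfD Cpw C7v.
have [p Dp pmax] := compact_max oU CPsi cD DU (ex_intro _ z0 Dz0).
exists p => //.
have Psi0 : gsq k v z0 <= Psi p.
  apply: le_trans (pmax _ Dz0); rewrite /Psi /phi !subrr !mulr0 !subr0 !mul1r.
  by rewrite lerDl mulr_ge0 // -expr2 sqr_ge0.
apply: le_trans Psi0 _.
have Up := DU _ Dp.
have [w0|w0] := eqVneq (gsq k v p) 0; first by rewrite /Psi w0 mulr0 add0r.
have wpos : 0 < gsq k v p by rewrite lt_neqAle eq_sym w0 gsq_ge0.
have := phi0 p Dp; rewrite le_eqVlt => /predU1P[E|phip].
  by rewrite /Psi -E !mul0r add0r.
have /(local_max_frame oU clk CPsi Up) [_] : \forall z \near p, Psi z <= Psi p.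
  by near=> z; apply: pmax; near: z; exact: Dopen.
rewrite (lapD oU clk Cpw C7v Up) (lapM oU clk Cphi2 Cw Up) (lapM oU clk Cphi Cphi Up).
rewrite (lapM oU clk C7 Cvv Up) (lapM oU clk Cv Cv Up) (lap_cst oU _ Up) (Lv _ Up).
have fdphi i : fd k i phi p = - (2 * (x p - x z0) * fd k i x p)
                              - 2 * (y p - y z0) * fd k i y p.
  rewrite (fdD oU i Cp1 CNy Up) (fdD oU i C1 CNx Up) fd_cst.
  rewrite (fdN oU i Cxx Up) (fdN oU i Cyy Up) (fdM oU i Cx0 Cx0 Up) (fdM oU i Cy0 Cy0 Up).
  rewrite (fdD oU i Cx (Cinf_cst U _) Up) (fdD oU i Cy (Cinf_cst U _) Up).
  by rewrite !fd_cst; ring.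
have lapphi : lap k phi p = - 2 * (gsq k x p + gsq k y p).
  rewrite (lapD oU clk Cp1 CNy Up) (lapD oU clk C1 CNx Up) (lap_cst oU _ Up).
  rewrite (lapN oU clk Cxx Up) (lapN oU clk Cyy Up).
  rewrite (lapM oU clk Cx0 Cx0 Up) (lapM oU clk Cy0 Cy0 Up).
  rewrite (lapD oU clk Cx (Cinf_cst U _) Up) (lapD oU clk Cy (Cinf_cst U _) Up).
  rewrite !(lap_cst oU _ Up) Lx // Ly // /gsq /gdot.
  rewrite !(fdD oU _ Cx (Cinf_cst U _) Up) !(fdD oU _ Cy (Cinf_cst U _) Up) !fd_cst.
  by ring.
have [A [B [w1 w2 Lw]]] := gsq_harmonic oU clk hv Up.
rewrite lapphi /gdot !(fdM oU _ Cphi Cphi Up) !fdphi w1 w2 Lw !fd_cst.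
have [E1 E2 E3] := fxy p Up.
have := @gradient_estimate_algebra (fd k true v p) (fd k false v p) A B
  (x p - x z0) (y p - y z0) _ _ _ _ wpos phip E1 E2 E3.
move=> pos; rewrite leNgt => /negP; case; apply: lt_le_trans pos _.
rewrite le_eqVlt; apply/orP; left; apply/eqP.
by rewrite /gsq /gdot /phi; ring.
Unshelve. all: by end_near. Qed.


(* Weights e^(N psi), N --> oo, against the boundary values of |f|^2. *)
Lemma gsq_le_weighted v psi (D B : set (R * R)) (M b : R) :
  frame_harmonic U k v -> Cinf U psi -> D `<=` U ->
  (forall p, D p -> ~ B p -> gsq k v p != 0 -> 0 < lap k psi p) ->
  (forall p, D p -> ~ B p -> \forall z \near p, D z) ->
  (forall p, B p -> psi p <= b) -> (forall p, B p -> gsq k v p <= M) ->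
  (forall z (N : R), 0 < N -> D z -> 0 < gsq k v z -> exists K : set (R * R),
    [/\ compact K, K `<=` D, K z &
        forall p, D p -> gsq k v z * expR (N * psi z) <= gsq k v p * expR (N * psi p)
          -> K p]) ->
  forall z, D z -> b < psi z -> gsq k v z = 0.
Proof.
move=> hv Cpsi DU psi0 Dopen psib wM HK z Dz bz.
have [//|w0] := eqVneq (gsq k v z) 0.
have wpos : 0 < gsq k v z by rewrite lt_neqAle eq_sym w0 gsq_ge0.
suff : gsq k v z <= 0 by rewrite leNgt wpos.
(* It suffices that |f(z)|^2 e^(N (psi z - b)) <= M for every N > 0. This is read off at the maximum
   point of |f|^2 e^(N psi), which has to lie on [B]. *)
apply: (@expR_scale_bounded _ _ M (psi z - b)); first by rewrite subr_gt0.
move=> N N0; have [K [cK KD Kz Kmax]] := HK z N N0 Dz wpos.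
have CN : Cinf U (fun y => N * psi y) by apply: CinfM => //; exact: Cinf_cst.
have Cw : Cinf U (gsq k v) by apply: Cinf_gdot => //; case: hv.
have Cf : Cinf U (fun y => gsq k v y * expR (N * psi y)).
  by apply: CinfM => //; exact: Cinf_exp.
have KU : K `<=` U by move=> y /KD/DU.
have [p Kp pmax] := compact_max oU Cf cK KU (ex_intro _ z Kz).
have Dp := KD _ Kp; have zp := pmax _ Kz.
have wp : 0 < gsq k v p.
  rewrite lt_neqAle gsq_ge0 andbT eq_sym; apply/eqP => wp.
  by move: zp; rewrite wp mul0r leNgt mulr_gt0 ?expR_gt0.
have [Bp|nBp] := pselect (B p).
  rewrite mulrBr expRB mulrA ler_pdivrMr ?expR_gt0 //; apply: le_trans zp _.
  by rewrite ler_pM ?gsq_ge0 ?expR_ge0 ?wM // ler_expR ler_pM2l // psib.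
exfalso; apply: (@no_local_max_weight _ _ _ oU clk v hv (fun y => N * psi y) p CN (DU _
  Dp) _ wp).
  rewrite (lapM oU clk (Cinf_cst U N) Cpsi (DU _ Dp)) (lap_cst oU _ (DU _ Dp)).
  rewrite /gdot !fd_cst !(mul0r, mulr0, addr0).
  by rewrite mulr_gt0 // psi0 // gt_eqF.
(* A neighbour y with a larger value than p also beats z, so it lies in [K], where p is the
   maximum. *)
near=> y; have Dy : D y by near: y; exact: Dopen.
have [yp|yp] := leP (gsq k v y * expR (N * psi y)) (gsq k v p * expR (N * psi p)) => //.
have /pmax : K y by apply: Kmax => //; apply: le_trans zp (ltW yp).
by rewrite leNgt yp.
Unshelve. all: by end_near. Qed.

Lemma cramer2 (a b c d X Y : R) : a * d - b * c != 0 ->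
  X * d - Y * c = 0 -> - X * b + Y * a = 0 -> X = 0 /\ Y = 0.
Proof.
move=> D0 H1 H2; split; apply: (mulIf D0); rewrite mul0r.
  transitivity (a * (X * d - Y * c) + c * (- X * b + Y * a)); first by ring.
  by rewrite H1 H2 !mulr0 addr0.
transitivity (b * (X * d - Y * c) + d * (- X * b + Y * a)); first by ring.
by rewrite H1 H2 !mulr0 addr0.
Qed.

(** The frame is a basis at every point, so the frame derivatives of the squared distance vanish
    together only at its centre. *)
Lemma gsq_sqd_gt0 c z : U z -> z != c -> 0 < gsq k (sqd c) z.
Proof.
move=> Uz zc; rewrite lt_neqAle gsq_ge0 andbT eq_sym; apply: contra_neq zc => H.
have C1 : Cinf U (fun z => z.1 - c.1) by apply: CinfB; [exact: Cinf_fst|exact: Cinf_cst].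
have C2 : Cinf U (fun z => z.2 - c.2) by apply: CinfB; [exact: Cinf_snd|exact: Cinf_cst].
have E i : fd k i (sqd c) z = 2 * ((z.1 - c.1) * fa k i z + (z.2 - c.2) * fb k i z).
  rewrite (fdD oU i (CinfM C1 C1) (CinfM C2 C2) Uz) (fdM oU i C1 C1 Uz) (fdM oU i C2 C2 Uz).
  rewrite (fdD oU i (Cinf_fst U) (Cinf_cst U (- c.1)) Uz) (fdD oU i (Cinf_snd U)
    (Cinf_cst U (- c.2)) Uz).
  by rewrite !fd_cst /fd ds_fst ds_snd dt_fst dt_snd; ring.
move: H; rewrite /gsq /gdot -!expr2 => /eqP; rewrite paddr_eq0 ?sqr_ge0 // !sqrf_eq0 !E.
rewrite !mulf_eq0 !pnatr_eq0 /= => /andP[/eqP H1 /eqP H2].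
have D0 : cdet k z != 0 by case: clk => _ _ _ _ /(_ z Uz); exact: lt0r_neq0.
have D0' := D0.
move: H1 H2 D0'; rewrite /fa /fb; set X := z.1 - _; set Y := z.2 - _ => H1 H2 D0'.
have {}H1 : X * et k z - Y * es k z = 0.
  by rewrite -[RHS](mul0r (cdet k z)) -H1; field.
have {}H2 : - X * xt k z + Y * xs k z = 0.
  by rewrite -[RHS](mul0r (cdet k z)) -H2; field.
have [X0 Y0] := cramer2 D0 H1 H2.
move/eqP: X0; move/eqP: Y0; rewrite /X /Y !subr_eq0 => /eqP E2 /eqP E1.
by case: z c E1 E2 {Uz E H1 H2 D0 D0' X Y C1 C2} => ? ? [? ?] /= -> ->.
Qed.

(** With rho = [sqd c], the Laplacian of e^(-al rho) is al e^(-al rho) (al |grad rho|^2 - lap rho),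
    which is positive off the centre for large al. The weight is larger inside than on the outer
    circle rho = r', the only boundary, because f is already 0 near the centre. *)
Lemma unique_continuation v c (r r' : R) : frame_harmonic U k v -> 0 < r -> r < r' ->
  [set z | sqd c z <= r'] `<=` U -> (forall z, sqd c z < r -> gsq k v z = 0) ->
  forall z, sqd c z < r' -> gsq k v z = 0.
Proof.
move=> hv r0 rr' DU v0.
pose D := [set z | sqd c z <= r']; pose Ann := [set z | D z /\ r <= sqd c z].
have cD : compact D by exact: compact_sqd.
have C1 := Cinf_sqd U c.
have cAnn : compact Ann.
  have -> : Ann = D `&` [set z | - sqd c z <= - r].
    by apply/seteqP; split => z /=; rewrite lerN2 => -[].
  by apply: compact_closedI => //; apply: closed_le_Cinf; apply: CinfN; exact: Cinf_sqd.
have AnnU : Ann `<=` U by move=> z [/DU].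
have Ann0 : Ann !=set0.
  exists (c.1 + Num.sqrt r, c.2); rewrite /Ann /D /sqd /= subrr mulr0 addr0 addrAC
    subrr add0r.
  by rewrite -expr2 sqr_sqrtr ltW.
have [p [Dp rp] pmin] := compact_max oU (CinfN (Cinf_gdot oU clk C1 C1)) cAnn AnnU Ann0.
have [q Aq qmax] := compact_max oU (Cinf_lap oU clk C1) cAnn AnnU Ann0.
pose m := gsq k (sqd c) p.
have m0 : 0 < m.
  apply: gsq_sqd_gt0; first exact: DU.
  apply: contraTneq rp => ->; rewrite -ltNge /sqd !subrr !mulr0 addr0 //.
(* On the annulus [m] is the minimum of |grad rho|^2 and [q] maximizes lap rho, so al |grad rho|^2 >
   lap rho there. *)
pose al := (`|lap k (sqd c) q| + 1) / m.
have al0 : 0 < al by rewrite divr_gt0 // ltr_wpDl.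
pose psi z := expR (- al * sqd c z).
have Cps : Cinf U (fun z => - al * sqd c z) by apply: CinfM => //; exact: Cinf_cst.
have Cpsi : Cinf U psi by exact: Cinf_exp.
have [M wM] : exists M, forall z, D z -> gsq k v z <= M.
  have D0 : D !=set0 by case: Ann0 => z [Dz _]; exists z.
  have Cw : Cinf U (gsq k v) by apply: Cinf_gdot => //; case: hv.
  have [w _ H] := compact_max oU Cw cD DU D0; by exists (gsq k v w).
move=> z zr'; pose B := [set z | sqd c z = r'].
apply: (@gsq_le_weighted v psi D B M (expR (- al * r')) hv Cpsi DU).
- move=> y Dy nBy wy; have Uy := DU _ Dy.
  have Ay : Ann y by split => //; rewrite leNgt; apply: contra_neqN wy; exact: v0.
  rewrite (lap_exp oU clk Cps Uy) mulr_gt0 ?expR_gt0 //.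
  rewrite (lapM oU clk (Cinf_cst U _) C1 Uy) (lap_cst oU _ Uy).
  rewrite /gsq /gdot !(fdM oU _ (Cinf_cst U _) C1 Uy) !fd_cst.
  rewrite (_ : _ + _ = al * (al * gsq k (sqd c) y - lap k (sqd c) y)); last first.
    by rewrite /gsq /gdot; ring.
  rewrite mulr_gt0 // subr_gt0; apply: le_lt_trans (qmax _ Ay) _.
  have : m <= gsq k (sqd c) y by have := pmin _ Ay; rewrite lerN2.
  rewrite -(ler_pM2l al0); apply: lt_le_trans.
  by rewrite /al divfK ?gt_eqF // (le_lt_trans (ler_norm _)) // ltrDl.
- move=> y Dy nBy; have ylt : sqd c y < r' by rewrite lt_neqAle Dy andbT; apply/eqP.
  have : nbhs y [set z | sqd c z < r'].
    by apply: open_nbhs_nbhs; split => //; apply: open_lt_Cinf; exact: Cinf_sqd.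
  by apply: filterS => z' /ltW.
- by move=> y /= yB; rewrite /psi yB.
- by move=> y /= yB; apply: wM; rewrite /D /= yB.
- by move=> y N N0 Dy wy; exists D; split.
- exact: ltW.
- by rewrite ltr_expR ltr_nM2l // oppr_lt0.
Qed.

End Estimates.

(** * Minimal immersions and their conformal coframe *)

Section Vectors.
Context {R : realType} {n : nat}.
Implicit Types (U : set (R * R)) (X Y : R * R -> 'rV[R]_n) (l x y : 'rV[R]_n).

Lemma dotE x y : dot x y = \sum_i x 0 i * y 0 i.
Proof. by rewrite /dot mxE; apply: eq_bigr => i _; rewrite mxE. Qed.

Lemma dotC x y : dot x y = dot y x.
Proof. by rewrite !dotE; apply: eq_bigr => i _; rewrite mulrC. Qed.

Lemma dotDl x y l : dot (x + y) l = dot x l + dot y l.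
Proof. by rewrite /dot mulmxDl mxE. Qed.

Lemma dotZl (a : R) x l : dot (a *: x) l = a * dot x l.
Proof. by rewrite /dot -scalemxAl mxE. Qed.

Lemma dotNl x l : dot (- x) l = - dot x l.
Proof. by rewrite -scaleN1r dotZl mulN1r. Qed.

Lemma dotBl x y l : dot (x - y) l = dot x l - dot y l.
Proof. by rewrite dotDl dotNl. Qed.

Lemma dotDr x y l : dot l (x + y) = dot l x + dot l y.
Proof. by rewrite !(dotC l) dotDl. Qed.

Lemma dotZr (a : R) x l : dot l (a *: x) = a * dot l x.
Proof. by rewrite !(dotC l) dotZl. Qed.

Lemma dotBr x y l : dot l (x - y) = dot l x - dot l y.
Proof. by rewrite !(dotC l) dotBl. Qed.

Lemma dot0l x : dot 0 x = 0.
Proof. by rewrite /dot mul0mx mxE. Qed.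

Lemma dot_ge0 x : 0 <= dot x x.
Proof. by rewrite dotE sumr_ge0 // => i _; rewrite -expr2 sqr_ge0. Qed.

Lemma dot_eq0 x : dot x x = 0 -> x = 0.
Proof.
rewrite dotE => H; apply/rowP => i; rewrite mxE.
have := psumr_eq0P (fun i (_ : true) => sqr_ge0 (x 0 i)).
by move=> /(_ H i isT) /eqP; rewrite sqrf_eq0 => /eqP.
Qed.

Lemma dot_inj x y : (forall l, dot x l = dot y l) -> x = y.
Proof.
move=> H; apply/eqP; rewrite -subr_eq0; apply/eqP/dot_eq0.
by rewrite dotBl H subrr.
Qed.

Lemma differentiable_entry X z i : differentiable X z ->
  differentiable (fun q => X q 0 i) z.
Proof.
move=> dX; apply: (@differentiable_comp _ _ _ _ X (fun N : 'rV[R]_n => N 0 i)) => //.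
exact: differentiable_coord.
Qed.

Lemma derive_entry X z v i : differentiable X z ->
  'D_v (fun q => X q 0 i) z = ('D_v X z) 0 i.
Proof. by move=> dX; rewrite derive_mx ?mxE //; exact: diff_derivable. Qed.

Lemma Cinf_entry U X i : open U -> smooth_on U X -> Cinf U (fun z => X z 0 i).
Proof.
move=> oU sX; apply: Cinf_smooth => vs z Uz.
have E q : U q -> foldr (fun v g => 'D_v g) (fun z => X z 0 i) vs q =
    (foldr (fun v g => 'D_v g) X vs q) 0 i.
  elim: vs q => [//|v vs IH] q Uy /=.
  by rewrite (derive_eq_on _ oU Uy IH) derive_entry //; exact: sX.
by apply: (differentiable_eq_on oU Uz E); apply: differentiable_entry; exact: sX.
Qed.

Lemma Cinf_dot U X Y : open U -> smooth_on U X -> smooth_on U Y ->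
  Cinf U (fun z => dot (X z) (Y z)).
Proof.
move=> oU sX sY; apply: Cinf_eq (fun z _ => dotE (X z) (Y z)) _.
by apply: Cinf_sum => i; apply: CinfM; exact: Cinf_entry.
Qed.

Lemma derive_dot X Y z v : differentiable X z -> differentiable Y z ->
  'D_v (fun q => dot (X q) (Y q)) z = dot ('D_v X z) (Y z) + dot (X z) ('D_v Y z).
Proof.
move=> dX dY.
have -> : (fun q => dot (X q) (Y q)) = \sum_i (fun q => X q 0 i * Y q 0 i).
  by apply/funext => q; rewrite dotE fct_sumE.
have dXY i : derivable (fun q => X q 0 i * Y q 0 i) z v.
  by apply: diff_derivable; apply: differentiableM; exact: differentiable_entry.
rewrite derive_sum // !dotE -big_split /=; apply: eq_bigr => i _.
rewrite (derive_mul v (differentiable_entry i dX) (differentiable_entry i dY)).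
by rewrite (derive_entry v i dX) (derive_entry v i dY); ring.
Qed.

Lemma smooth_on_cst U (x : 'rV[R]_n) : smooth_on U (fun=> x).
Proof. by apply: (smooth_on_affine (L := 0)) => z; exact: is_diff_cst. Qed.

Lemma derive_dotl X z v l : differentiable X z ->
  'D_v (fun q => dot (X q) l) z = dot ('D_v X z) l.
Proof.
move=> dX; have dl : differentiable (fun=> l : 'rV[R]_n) z by exact: differentiable_cst.
by rewrite (derive_dot v dX dl) derive_cst [dot (X z) 0]dotC dot0l addr0.
Qed.

Lemma smooth_ds U X : smooth_on U X -> smooth_on U (ds X).
Proof. by rewrite ds.unlock; exact: smooth_on_derive. Qed.

Lemma smooth_dt U X : smooth_on U X -> smooth_on U (dt X).
Proof. by rewrite dt.unlock; exact: smooth_on_derive. Qed.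

Lemma dsdtC U X z : open U -> smooth_on U X -> U z -> dt (ds X) z = ds (dt X) z.
Proof.
move=> oU sX Uz; apply/rowP => i.
have dX Y q : smooth_on U Y -> U q -> differentiable Y q by move=> sY Uy; exact: (sY [::]).
have := deriveC ((1, 0) : R * R) ((0, 1) : R * R) oU (Cinf_entry i oU sX) Uz.
have E (v q : R * R) : U q -> 'D_v (fun z => X z 0 i) q = ('D_v X q) 0 i.
  by move=> Uy; rewrite derive_entry //; exact: dX.
have dsX : differentiable ('D_((1, 0) : R * R) X) z.
  by apply: dX => //; exact: smooth_on_derive.
have dtX : differentiable ('D_((0, 1) : R * R) X) z.
  by apply: dX => //; exact: smooth_on_derive.
rewrite (derive_eq_on _ oU Uz (E _)) (derive_entry _ _ dsX).
rewrite (derive_eq_on _ oU Uz (E _)) (derive_entry _ _ dtX).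
by rewrite ds.unlock dt.unlock.
Qed.

Definition ffE X z := dot (ds X z) (ds X z).
Definition ffF X z := dot (ds X z) (dt X z).
Definition ffG X z := dot (dt X z) (dt X z).
Definition ffdet X z := ffE X z * ffG X z - ffF X z * ffF X z.

(* Vanishing of the mean curvature, with denominators cleared and stated so as
   to be visibly independent of the parametrization. *)
Definition trace_tangent X z := exists a b : R,
  ffG X z *: ds (ds X) z - ffF X z *: (ds (dt X) z + dt (ds X) z)
    + ffE X z *: dt (dt X) z = a *: ds X z + b *: dt X z.

Lemma sum2 (V : nmodType) (f : 'I_2 -> V) : \sum_i f i = f 0 + f 1.
Proof. by rewrite big_ord_recl big_ord1; congr (_ + f _); apply/val_inj. Qed.

Lemma partialE (i : 'I_2) X : partial i X = if i == 0 then ds X else dt X.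
Proof. by rewrite /partial /basis2; case: (i == 0); rewrite ?ds.unlock ?dt.unlock. Qed.

Let neq10 : (1 == 0 :> 'I_2) = false. Proof. by []. Qed.

Lemma det_mx22 (N : 'M[R]_2) : \det N = N 0 0 * N 1 1 - N 0 1 * N 1 0.
Proof.
rewrite (expand_det_row _ 0) sum2 /cofactor !det_mx11 !mxE /=.
have -> : lift 0 0 = 1 :> 'I_2 by exact/val_inj.
have -> : lift 1 0 = 0 :> 'I_2 by exact/val_inj.
by rewrite expr0 expr1; ring.
Qed.

Lemma det_first_form X z : \det (first_form X z) = ffdet X z.
Proof.
by rewrite det_mx22 !mxE !partialE ?eqxx ?neq10 /ffdet /ffE /ffF /ffG [dot (dt X z) (ds
  X z)]dotC.
Qed.

(** The Gram determinant times its inverse matrix [N] is the adjugate, with entries G, -F, -F, E.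
    Multiplying the hypothesis by that determinant clears the denominators, and the projections go
    to the right-hand side. *)
Lemma trace_tangent_algebra (N : 'M[R]_2) (P : 'I_2 -> 'rV[R]_n) (Q : 'I_2 -> 'I_2 ->
  'rV[R]_n) :
  let E := dot (P 0) (P 0) in let F := dot (P 0) (P 1) in let G := dot (P 1) (P 1) in
  E * G - F * F != 0 -> N *m (\matrix_(i, j) dot (P i) (P j)) = 1%:M ->
  \sum_i \sum_j N i j *: (Q i j - \sum_a \sum_b (N a b * dot (Q i j) (P a)) *: P b) = 0 ->
  exists a b : R, G *: Q 0 0 - F *: (Q 0 1 + Q 1 0) + E *: Q 1 1 = a *: P 0 + b *: P 1.
Proof.
move=> E F G D0 NE; rewrite !sum2.
have ne i j : N i 0 * dot (P 0) (P j) + N i 1 * dot (P 1) (P j) = (i == j)%:R.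
  by move/matrixP: NE => /(_ i j); rewrite !mxE sum2 !mxE.
have e00 : N 0 0 * E + N 0 1 * F = 1 by have := ne 0 0; rewrite [dot (P 1) _]dotC.
have e01 : N 0 0 * F + N 0 1 * G = 0 := ne 0 1.
have e10 : N 1 0 * E + N 1 1 * F = 0 by have := ne 1 0; rewrite [dot (P 1) _]dotC.
have e11 : N 1 0 * F + N 1 1 * G = 1 := ne 1 1.
have n00 : (E * G - F * F) * N 0 0 = G.
  transitivity (G * (N 0 0 * E + N 0 1 * F) - F * (N 0 0 * F + N 0 1 * G)).
    by ring.
  by rewrite e00 e01 mulr1 mulr0 subr0.
have n01 : (E * G - F * F) * N 0 1 = - F.
  transitivity (E * (N 0 0 * F + N 0 1 * G) - F * (N 0 0 * E + N 0 1 * F)).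
    by ring.
  by rewrite e00 e01 mulr1 mulr0 sub0r.
have n10 : (E * G - F * F) * N 1 0 = - F.
  transitivity (G * (N 1 0 * E + N 1 1 * F) - F * (N 1 0 * F + N 1 1 * G)).
    by ring.
  by rewrite e10 e11 mulr1 mulr0 sub0r.
have n11 : (E * G - F * F) * N 1 1 = E.
  transitivity (E * (N 1 0 * F + N 1 1 * G) - F * (N 1 0 * E + N 1 1 * F)).
    by ring.
  by rewrite e10 e11 mulr1 mulr0 subr0.
have {}n10 : N 1 0 = N 0 1 by apply: (mulfI D0); rewrite n10 n01.
have nF : F = - ((E * G - F * F) * N 0 1) by rewrite n01 opprK.
rewrite {ne NE e00 e01 e10 e11}; move: (E * G - F * F) nF n00 n11 {D0 n01} => D -> <- <-.
move: E F G => _ _ _; rewrite n10 => H.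
(* [ca] and [cb] are the coefficients of the tangential projection in the basis [P 0], [P 1]. *)
pose ca w := N 0 0 * dot w (P 0) + N 0 1 * dot w (P 1).
pose cb w := N 0 1 * dot w (P 0) + N 1 1 * dot w (P 1).
pose S (f : 'rV[R]_n -> R) := D * N 0 0 * f (Q 0 0) + D * N 0 1 * (f (Q 0 1) + f (Q 1
  0)) + D * N 1 1 * f (Q 1 1).
exists (S ca), (S cb); apply/rowP => i.
move/rowP: H => /(_ i); rewrite !mxE => /(congr1 ( *%R D)); rewrite mulr0 => H.
apply/eqP; rewrite -subr_eq0 -H; apply/eqP.
by rewrite /S /ca /cb; ring.
Qed.

Lemma trace_tangentP X z : ffdet X z != 0 -> mean_curvature X z = 0 ->
  trace_tangent X z.
Proof.
move=> D0 H.
have gU : first_form X z \in unitmx by rewrite unitmxE det_first_form unitfE.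
have := @trace_tangent_algebra (invmx (first_form X z)) (fun i => partial i X z)
  (fun i j => partial i (partial j X) z) _ (mulVmx gU) H.
by rewrite !partialE !eqxx !neq10; apply.
Qed.

End Vectors.

(** * Conjugate differentials of linear functions on a minimal surface *)

Section MinimalFrame.
Context {R : realType} {n : nat} {U : set (R * R)} {X : R * R -> 'rV[R]_n}.
Hypotheses (oU : open U) (sX : smooth_on U X).
Hypothesis tX : forall z, U z -> trace_tangent X z.
Implicit Types (l : 'rV[R]_n) (z : R * R).

Let sS : smooth_on U (ds X). Proof. exact: smooth_ds. Qed.
Let sT : smooth_on U (dt X). Proof. exact: smooth_dt. Qed.

Let dC (f : R * R -> R) z : Cinf U f -> U z -> differentiable f z.
Proof. by move=> Cf Uz; apply: Cinf_differentiable oU Cf Uz. Qed.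

Let dX (Y : R * R -> 'rV[R]_n) z : smooth_on U Y -> U z -> differentiable Y z.
Proof. by move=> sY Uz; exact: (sY [::]). Qed.

Lemma ds_dot Y Z z : smooth_on U Y -> smooth_on U Z -> U z ->
  ds (fun q => dot (Y q) (Z q) : R) z = dot (ds Y z) (Z z : 'rV[R]_n) + dot (Y z) (ds Z z).
Proof. by move=> sY sZ Uz; rewrite ds.unlock; apply: derive_dot; exact: dX. Qed.

Lemma dt_dot Y Z z : smooth_on U Y -> smooth_on U Z -> U z ->
  dt (fun q => dot (Y q) (Z q) : R) z = dot (dt Y z) (Z z : 'rV[R]_n) + dot (Y z) (dt Z z).
Proof. by move=> sY sZ Uz; rewrite dt.unlock; apply: derive_dot; exact: dX. Qed.

Lemma ds_dotl Y z l : smooth_on U Y -> U z ->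
  ds (fun q => dot (Y q) l : R) z = dot (ds Y z) l.
Proof. by move=> sY Uz; rewrite ds.unlock derive_dotl //; exact: dX. Qed.

Lemma dt_dotl Y z l : smooth_on U Y -> U z ->
  dt (fun q => dot (Y q) l : R) z = dot (dt Y z) l.
Proof. by move=> sY Uz; rewrite dt.unlock derive_dotl //; exact: dX. Qed.

Lemma Cinf_dotl Y l : smooth_on U Y -> Cinf U (fun q => dot (Y q) l).
Proof. by move=> sY; apply: (@Cinf_dot _ _ U Y (fun=> l)) => //; exact: smooth_on_cst. Qed.

Hypothesis D0 : forall z, U z -> 0 < ffdet X z.

Local Notation E := (ffE X).
Local Notation F := (ffF X).
Local Notation G := (ffG X).

Definition areaW z := Num.sqrt (ffdet X z).
(* The coefficients of the closed form *d(l.X) = starA dt - starB ds. *)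
Definition starA l z := (G z * dot (ds X z) l - F z * dot (dt X z) l) / areaW z.
Definition starB l z := (E z * dot (dt X z) l - F z * dot (ds X z) l) / areaW z.

Lemma Cinf_ffE : Cinf U E. Proof. exact: Cinf_dot. Qed.
Lemma Cinf_ffF : Cinf U F. Proof. exact: Cinf_dot. Qed.
Lemma Cinf_ffG : Cinf U G. Proof. exact: Cinf_dot. Qed.
Lemma Cinf_ffdet : Cinf U (ffdet X).
Proof.
apply: CinfB; apply: CinfM;
  (exact: Cinf_ffE || exact: Cinf_ffF || exact: Cinf_ffG).
Qed.
Lemma Cinf_areaW : Cinf U areaW.
Proof. by apply: Cinf_sqrt D0; exact: Cinf_ffdet. Qed.

Lemma areaW_gt0 z : U z -> 0 < areaW z.
Proof. by move=> Uz; rewrite sqrtr_gt0 D0. Qed.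
Lemma areaW_neq0 z : U z -> areaW z != 0.
Proof. by move=> Uz; rewrite gt_eqF ?areaW_gt0. Qed.
Lemma areaW_sqr z : U z -> areaW z * areaW z = E z * G z - F z * F z.
Proof. by move=> Uz; rewrite -expr2 sqr_sqrtr // ltW // D0. Qed.

Lemma CinfA_num l : Cinf U (fun z => G z * dot (ds X z) l - F z * dot (dt X z) l).
Proof.
by apply: CinfB; apply: CinfM; do ?[exact: Cinf_ffF|exact: Cinf_ffG|exact: Cinf_dotl].
Qed.
Lemma CinfB_num l : Cinf U (fun z => E z * dot (dt X z) l - F z * dot (ds X z) l).
Proof.
by apply: CinfB; apply: CinfM; do ?[exact: Cinf_ffF|exact: Cinf_ffE|exact: Cinf_dotl].
Qed.
Lemma Cinf_invW : Cinf U (fun z => (areaW z)^-1).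
Proof. by apply: CinfV areaW_neq0; exact: Cinf_areaW. Qed.
Lemma Cinf_starA l : Cinf U (starA l).
Proof. by apply: CinfM; [exact: CinfA_num|exact: Cinf_invW]. Qed.
Lemma Cinf_starB l : Cinf U (starB l).
Proof. by apply: CinfM; [exact: CinfB_num|exact: Cinf_invW]. Qed.

(** Here p, q, r are the products of X_ss, X_st, X_tt with X_s (index 1) and X_t (index 2), and s, t
    those of l with X_s, X_t. The minimal surface equation paired with X_s and X_t determines a and
    b; paired with l it eliminates the second derivatives of l.X. *)
Lemma star_closed_algebra (Ev Fv Gv Wv p1 p2 q1 q2 r1 r2 a b s t xss xst xtt : R) :
  Wv != 0 -> Wv * Wv = Ev * Gv - Fv * Fv ->
  Gv * xss - Fv * (xst + xst) + Ev * xtt = a * s + b * t ->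
  Gv * p1 - Fv * (q1 + q1) + Ev * r1 = a * Ev + b * Fv ->
  Gv * p2 - Fv * (q2 + q2) + Ev * r2 = a * Fv + b * Gv ->
  let Ws := (2 * Wv)^-1 * (Ev * (q2 + q2) + Gv * (p1 + p1) - (Fv * (p2 + q1) + Fv * (p2
    + q1))) in
  let Wt := (2 * Wv)^-1 * (Ev * (r2 + r2) + Gv * (q1 + q1) - (Fv * (q2 + r1) + Fv * (q2
    + r1))) in
  (Gv * s - Fv * t) * - (Wv ^- 2 * Ws)
   + Wv^-1 * (Gv * xss + s * (q2 + q2) - (Fv * xst + t * (p2 + q1)))
  + ((Ev * t - Fv * s) * - (Wv ^- 2 * Wt)
   + Wv^-1 * (Ev * xtt + t * (q1 + q1) - (Fv * xst + s * (q2 + r1)))) = 0.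
Proof.
move=> W0 W2 Q P1 P2 Ws Wt.
have D0' : Ev * Gv - Fv * Fv != 0 by rewrite -W2 mulf_neq0.
have aE : a = (Gv * (Gv * p1 - Fv * (q1 + q1) + Ev * r1) - Fv * (Gv * p2 - Fv * (q2 +
  q2) + Ev * r2)) / (Ev * Gv - Fv * Fv).
  by rewrite P1 P2; field.
have bE : b = (Ev * (Gv * p2 - Fv * (q2 + q2) + Ev * r2) - Fv * (Gv * p1 - Fv * (q1 +
  q1) + Ev * r1)) / (Ev * Gv - Fv * Fv).
  by rewrite P1 P2; field.
have Qx : Gv * xss = a * s + b * t - Ev * xtt + Fv * (xst + xst) by rewrite -Q; ring.
pose c := Wv^-1.
have -> : Wv ^- 2 * Ws = c / (2 * (Ev * Gv - Fv * Fv)) * (Ev * (q2 + q2) + Gv * (p1 +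
  p1) - (Fv * (p2 + q1) + Fv * (p2 + q1))).
  by rewrite -W2 /c /Ws; field.
have -> : Wv ^- 2 * Wt = c / (2 * (Ev * Gv - Fv * Fv)) * (Ev * (r2 + r2) + Gv * (q1 +
  q1) - (Fv * (q2 + r1) + Fv * (q2 + r1))).
  by rewrite -W2 /c /Wt; field.
rewrite -/c Qx aE bE; field.
exact: D0'.
Qed.

(** The left side is the area density times the Laplace-Beltrami operator of l.X, and that operator
    sends X to its mean curvature vector. *)
Lemma star_closed l z : U z -> ds (starA l) z + dt (starB l) z = 0.
Proof.
move=> Uz.
have dE := dC Cinf_ffE Uz; have dF := dC Cinf_ffF Uz; have dG := dC Cinf_ffG Uz.
have dW := dC Cinf_areaW Uz; have dV := dC Cinf_invW Uz.
have dS := dC (Cinf_dotl l sS) Uz; have dT := dC (Cinf_dotl l sT) Uz.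
have W0 := areaW_neq0 Uz; have W2 := areaW_sqr Uz.
have CC : dt (ds X) z = ds (dt X) z by exact: dsdtC oU sX Uz.
have Es : ds E z = dot (ds (ds X) z) (ds X z) + dot (ds (ds X) z) (ds X z).
  by rewrite ds_dot // [X in _ + X]dotC.
have Et : dt E z = dot (ds (dt X) z) (ds X z) + dot (ds (dt X) z) (ds X z).
  by rewrite dt_dot // [X in _ + X]dotC CC.
have Fs : ds F z = dot (ds (ds X) z) (dt X z) + dot (ds (dt X) z) (ds X z).
  by rewrite ds_dot // [X in _ + X]dotC.
have Ft : dt F z = dot (ds (dt X) z) (dt X z) + dot (dt (dt X) z) (ds X z).
  by rewrite dt_dot // [X in _ + X]dotC CC.
have Gs : ds G z = dot (ds (dt X) z) (dt X z) + dot (ds (dt X) z) (dt X z).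
  by rewrite ds_dot // [X in _ + X]dotC.
have Gt : dt G z = dot (dt (dt X) z) (dt X z) + dot (dt (dt X) z) (dt X z).
  by rewrite dt_dot // [X in _ + X]dotC.
have dD := dC Cinf_ffdet Uz.
have derD v : 'D_v (ffdet X) z = E z * 'D_v G z + G z * 'D_v E z - (F z * 'D_v F z + F
  z * 'D_v F z).
  rewrite (derive_add v (differentiableM dE dG) (differentiableN (differentiableM dF dF))).
  by rewrite (derive_opp v (differentiableM dF dF)) (derive_mul v dE dG) (derive_mul v
    dF dF).
have derW v : 'D_v areaW z = (2 * areaW z)^-1 * 'D_v (ffdet X) z.
  exact: (derive_sqrtf v dD (D0 Uz)).
have derA v : 'D_v (starA l) z =
    (G z * dot (ds X z) l - F z * dot (dt X z) l) * - (areaW z ^- 2 * 'D_v areaW z)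
    + (areaW z)^-1 * (G z * 'D_v (fun q => dot (ds X q) l) z + dot (ds X z) l * 'D_v G z
       - (F z * 'D_v (fun q => dot (dt X q) l) z + dot (dt X z) l * 'D_v F z)).
  rewrite (derive_mul v (dC (CinfA_num l) Uz) dV) (derive_inv v dW W0).
  rewrite (derive_add v (differentiableM dG dS) (differentiableN (differentiableM dF dT))).
  by rewrite (derive_opp v (differentiableM dF dT)) (derive_mul v dG dS) (derive_mul v
    dF dT).
have derB v : 'D_v (starB l) z =
    (E z * dot (dt X z) l - F z * dot (ds X z) l) * - (areaW z ^- 2 * 'D_v areaW z)
    + (areaW z)^-1 * (E z * 'D_v (fun q => dot (dt X q) l) z + dot (dt X z) l * 'D_v E z
       - (F z * 'D_v (fun q => dot (ds X q) l) z + dot (ds X z) l * 'D_v F z)).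
  rewrite (derive_mul v (dC (CinfB_num l) Uz) dV) (derive_inv v dW W0).
  rewrite (derive_add v (differentiableM dE dT) (differentiableN (differentiableM dF dS))).
  by rewrite (derive_opp v (differentiableM dF dS)) (derive_mul v dE dT) (derive_mul v
    dF dS).
have dsE (f : R * R -> R) : 'D_((1, 0) : R * R) f z = ds f z by rewrite ds.unlock.
have dtE (f : R * R -> R) : 'D_((0, 1) : R * R) f z = dt f z by rewrite dt.unlock.
rewrite -dsE -dtE derA derB !derW !derD !dsE !dtE.
rewrite !ds_dotl // !dt_dotl // CC Es Et Fs Ft Gs Gt.
have [a [b]] := tX Uz; rewrite CC => Q.
have Ql y := congr1 (dot^~ y) Q; move: (Ql l) (Ql (ds X z)) (Ql (dt X z)).
rewrite !(dotDl, dotNl, dotZl) -/(E z) -/(F z) -/(G z) [dot (dt X z) (ds X z)]dotC -/(F z).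
exact: star_closed_algebra.
Qed.
End MinimalFrame.

(** Times |a|^2, the Gram determinant is the squared length of |a|^2 b - (a.b) a, a nontrivial
    combination of independent vectors. *)
Lemma gram_gt0 (R : realType) n (a b : 'rV[R]_n) :
  (forall s t : R, s *: a + t *: b = 0 -> s = 0 /\ t = 0) ->
  0 < dot a a * dot b b - dot a b * dot a b.
Proof.
move=> ab.
have a0 : dot a a != 0.
  apply/eqP => /dot_eq0 a0; have [|/eqP] := ab 1 0; last by rewrite oner_eq0.
  by rewrite a0 scaler0 scale0r addr0.
have apos : 0 < dot a a by rewrite lt_neqAle eq_sym a0 dot_ge0.
set D := _ - _; have DE : dot a a * D = dot (- dot a b *: a + dot a a *: b) (- dot a b
  *: a + dot a a *: b).
  rewrite !(dotDl, dotDr, dotZl, dotZr) [dot b a]dotC /D; ring.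
have : 0 <= dot a a * D by rewrite DE dot_ge0.
rewrite pmulr_rge0 // le_eqVlt => /predU1P[D0|//].
move: DE; rewrite -D0 mulr0 => /esym/dot_eq0/ab[_] /eqP.
by rewrite (negbTE a0).
Qed.

(** * The conformal coframe of two linear functions *)

Section FrameOfMinimal.
Context {R : realType} {n : nat} {U : set (R * R)} {X : R * R -> 'rV[R]_n}.
Context {l1 l2 : 'rV[R]_n}.
Hypotheses (oU : open U) (sX : smooth_on U X).
Hypothesis tX : forall z, U z -> trace_tangent X z.
Implicit Types (l : 'rV[R]_n) (z : R * R).

(** The coefficient of dx /\ dy for x = l1.X and y = l2.X. *)
Definition jac z := dot (ds X z) l1 * dot (dt X z) l2 - dot (dt X z) l1 * dot (ds X z) l2.
Hypothesis j0 : forall z, U z -> 0 < jac z.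

Lemma ffdet_gt0 z : U z -> 0 < ffdet X z.
Proof.
move=> Uz; apply: gram_gt0 => s t H.
have H1 := congr1 (dot^~ l1) H; have H2 := congr1 (dot^~ l2) H.
rewrite !(dotDl, dotZl) dot0l in H1; rewrite !(dotDl, dotZl) dot0l in H2.
have J : jac z != 0 by rewrite gt_eqF // j0.
split; apply: (mulIf J); rewrite mul0r /jac.
  transitivity ((s * dot (ds X z) l1 + t * dot (dt X z) l1) * dot (dt X z) l2
    - (s * dot (ds X z) l2 + t * dot (dt X z) l2) * dot (dt X z) l1); first by ring.
  by rewrite H1 H2 !mul0r subr0.
transitivity ((s * dot (ds X z) l2 + t * dot (dt X z) l2) * dot (ds X z) l1
  - (s * dot (ds X z) l1 + t * dot (dt X z) l1) * dot (ds X z) l2); first by ring.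
by rewrite H1 H2 !mul0r subr0.
Qed.

(* With x = l1.X and y = l2.X, the closed forms dx - *dy and dy + *dx, i.e. the
   real and imaginary parts of twice the (1,0)-part of d(x + iy). *)
Definition min_coframe : coframe R := {|
  xs := fun z => dot (ds X z) l1 + starB (X := X) l2 z;
  xt := fun z => dot (dt X z) l1 - starA (X := X) l2 z;
  es := fun z => dot (ds X z) l2 - starB (X := X) l1 z;
  et := fun z => dot (dt X z) l2 + starA (X := X) l1 z |}.
Local Notation k := min_coframe.

Let sS : smooth_on U (ds X). Proof. exact: smooth_ds. Qed.
Let sT : smooth_on U (dt X). Proof. exact: smooth_dt. Qed.
Let CA l := Cinf_starA oU sX ffdet_gt0 l.
Let CB l := Cinf_starB oU sX ffdet_gt0 l.

(** Here a, b, c, d are x_s, x_t, y_s, y_t. The first identity makes the coframe determinant 2 (ad -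
    bc) plus a nonnegative term; the next two say deta = *dxi, which is conformality. Since the
    first and fourth have the same right side, D1 x + D2 y = 1; the fifth is D2 x = D1 y. *)
Lemma min_coframe_algebra (Ev Fv Gv Wv a b c d : R) : Wv != 0 ->
  Wv * Wv = Ev * Gv - Fv * Fv ->
  let A1 := (Gv * a - Fv * b) / Wv in let B1 := (Ev * b - Fv * a) / Wv in
  let A2 := (Gv * c - Fv * d) / Wv in let B2 := (Ev * d - Fv * c) / Wv in
  [/\ (a + B2) * (d + A1) - (b - A2) * (c - B1) =
      2 * (a * d - b * c) + (Gv * a * a - 2 * Fv * a * b + Ev * b * b
                       + (Gv * c * c - 2 * Fv * c * d + Ev * d * d)) / Wv,
      Wv * (d + A1) = Gv * (a + B2) - Fv * (b - A2),
      Wv * (c - B1) = Fv * (a + B2) - Ev * (b - A2),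
      (d + A1) * a - (c - B1) * b + ((a + B2) * d - (b - A2) * c) =
       2 * (a * d - b * c) + (Gv * a * a - 2 * Fv * a * b + Ev * b * b
                       + (Gv * c * c - 2 * Fv * c * d + Ev * d * d)) / Wv &
      (a + B2) * b - (b - A2) * a = (d + A1) * c - (c - B1) * d].
Proof.
move=> W0 W2 A1 B1 A2 B2.
have c2 : Wv^-1 * Wv^-1 * (Ev * Gv - Fv * Fv) = 1 by rewrite -W2; field.
have c3 : Wv * Wv^-1 = 1 by rewrite mulfV.
split; rewrite /A1 /B1 /A2 /B2.
- transitivity ((a * d - b * c) + (a * d - b * c) * (Wv^-1 * Wv^-1 * (Ev * Gv - Fv * Fv))
    + (Gv * a * a - 2 * Fv * a * b + Ev * b * b
       + (Gv * c * c - 2 * Fv * c * d + Ev * d * d)) / Wv); first by ring.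
  by rewrite c2; ring.
- transitivity ((Wv * Wv^-1) * (Wv * d + (Gv * a - Fv * b)) ); first by rewrite c3; field.
  rewrite c3 mul1r (_ : Wv * d = (Wv * Wv) * Wv^-1 * d); last by field.
  by rewrite W2; ring.
- transitivity ((Wv * Wv^-1) * (Wv * c - (Ev * b - Fv * a)) ); first by rewrite c3; field.
  rewrite c3 mul1r (_ : Wv * c = (Wv * Wv) * Wv^-1 * c); last by field.
  by rewrite W2; ring.
- by ring.
- by ring.
Qed.

Lemma gram_form_ge0 (Ev Fv Gv a b : R) : 0 <= Ev -> 0 < Ev * Gv - Fv * Fv ->
  0 <= Gv * a * a - 2 * Fv * a * b + Ev * b * b.
Proof.
move=> E0 D0; have {E0}E0 : 0 < Ev.
  by rewrite lt_neqAle E0 andbT; apply: contraTneq D0 => <-; rewrite -leNgt; nra.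
rewrite -(pmulr_rge0 _ E0).
have -> : Ev * (Gv * a * a - 2 * Fv * a * b + Ev * b * b) =
  (Ev * b - Fv * a) ^+ 2 + (Ev * Gv - Fv * Fv) * a ^+ 2 by ring.
by rewrite addr_ge0 ?sqr_ge0 // mulr_ge0 ?sqr_ge0 // ltW.
Qed.

Let algebra z (Uz : U z) := @min_coframe_algebra (ffE X z) (ffF X z) (ffG X z)
  (areaW (X := X) z) (dot (ds X z) l1) (dot (dt X z) l1) (dot (ds X z) l2) (dot (dt X z) l2)
  (areaW_neq0 ffdet_gt0 Uz) (areaW_sqr ffdet_gt0 Uz).

Let cdet_gt0 z : U z -> 0 < cdet k z.
Proof.
move=> Uz; have [E _ _ _ _] := algebra Uz; rewrite /cdet /= E.
rewrite ltr_pwDl ?mulr_gt0 ?j0 // divr_ge0 ?(ltW (areaW_gt0 ffdet_gt0 Uz)) //.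
by rewrite addr_ge0 // gram_form_ge0 ?dot_ge0 // ffdet_gt0.
Qed.

(** dx and dy are closed by symmetry of second derivatives, *dx and *dy by [star_closed]; positivity
    of the determinant rests on the sign of [jac]. *)
Lemma closed_min_coframe : closed_coframe U k.
Proof.
have dC (f : R * R -> R) z : Cinf U f -> U z -> differentiable f z.
  by move=> Cf Uz; apply: Cinf_differentiable oU Cf Uz.
have CS l := Cinf_dotl oU l sS; have CT l := Cinf_dotl oU l sT.
have dsD f g z : Cinf U f -> Cinf U g -> U z -> ds (fun q => f q + g q : R) z = ds f z
  + ds g z.
  by move=> Cf Cg Uz; rewrite ds.unlock derive_add //; exact: dC.
have dtD f g z : Cinf U f -> Cinf U g -> U z -> dt (fun q => f q + g q : R) z = dt f z
  + dt g z.
  by move=> Cf Cg Uz; rewrite dt.unlock derive_add //; exact: dC.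
have dsN f z : Cinf U f -> U z -> ds (fun q => - f q : R) z = - ds f z.
  by move=> Cf Uz; rewrite ds.unlock derive_opp //; exact: dC.
have dtN f z : Cinf U f -> U z -> dt (fun q => - f q : R) z = - dt f z.
  by move=> Cf Uz; rewrite dt.unlock derive_opp //; exact: dC.
split => //.
- by split; [apply: CinfD|apply: CinfB].
- by split; [apply: CinfB|apply: CinfD].
- move=> z Uz; rewrite /= (dtD _ _ _ (CS l1) (CB l2) Uz) (dsD _ _ _ (CT l1) (CinfN (CA
  l2)) Uz).
  rewrite (dsN _ _ (CA l2) Uz) (dt_dotl l1 sS Uz) (ds_dotl l1 sT Uz) (dsdtC oU sX Uz).
  by apply/eqP; rewrite -subr_eq0; apply/eqP; rewrite -[RHS](star_closed oU sX tX
    ffdet_gt0 l2 Uz); ring.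
- move=> z Uz; rewrite /= (dtD _ _ _ (CS l2) (CinfN (CB l1)) Uz) (dsD _ _ _ (CT l2) (CA
  l1) Uz).
  rewrite (dtN _ _ (CB l1) Uz) (dt_dotl l2 sS Uz) (ds_dotl l2 sT Uz) (dsdtC oU sX Uz).
  by apply/eqP; rewrite -subr_eq0 -oppr_eq0; apply/eqP; rewrite -[RHS](star_closed oU
    sX tX ffdet_gt0 l1 Uz); ring.
Qed.

(** Trace and symmetry are identities of [min_coframe_algebra] divided by [cdet]; the determinant of
    the frame derivatives is [jac / cdet]. *)
Lemma expanding_min_coframe :
  expanding_frame (U := U) (k := k) (fun z => dot (X z) l1) (fun z => dot (X z) l2).
Proof.
move=> z Uz; have [E1 _ _ E4 E5] := algebra Uz; have D0 := cdet_gt0 Uz.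
rewrite /fd /fa /fb !(ds_dotl _ sX Uz) !(dt_dotl _ sX Uz).
have ne := lt0r_neq0 D0; have J := j0 Uz.
split.
- apply: (mulIf ne); rewrite mul1r.
  transitivity (et k z * dot (ds X z) l1 - es k z * dot (dt X z) l1
    + (xs k z * dot (dt X z) l2 - xt k z * dot (ds X z) l2)); first by field.
  by rewrite /cdet; exact: (etrans E4 (esym E1)).
- apply: (mulIf ne); transitivity (xs k z * dot (dt X z) l1 - xt k z * dot (ds X z)
  l1); first by field.
  transitivity (et k z * dot (ds X z) l2 - es k z * dot (dt X z) l2); last by field.
  exact: E5.
- rewrite (_ : _ - _ = jac z / cdet k z); first by rewrite divr_gt0.
  apply: (mulIf ne); apply: (mulIf ne).
  transitivity (jac z * cdet k z); last by field.
  transitivity ((et k z * dot (ds X z) l1 - es k z * dot (dt X z) l1)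
    * (xs k z * dot (dt X z) l2 - xt k z * dot (ds X z) l2)
    - (xs k z * dot (dt X z) l1 - xt k z * dot (ds X z) l1)
    * (et k z * dot (ds X z) l2 - es k z * dot (dt X z) l2)); first by field.
  by rewrite /cdet /jac; move: (xs k z) (xt k z) (es k z) (et k z) => *; ring.
Qed.

(** Conformality turns *dv into (D1 v) deta - (D2 v) dxi, which is [key]. Its closedness is D1 D1 v
    + D2 D2 v = 0, because dxi and deta are closed. *)
Lemma harmonic_min_coframe l : frame_harmonic U k (fun z => dot (X z) l).
Proof.
have Cv : Cinf U (fun z => dot (X z) l) by exact: Cinf_dotl.
split=> // z Uz.
have clk := closed_min_coframe.
set v1 := fd k true (fun z => dot (X z) l); set v2 := fd k false (fun z => dot (X z) l).
have C1 : Cinf U v1 by exact: Cinf_fd.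
have C2 : Cinf U v2 by exact: Cinf_fd.
have key q : U q -> starA (X := X) l q = v1 q * et k q - v2 q * xt k q /\
                    starB (X := X) l q = - (v1 q * es k q) + v2 q * xs k q.
  move=> Uq; have [_ E2 E3 _ _] := algebra Uq; have ne := lt0r_neq0 (cdet_gt0 Uq).
  have W0 := areaW_neq0 ffdet_gt0 Uq; have W2 := areaW_sqr ffdet_gt0 Uq.
  have eS : dot (ds X q) l = v1 q * xs k q + v2 q * es k q.
    by rewrite -(ds_dotl l sX Uq); exact: dsE clk _ _ Uq.
  have eT : dot (dt X q) l = v1 q * xt k q + v2 q * et k q.
    by rewrite -(dt_dotl l sX Uq); exact: dtE clk _ _ Uq.
  rewrite /starA /starB eS eT.
  have {}E2 : areaW (X := X) q * et k q = ffG X q * xs k q - ffF X q * xt k q := E2.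
  have {}E3 : areaW (X := X) q * es k q = ffF X q * xs k q - ffE X q * xt k q := E3.
  split; apply: (mulfI W0); apply: (mulfI W0).
    transitivity (v1 q * (areaW (X := X) q * (ffG X q * xs k q - ffF X q * xt k q))
      + v2 q * (ffG X q * (areaW (X := X) q * es k q) - ffF X q * (areaW (X := X) q *
        et k q))).
      by field.
    rewrite E2 E3.
    transitivity (v1 q * (areaW (X := X) q * (areaW (X := X) q * et k q))
      - v2 q * xt k q * (ffE X q * ffG X q - ffF X q * ffF X q)).
      by rewrite E2; ring.
    by rewrite -W2; ring.
  transitivity (- (v1 q * (areaW (X := X) q * (ffF X q * xs k q - ffE X q * xt k q)))
      + v2 q * (ffE X q * (areaW (X := X) q * et k q) - ffF X q * (areaW (X := X) q *
        es k q))).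
    by field.
  rewrite E2 E3.
  transitivity (- (v1 q * (areaW (X := X) q * (areaW (X := X) q * es k q)))
      + v2 q * xs k q * (ffE X q * ffG X q - ffF X q * ffF X q)).
    by rewrite E3; ring.
  by rewrite -W2; ring.
have dC (f : R * R -> R) : Cinf U f -> differentiable f z.
  by move=> Cf; apply: Cinf_differentiable oU Cf Uz.
have [[Cxs Cxt] [Ces Cet] clx cle _] := clk.
have := star_closed oU sX tX ffdet_gt0 l Uz.
have -> : ds (starA (X := X) l) z = ds (fun q => v1 q * et k q + (- v2 q) * xt k q) z.
  rewrite ds.unlock; apply: (derive_eq_on _ oU Uz) => q /key[-> _]; ring.
have -> : dt (starB (X := X) l) z = dt (fun q => (- v1 q) * es k q + v2 q * xs k q) z.
  rewrite dt.unlock; apply: (derive_eq_on _ oU Uz) => q /key[_ ->]; ring.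
have dv1 := dC _ C1; have dv2 := dC _ C2.
have -> : ds (fun q => v1 q * et k q + (- v2 q) * xt k q) z =
   v1 z * ds (et k) z + et k z * ds v1 z + (- v2 z * ds (xt k) z + xt k z * - ds v2 z).
  rewrite ds.unlock derive_lin2 ?derive_opp //; try exact: dC.
  exact: differentiableN.
have -> : dt (fun q => (- v1 q) * es k q + v2 q * xs k q) z =
   - v1 z * dt (es k) z + es k z * - dt v1 z + (v2 z * dt (xs k) z + xs k z * dt v2 z).
  rewrite dt.unlock derive_lin2 ?derive_opp //; try exact: dC.
  exact: differentiableN.
rewrite clx // cle // => H.
have ne := lt0r_neq0 (cdet_gt0 Uz).
rewrite /lap {1 3}/fd /fa /fb -/v1 -/v2.
apply: (mulfI ne); rewrite mulr0 -[RHS]H; field.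
exact: ne.
Qed.
End FrameOfMinimal.

(** * The end is flat *)

Section Reparametrization.
Context {R : realType}.
Implicit Types (U N : set (R * R)) (z w : R * R) (f g : R * R -> R).

Lemma derive_chain f g1 g2 w (v : R * R) : differentiable g1 w ->
  differentiable g2 w -> differentiable f (g1 w, g2 w) ->
  'D_v (fun q => f (g1 q, g2 q)) w =
  'D_v g1 w * ds f (g1 w, g2 w) + 'D_v g2 w * dt f (g1 w, g2 w).
Proof.
move=> d1 d2 df; have d12 : differentiable (fun q => (g1 q, g2 q)) w.
  exact: differentiable_pair.
have dfg : differentiable (f \o (fun q => (g1 q, g2 q))) w by exact: differentiable_comp.
rewrite (deriveE v dfg) diff_comp //= -(deriveE _ df) derive_dsdt //.
by rewrite diff_pair //= -!deriveE.
Qed.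

Context {n : nat} {U N : set (R * R)} {X Y : R * R -> 'rV[R]_n}.
Context {g1 g2 : R * R -> R} {z : R * R}.
Hypotheses (oU : open U) (oN : open N) (sX : smooth_on U X) (sY : smooth_on N Y).
Hypotheses (C1 : Cinf N g1) (C2 : Cinf N g2) (Nz : N z).
Hypothesis gU : forall w, N w -> U (g1 w, g2 w).
Hypothesis YX : forall w, N w -> Y w = X (g1 w, g2 w).

Let dU f w : Cinf U f -> U w -> differentiable f w.
Proof. by move=> Cf Uw; exact: Cinf_differentiable oU Cf Uw. Qed.
Let dN f w : Cinf N f -> N w -> differentiable f w.
Proof. by move=> Cf Nw; exact: Cinf_differentiable oN Cf Nw. Qed.

Lemma derive_reparam f g (v : R * R) w : Cinf U f -> N w ->
  (forall q, N q -> g q = f (g1 q, g2 q)) ->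
  'D_v g w = 'D_v g1 w * ds f (g1 w, g2 w) + 'D_v g2 w * dt f (g1 w, g2 w).
Proof.
move=> Cf Nw gf; rewrite (derive_eq_on _ oN Nw gf) derive_chain //; try exact: dN.
by apply: dU => //; exact: gU.
Qed.

Let shuffle (a s A S b t B T : R) :
  a * S + s * A + (b * T + t * B) = A * s + B * t + a * S + b * T.
Proof. by ring. Qed.

Lemma derive2_reparam f g (u v : R * R) : Cinf U f ->
  (forall q, N q -> g q = f (g1 q, g2 q)) ->
  let p := (g1 z, g2 z) in
  'D_u ('D_v g) z = 'D_u ('D_v g1) z * ds f p + 'D_u ('D_v g2) z * dt f p
   + 'D_v g1 z * ('D_u g1 z * ds (ds f) p + 'D_u g2 z * dt (ds f) p)
   + 'D_v g2 z * ('D_u g1 z * ds (dt f) p + 'D_u g2 z * dt (dt f) p).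
Proof.
move=> Cf gf p.
have Cs : Cinf U (ds f) by rewrite ds.unlock; exact: Cinf_derive.
have Ct : Cinf U (dt f) by rewrite dt.unlock; exact: Cinf_derive.
have d1 := dN (Cinf_derive v oN C1) Nz; have d2 := dN (Cinf_derive v oN C2) Nz.
have dg h : Cinf U h -> differentiable (fun q => h (g1 q, g2 q)) z.
  move=> Ch; have d12 : differentiable (fun q => (g1 q, g2 q)) z.
    by apply: differentiable_pair; exact: dN.
  apply: (@differentiable_comp _ _ _ _ (fun q => (g1 q, g2 q)) h) => //.
  by apply: dU => //; exact: gU.
rewrite (derive_eq_on _ oN Nz (fun w Nw => @derive_reparam f g v w Cf Nw gf)).
rewrite (derive_lin2 u d1 (dg _ Cs) d2 (dg _ Ct)).
rewrite (derive_reparam u Cs Nz (fun q _ => erefl)).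
rewrite (derive_reparam u Ct Nz (fun q _ => erefl)).
exact: shuffle.
Qed.

Lemma dot_derive2 (W : set (R * R)) (Z : R * R -> 'rV[R]_n) (u v w : R * R) (l : 'rV[R]_n) :
  open W -> smooth_on W Z -> W w ->
  'D_u ('D_v (fun q => dot (Z q) l)) w = dot ('D_u ('D_v Z) w) l.
Proof.
move=> oW sZ Ww.
have dZ q : W q -> differentiable Z q by move=> Wq; exact: (sZ [::]).
rewrite (derive_eq_on _ oW Ww (fun q Wq => derive_dotl v l (dZ q Wq))).
by rewrite derive_dotl //; exact: (sZ [:: v]).
Qed.

(** The primed coefficients are the pulled-back first fundamental form. Contracting with them
    multiplies the trace by J^2, while second derivatives of the change of variables contribute only
    tangential terms. *)
Lemma trace_tangent_algebra2 (E F G p q r t a b x11 x12 x21 x22 xs xt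
   a11 a12 a21 a22 b11 b12 b21 b22 : R) :
  let J := p * t - q * r in
  let E' := p * p * E + 2 * p * r * F + r * r * G in
  let F' := p * q * E + (p * t + q * r) * F + r * t * G in
  let G' := q * q * E + 2 * q * t * F + t * t * G in
  J != 0 ->
  G' * (a11 * xs + b11 * xt + p * (p * x11 + r * x21) + r * (p * x12 + r * x22))
  - F' * ((a12 * xs + b12 * xt + q * (p * x11 + r * x21) + t * (p * x12 + r * x22))
        + (a21 * xs + b21 * xt + p * (q * x11 + t * x21) + r * (q * x12 + t * x22)))
  + E' * (a22 * xs + b22 * xt + q * (q * x11 + t * x21) + t * (q * x12 + t * x22))
   = a * (p * xs + r * xt) + b * (q * xs + t * xt) ->
  G * x11 - F * (x12 + x21) + E * x22 =
    (a * p + b * q - (G' * a11 - F' * (a12 + a21) + E' * a22)) / (J * J) * xs +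
    (a * r + b * t - (G' * b11 - F' * (b12 + b21) + E' * b22)) / (J * J) * xt.
Proof.
move=> J E' F' G' J0 H; apply: (mulfI J0); apply: (mulfI J0).
transitivity (a * (p * xs + r * xt) + b * (q * xs + t * xt)
  - (G' * a11 - F' * (a12 + a21) + E' * a22) * xs
  - (G' * b11 - F' * (b12 + b21) + E' * b22) * xt); last by field.
by rewrite -H /E' /F' /G' /J; ring.
Qed.

(** Because [Y] is immersive at z, the change of variables has nonzero Jacobian there, and the
    equation passes pointwise from [Y] to [X] without inverting it. *)
Lemma trace_tangent_reparam : 0 < ffdet Y z -> trace_tangent Y z ->
  trace_tangent X (g1 z, g2 z).
Proof.
move=> D0 [a [b Q]]; set c := (g1 z, g2 z).
have Uc : U c by exact: gU.
have Cl l := Cinf_dotl oU l sX.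
have gf l q : N q -> (fun q => dot (Y q) l) q = (fun q => dot (X q) l) (g1 q, g2 q).
  by move=> /YX ->.
have dX (Z : R * R -> 'rV[R]_n) w : smooth_on U Z -> U w -> differentiable Z w.
  by move=> sZ Uw; exact: (sZ [::]).
have dY (Z : R * R -> 'rV[R]_n) w : smooth_on N Z -> N w -> differentiable Z w.
  by move=> sZ Nw; exact: (sZ [::]).
have Y1 l : dot (ds Y z) l = ds g1 z * dot (ds X c) l + ds g2 z * dot (dt X c) l.
  rewrite -(ds_dotl l sY Nz) ds.unlock (derive_reparam _ (Cl l) Nz (gf l)) -/c.
  by rewrite (ds_dotl l sX Uc) (dt_dotl l sX Uc) ds.unlock.
have Y2 l : dot (dt Y z) l = dt g1 z * dot (ds X c) l + dt g2 z * dot (dt X c) l.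
  rewrite -(dt_dotl l sY Nz) dt.unlock (derive_reparam _ (Cl l) Nz (gf l)) -/c.
  by rewrite (ds_dotl l sX Uc) (dt_dotl l sX Uc) dt.unlock.
have v1 : ds Y z = ds g1 z *: ds X c + ds g2 z *: dt X c.
  by apply: dot_inj => l; rewrite Y1 dotDl !dotZl.
have v2 : dt Y z = dt g1 z *: ds X c + dt g2 z *: dt X c.
  by apply: dot_inj => l; rewrite Y2 dotDl !dotZl.
have J0 : ds g1 z * dt g2 z - dt g1 z * ds g2 z != 0.
  apply: contraTneq D0 => J0; rewrite -leNgt le_eqVlt; apply/orP; left; apply/eqP.
  rewrite /ffdet /ffE /ffF /ffG v1 v2 !(dotDl, dotDr, dotZl, dotZr) [dot (dt X c) (ds X
    c)]dotC.
  transitivity ((ds g1 z * dt g2 z - dt g1 z * ds g2 z) ^+ 2 * (ffE X c * ffG X c - ffF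
    X c * ffF X c)).
    by rewrite /ffE /ffF /ffG; ring.
  by rewrite J0 expr0n mul0r.
have eE : ffE Y z = ds g1 z * ds g1 z * ffE X c + 2 * ds g1 z * ds g2 z * ffF X c
                  + ds g2 z * ds g2 z * ffG X c.
  rewrite /ffE /ffF /ffG v1 !(dotDl, dotDr, dotZl, dotZr) [dot (dt X c) (ds X c)]dotC; ring.
have eF : ffF Y z = ds g1 z * dt g1 z * ffE X c
    + (ds g1 z * dt g2 z + dt g1 z * ds g2 z) * ffF X c + ds g2 z * dt g2 z * ffG X c.
  rewrite /ffE /ffF /ffG v1 v2 !(dotDl, dotDr, dotZl, dotZr) [dot (dt X c) (ds X
    c)]dotC; ring.
have eG : ffG Y z = dt g1 z * dt g1 z * ffE X c + 2 * dt g1 z * dt g2 z * ffF X c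
                  + dt g2 z * dt g2 z * ffG X c.
  rewrite /ffE /ffF /ffG v2 !(dotDl, dotDr, dotZl, dotZr) [dot (dt X c) (ds X c)]dotC; ring.
have xX (u v : R * R) l := dot_derive2 u v l oU sX Uc.
have x11 l : ds (ds (fun q => dot (X q) l)) c = dot (ds (ds X) c) l.
  by rewrite ds.unlock; exact: xX.
have x21 l : dt (ds (fun q => dot (X q) l)) c = dot (dt (ds X) c) l.
  by rewrite ds.unlock dt.unlock; exact: xX.
have x12 l : ds (dt (fun q => dot (X q) l)) c = dot (ds (dt X) c) l.
  by rewrite ds.unlock dt.unlock; exact: xX.
have x22 l : dt (dt (fun q => dot (X q) l)) c = dot (dt (dt X) c) l.
  by rewrite dt.unlock; exact: xX.
have yY (u v : R * R) l : dot ('D_u ('D_v Y) z) l =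
    'D_u ('D_v g1) z * dot (ds X c) l + 'D_u ('D_v g2) z * dot (dt X c) l
   + 'D_v g1 z * ('D_u g1 z * dot (ds (ds X) c) l + 'D_u g2 z * dot (dt (ds X) c) l)
   + 'D_v g2 z * ('D_u g1 z * dot (ds (dt X) c) l + 'D_u g2 z * dot (dt (dt X) c) l).
  rewrite -(dot_derive2 u v l oN sY Nz) (derive2_reparam _ _ (Cl l) (gf l)) -/c.
  rewrite (ds_dotl l sX Uc) (dt_dotl l sX Uc).
  by rewrite x11 x21 x12 x22.
(* A boolean selects the coordinate direction, so the four second-order formulas below are instances
   of one. *)
pose e (i : bool) : R * R := if i then (1, 0) else (0, 1).
pose o (i : bool) (f : R * R -> R) := if i then ds f else dt f.
pose ov (i : bool) (f : R * R -> 'rV[R]_n) := if i then ds f else dt f.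
have opS i (f : R * R -> R) : 'D_(e i) f = o i f.
  by rewrite /o; case: i; rewrite ?ds.unlock ?dt.unlock.
have opV i (f : R * R -> 'rV[R]_n) : 'D_(e i) f = ov i f.
  by rewrite /ov; case: i; rewrite ?ds.unlock ?dt.unlock.
have yYb i j l : dot (ov i (ov j Y) z) l =
    o i (o j g1) z * dot (ds X c) l + o i (o j g2) z * dot (dt X c) l
   + o j g1 z * (o i g1 z * dot (ds (ds X) c) l + o i g2 z * dot (dt (ds X) c) l)
   + o j g2 z * (o i g1 z * dot (ds (dt X) c) l + o i g2 z * dot (dt (dt X) c) l).
  by rewrite -!opS -!opV; exact: yY.
have y11 l : dot (ds (ds Y) z) l =
    ds (ds g1) z * dot (ds X c) l + ds (ds g2) z * dot (dt X c) l
   + ds g1 z * (ds g1 z * dot (ds (ds X) c) l + ds g2 z * dot (dt (ds X) c) l)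
   + ds g2 z * (ds g1 z * dot (ds (dt X) c) l + ds g2 z * dot (dt (dt X) c) l).
  exact: (yYb true true l).
have y12 l : dot (ds (dt Y) z) l =
    ds (dt g1) z * dot (ds X c) l + ds (dt g2) z * dot (dt X c) l
   + dt g1 z * (ds g1 z * dot (ds (ds X) c) l + ds g2 z * dot (dt (ds X) c) l)
   + dt g2 z * (ds g1 z * dot (ds (dt X) c) l + ds g2 z * dot (dt (dt X) c) l).
  exact: (yYb true false l).
have y21 l : dot (dt (ds Y) z) l =
    dt (ds g1) z * dot (ds X c) l + dt (ds g2) z * dot (dt X c) l
   + ds g1 z * (dt g1 z * dot (ds (ds X) c) l + dt g2 z * dot (dt (ds X) c) l)
   + ds g2 z * (dt g1 z * dot (ds (dt X) c) l + dt g2 z * dot (dt (dt X) c) l).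
  exact: (yYb false true l).
have y22 l : dot (dt (dt Y) z) l =
    dt (dt g1) z * dot (ds X c) l + dt (dt g2) z * dot (dt X c) l
   + dt g1 z * (dt g1 z * dot (ds (ds X) c) l + dt g2 z * dot (dt (ds X) c) l)
   + dt g2 z * (dt g1 z * dot (ds (dt X) c) l + dt g2 z * dot (dt (dt X) c) l).
  exact: (yYb false false l).
eexists; eexists; apply: dot_inj => l.
move/(congr1 (dot^~ l)) : Q; rewrite !(dotDl, dotNl, dotZl) v1 v2 !(dotDl, dotZl).
rewrite y11 y12 y21 y22 eE eF eG.
exact: trace_tangent_algebra2 J0.
Qed.
End Reparametrization.

Lemma sqd_le1 (R : realType) (z p : R * R) : sqd z p <= 1 ->
  `|p.1 - z.1| <= 1 /\ `|p.2 - z.2| <= 1.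
Proof.
rewrite /sqd => H; rewrite -[`|p.1 - _| <= 1](expr_le1 (n := 2)) //.
rewrite -[`|p.2 - _| <= 1](expr_le1 (n := 2)) // !real_normK ?num_real //.
have := sqr_ge0 (p.1 - z.1); have := sqr_ge0 (p.2 - z.2); rewrite !expr2.
by move=> ? ?; split; lra.
Qed.

(** * Vanishing of a decaying normal coordinate over a half plane *)

Section GraphEnd.
Context {R : realType} {n : nat} {U : set (R * R)} {X : R * R -> 'rV[R]_n}.
Context {l1 l2 l : 'rV[R]_n} {a1 a2 a c0 : R}.
Hypotheses (oU : open U) (sX : smooth_on U X).
Hypothesis tX : forall z, U z -> trace_tangent X z.
Hypothesis x1 : forall z, U z -> dot (X z) l1 - a1 = z.1.
Hypothesis x2 : forall z, U z -> dot (X z) l2 - a2 = z.2.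
Hypothesis HU : forall z, c0 < z.1 -> U z.
Let v z := dot (X z) l - a.
Let nn (z : R * R) : R := `|z.1| + `|z.2|.
Hypothesis decay : forall sg : R, 0 < sg -> exists r : R, forall z : R * R,
  c0 < z.1 -> r < nn z -> `|v z| <= expR (- (sg * nn z)).

Let ds1 z : U z -> dot (ds X z) l1 = 1 /\ dot (dt X z) l1 = 0.
Proof.
move=> Uz; rewrite -(ds_dotl l1 sX Uz) -(dt_dotl l1 sX Uz).
have E q : U q -> dot (X q) l1 = q.1 + a1 by move=> Uq; rewrite -x1 // subrK.
have df : differentiable (fst : R * R -> R) z by have d := is_diff_fst z; exact: ex_diff.
have dc : differentiable (fun _ : R * R => a1) z by exact: differentiable_cst.
have := ds_fst z; have := dt_fst z; rewrite ds.unlock dt.unlock.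
rewrite !(derive_eq_on _ oU Uz E) !(derive_add _ df dc) !derive_cst => -> ->.
by rewrite !addr0.
Qed.

Let ds2 z : U z -> dot (ds X z) l2 = 0 /\ dot (dt X z) l2 = 1.
Proof.
move=> Uz; rewrite -(ds_dotl l2 sX Uz) -(dt_dotl l2 sX Uz).
have E q : U q -> dot (X q) l2 = q.2 + a2 by move=> Uq; rewrite -x2 // subrK.
have df : differentiable (snd : R * R -> R) z by have d := is_diff_snd z; exact: ex_diff.
have dc : differentiable (fun _ : R * R => a2) z by exact: differentiable_cst.
have := ds_snd z; have := dt_snd z; rewrite ds.unlock dt.unlock.
rewrite !(derive_eq_on _ oU Uz E) !(derive_add _ df dc) !derive_cst => -> ->.
by rewrite !addr0.
Qed.

Let j0 z : U z -> 0 < jac (X := X) (l1 := l1) (l2 := l2) z.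
Proof.
move=> Uz; have [e1 e2] := ds1 Uz; have [e3 e4] := ds2 Uz.
by rewrite /jac e1 e2 e3 e4 mulr1 mul0r subr0 ltr01.
Qed.

Let k := min_coframe (X := X) (l1 := l1) (l2 := l2).
Let clk : closed_coframe U k. Proof. exact: closed_min_coframe. Qed.

Lemma harmonic_subc (f : R * R -> R) (b : R) :
  frame_harmonic U k f -> frame_harmonic U k (fun z => f z - b).
Proof.
move=> [Cf Lf]; have Cb := Cinf_cst U (- b).
split; first exact: CinfD.
by move=> z Uz; rewrite (lapD oU clk Cf Cb Uz) (lap_cst oU _ Uz) Lf // addr0.
Qed.

Let hx y := harmonic_min_coframe oU sX tX j0 y.
Let hv : frame_harmonic U k v. Proof. by apply: harmonic_subc; exact: hx. Qed.
Let fxy := expanding_min_coframe sX j0.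

Let nn_shift z p : sqd z p <= 1 -> nn z - 2 <= nn p.
Proof.
rewrite /nn => /sqd_le1[h1 h2].
have := ler_normB p.1 (p.1 - z.1); have := ler_normB p.2 (p.2 - z.2).
by rewrite !subKr => *; lra.
Qed.

(** In graph coordinates the cut-off of [gradient_estimate] is 1 - [sqd z], so the closed unit disc
    is an admissible [D]. *)
Lemma gsq_end_estimate z : c0 < z.1 - 1 ->
  exists p, [/\ c0 < p.1, sqd z p <= 1 & gsq k v z <= 7 * (v p * v p)].
Proof.
move=> cz; pose D := [set p | sqd z p <= 1].
have Dc p : D p -> c0 < p.1.
  by move=> /sqd_le1[]; rewrite ler_norml => /andP[? ?] _; lra.
have DU : D `<=` U by move=> p /Dc /HU.
have Uz : U z by apply: HU; lra.
have phiE p : U p -> 1 - (dot (X p) l1 - dot (X z) l1) * (dot (X p) l1 - dot (X z) l1)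
    - (dot (X p) l2 - dot (X z) l2) * (dot (X p) l2 - dot (X z) l2) = 1 - sqd z p.
  by move=> Up; rewrite /sqd -!x1 // -!x2 //; ring.
have Dz : D z by rewrite /D /sqd /= !subrr !mulr0 addr0 ler01.
have [||p Dp H] := @gradient_estimate _ _ _ oU clk _ _ v D z (hx l1) (hx l2) hv fxy
  (@compact_sqd _ z 1) DU Dz.
- by move=> p Dp; rewrite phiE ?subr_ge0 //; exact: DU.
- move=> p Dp; rewrite phiE; last exact: DU.
  rewrite subr_gt0 => H.
  have : nbhs p [set q | sqd z q < 1].
    by apply: open_nbhs_nbhs; split => //; apply: open_lt_Cinf; exact: Cinf_sqd.
  by apply: filterS => q /ltW.
by exists p; split => //; exact: Dc.
Qed.

Let r1_spec : exists2 r1 : R, 0 <= r1 & forall z : R * R, c0 < z.1 -> r1 < z.1 -> `|v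
  z| <= 1.
Proof.
have [r hr] := decay ltr01; exists `|r| => // z cz rz.
have nz : z.1 <= nn z by rewrite /nn (le_trans (ler_norm _)) // lerDl.
have := hr z cz (lt_le_trans (le_lt_trans (ler_norm r) rz) nz).
move/le_trans; apply; rewrite -[leRHS]expR0 ler_expR oppr_le0 mul1r.
by rewrite addr_ge0.
Qed.

Lemma graph_end_vanish : exists c, forall z, c < z.1 -> v z = 0.
Proof.
have [r1 r10 v1] := r1_spec.
(* The margin keeps unit discs centred over x >= c inside the region where X is a graph and |v| <=
   1. *)
pose c := Num.max c0 r1 + 2.
have cc0 (z : R * R) : c <= z.1 -> c0 < z.1 - 1.
  move=> cz; have : c0 <= Num.max c0 r1 by rewrite le_max lexx.
  by move: cz; rewrite /c => ? ?; lra.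
have cr1 (z : R * R) : c <= z.1 -> r1 < z.1 - 1.
  move=> cz; have : r1 <= Num.max c0 r1 by rewrite le_max lexx orbT.
  by move: cz; rewrite /c => ? ?; lra.
pose D := [set z : R * R | c <= z.1]; pose B := [set z : R * R | z.1 = c].
have DU : D `<=` U by move=> z /cc0 H; apply: HU; lra.
pose x z := dot (X z) l1 - a1.
have [Cx Lx] : frame_harmonic U k x by apply: harmonic_subc; exact: hx.
have xE z : U z -> x z = z.1 by move=> Uz; rewrite /x x1.
(* The exponential makes the Laplacian positive and is at most 1 for x >= c; on the line x = c the
   weight is c + 1. *)
pose psi z := x z + expR (c - x z).
have Ccx : Cinf U (fun z => c - x z) by apply: CinfB => //; exact: Cinf_cst.
have Cpsi : Cinf U psi by apply: CinfD => //; exact: Cinf_exp.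
have psiE z : U z -> psi z = z.1 + expR (c - z.1) by move=> Uz; rewrite /psi xE.
have shift1 (z p : R * R) : sqd z p <= 1 -> z.1 - 1 <= p.1.
  by move=> /sqd_le1[]; rewrite ler_norml => /andP[? ?] _; lra.
have w7 (z : R * R) : D z -> gsq k v z <= 7.
  move=> Dz; have [p [cp zp]] := gsq_end_estimate (cc0 _ Dz).
  move/le_trans; apply; rewrite -[leRHS]mulr1 ler_pM2l // -expr2.
  have rp : r1 < p.1 := lt_le_trans (cr1 _ Dz) (shift1 _ _ zp).
  by rewrite -(real_normK (num_real _)) expr_le1 // v1.
have gsqx (z : R * R) : U z -> 0 < gsq k x z.
  move=> Uz; have [_ _] := fxy Uz.
  have E i : fd k i (fun z => dot (X z) l1) z = fd k i x z.
    by rewrite (fdD oU i (proj1 (hx l1)) (Cinf_cst U (- a1)) Uz) fd_cst addr0.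
  rewrite !E.
  move=> H; rewrite lt_neqAle gsq_ge0 andbT eq_sym; apply: contraTneq H.
  rewrite /gsq /gdot -!expr2 => /eqP; rewrite paddr_eq0 ?sqr_ge0 // !sqrf_eq0.
  by move=> /andP[/eqP -> /eqP ->]; rewrite !mul0r subr0 ltxx.
have wD0 : forall z : R * R, D z -> c + 1 < psi z -> gsq k v z = 0.
  apply: (@gsq_le_weighted _ _ _ oU clk v psi D B 7 (c + 1) hv Cpsi DU).
  - move=> p Dp nBp wp; have Up := DU _ Dp.
    rewrite (lapD oU clk Cx (Cinf_exp Ccx) Up) Lx // add0r (lap_exp oU clk Ccx Up).
    rewrite mulr_gt0 ?expR_gt0 // (lapD oU clk (Cinf_cst U c) (CinfN Cx) Up).
    rewrite (lap_cst oU _ Up) (lapN oU clk Cx Up) Lx // oppr0 !add0r.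
    have -> : gsq k (fun z => c - x z) p = gsq k x p.
      rewrite /gsq /gdot !(fdD oU _ (Cinf_cst U c) (CinfN Cx) Up) !fd_cst.
      by rewrite !(fdN oU _ Cx Up) !add0r !mulrNN.
    exact: gsqx.
  - move=> p Dp nBp; have pc : c < p.1.
      by rewrite lt_neqAle Dp andbT eq_sym; apply/eqP.
    have : nbhs p [set q : R * R | - q.1 < - c].
      apply: open_nbhs_nbhs; split; last by rewrite /= ltrN2.
      by apply: (@open_lt_Cinf _ (fun q => - q.1)); apply: CinfN; exact: Cinf_fst.
    by apply: filterS => q /=; rewrite ltrN2 => /ltW.
  - move=> p pB; rewrite psiE; last by apply: DU; rewrite /D /= pB.
    by rewrite pB subrr expR0.
  - by move=> p pB; apply: w7; rewrite /D /= pB.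
  move=> z m m0 Dz wz.
  have [r hr] := decay m0.
  (* As t <= e^t, [nn p] > [L0] makes 7 e^(5m) e^(-m nn p) smaller than the weighted value at z. The
     other entries of [L] put the unit disc around p in the range of the decay, with margin 2, and z
     in the compact set. *)
  pose L0 := 7 * expR (5 * m) / (gsq k v z * expR (m * psi z) * m).
  pose L := Num.max L0 (Num.max (r + 2) (nn z)).
  have nn0 p : 0 <= nn p by rewrite addr_ge0.
  have sqnn (p : R * R) : sqd (0, 0) p <= nn p * nn p.
    rewrite /sqd /nn /= !subr0 -!expr2 -(real_normK (num_real p.1)) -(real_normK
      (num_real p.2)).
    have : 0 <= `|p.1| * `|p.2| by rewrite mulr_ge0.
    by rewrite sqrrD mulr2n => ?; lra.
  have L_ge p : L <= p -> [/\ L0 <= p, r + 2 <= p & nn z <= p].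
    by rewrite /L !ge_max => /and3P.
  have [L00 Lr Lz] := L_ge L (lexx _).
  have Lge0 : 0 <= L := le_trans (nn0 z) Lz.
  exists ([set p | sqd (0, 0) p <= L * L] `&` D); split.
  - apply: compact_closedI; first exact: compact_sqd.
    have -> : D = [set q : R * R | - q.1 <= - c].
      by apply/seteqP; split => q /=; rewrite lerN2.
    by apply: (@closed_le_Cinf _ (fun q => - q.1)); apply: CinfN; exact: Cinf_fst.
  - by move=> p [].
  - by split=> //=; apply: le_trans (sqnn z) _; rewrite ler_pM.
  move=> p Dp H; split=> //=; rewrite leNgt; apply/negP => Hp.
  have Lp : L < nn p.
    rewrite -(ltr_pXn2r (n := 2)) ?nnegrE // !expr2.
    exact: lt_le_trans Hp (sqnn p).
  have [p' [cp' pp' wp]] := gsq_end_estimate (cc0 _ Dp).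
  have nnp' := nn_shift pp'.
  have vp' : `|v p'| <= expR (- (m * (nn p - 2))).
    have rp' : r < nn p'.
      by clear -Lr Lp nnp'; apply: lt_le_trans nnp'; rewrite ltrBrDr; exact: le_lt_trans Lp.
    by apply: le_trans (hr p' cp' rp') _; rewrite ler_expR lerN2 ler_pM2l.
  have wp' : gsq k v p <= 7 * (expR (- (m * (nn p - 2))) * expR (- (m * (nn p - 2)))).
    apply: le_trans wp _; rewrite ler_pM2l // -expr2 -(real_normK (num_real _)) expr2.
    by rewrite ler_pM.
  have psip : psi p <= nn p + 1.
    rewrite psiE; last exact: DU.
    apply: lerD; first by rewrite /nn (le_trans (ler_norm _)) // lerDl.
    by rewrite -[leRHS]expR0 ler_expR subr_le0.
  (* The square of v contributes the exponent -2m (nn p - 2) and the weight at most m (nn p + 1);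
     the sum is 5m - m nn p. *)
  have : gsq k v z * expR (m * psi z) <= 7 * expR (5 * m) * expR (- (m * nn p)).
    apply: le_trans H _.
    apply: (@le_trans _ _ (7 * (expR (- (m * (nn p - 2))) * expR (- (m * (nn p - 2))))
      * expR (m * (nn p + 1)))).
      by rewrite ler_pM ?gsq_ge0 ?expR_ge0 // ler_expR ler_pM2l.
    rewrite -!mulrA -!expRD ler_pM2l // ler_expR; lra.
  rewrite expRN ler_pdivlMr ?expR_gt0 // leNgt => /negP; apply.
  have W0 : 0 < gsq k v z * expR (m * psi z) by rewrite mulr_gt0 ?expR_gt0.
  have : L0 < nn p by apply: le_lt_trans Lp.
  rewrite /L0 (ltr_pdivrMr _ _ (mulr_gt0 W0 m0)) => /lt_le_trans; apply.
  rewrite mulrC -mulrA ler_pM2l //.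
  by apply: le_trans (expR_ge1Dx _); rewrite lerDr.
have v0 (z : R * R) : c + 1 < z.1 -> ds v z = 0 /\ dt v z = 0.
  move=> cz; have Dz : D z by rewrite /D /=; lra.
  have Uz := DU _ Dz.
  have : gsq k v z = 0.
    by apply: wD0 => //; rewrite psiE // ltr_wpDr ?expR_ge0.
  rewrite /gsq /gdot -!expr2 => /eqP; rewrite paddr_eq0 ?sqr_ge0 // !sqrf_eq0.
  move=> /andP[/eqP e1 /eqP e2].
  by rewrite (dsE clk _ Uz) (dtE clk _ Uz) e1 e2 !mul0r addr0.
exists (c + 1) => z cz.
have c0' : 0 <= c by rewrite /c addr_ge0 // le_max r10 orbT.
have dv (q : R * R) : c + 1 < q.1 -> differentiable v q.
  move=> cq; apply: (Cinf_differentiable oU (proj1 hv)); apply: DU.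
  by rewrite /D /=; lra.
(* Zero gradient makes v constant along horizontal rays, on which the decay bounds it by e^(-s) for
   every s > 0. *)
have const (s : R) : 0 <= s -> v (z + (s, 0)) = v z.
  move=> s0; have [h h01|h h01 E] := @MVT_line _ _ v z (s, 0).
    apply: dv; apply: lt_le_trans cz _; rewrite /= lerDl mulr_ge0 //.
    by case/andP: h01.
  apply/eqP; rewrite -subr_eq0 E; apply/eqP.
  have ch : c + 1 < (z + h *: ((s, 0) : R * R)).1.
    apply: lt_le_trans cz _; rewrite /= lerDl mulr_ge0 //.
    by case/andP: h01.
  rewrite derive_dsdt; last exact: dv.
  by have [-> ->] := v0 _ ch; rewrite !mulr0 addr0.
apply/eqP; rewrite -normr_le0.
have [r hr] := decay ltr01.
apply: (@expR_scale_bounded _ _ 1 1) => // s s0.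
have s'0 : 0 <= s + `|r| by rewrite addr_ge0 // ltW.
rewrite -(const _ s'0) mulr1; set z' := z + _.
have z'1 : z'.1 = z.1 + (s + `|r|) by [].
have nz' : s + `|r| <= nn z'.
  rewrite /nn (le_trans (_ : _ <= z'.1)) // ?z'1; first lra.
  by rewrite -z'1 (le_trans (ler_norm _)) // lerDl.
have cz' : c0 < z'.1.
  have := cc0 z; rewrite z'1 => /(_ (ltW (lt_trans _ cz))) H.
  have : c0 < z.1 - 1 by apply: H; rewrite ltrDl.
  by move: s'0 => ? ?; lra.
have rz' : r < nn z' by apply: lt_le_trans nz'; rewrite (le_lt_trans (ler_norm r)) // ltrDr.
have H := hr z' cz' rz'; rewrite mul1r in H.
apply: (@le_trans _ _ (expR (- nn z') * expR s)); first by rewrite ler_wpM2r ?expR_ge0.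
rewrite -expRD -[leRHS]expR0 ler_expR; have := normr_ge0 r.
by move: nz' => ? ?; lra.
Qed.
End GraphEnd.

Definition segment_closed (R : realType) (V : normedModType R) (S : set V) :=
  forall x y (t : R), S x -> S y -> 0 <= t <= 1 -> S (x + t *: (y - x)).

Lemma segment_closed_connected (R : realType) (V : normedModType R) (S : set V) :
  segment_closed S -> connected S.
Proof.
move=> cS; have [->|/set0P[x Sx]] := eqVneq S set0; first exact: connected0.
pose seg y := (fun t : R => x + t *: (y - x)) @` `[0, 1].
have -> : S = \bigcup_(y in S) seg y.
  apply/seteqP; split=> [y Sy|z [y Sy [t t01 <-]]].
    exists y => //; exists 1; first by rewrite /= in_itv /= ler01 lexx.
    by rewrite scale1r addrC subrK.
  by apply: cS => //; move: t01; rewrite /= in_itv.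
apply: bigcup_connected.
  exists x => y _; exists 0; first by rewrite /= in_itv /= ler01 lexx.
  by rewrite scale0r addr0.
move=> y _; apply: connected_continuous_connected; first exact: segment_connected.
apply: continuous_subspaceT => t.
apply: cvgD; first exact: cvg_cst.
by apply: cvgZ; [exact: cvg_id|exact: cvg_cst].
Qed.

Lemma segment_closed_ball (R : realType) (V : normedModType R) (z : V) (r : R) :
  segment_closed (ball z r).
Proof.
move=> x y t; rewrite -ball_normE /= => xr yr /andP[t0 t1].
have -> : z - (x + t *: (y - x)) = (1 - t) *: (z - x) + t *: (z - y).
  rewrite scalerBl scale1r -addrA [- (t *: _) + _]addrC -scalerBr.
  have -> : z - y - (z - x) = x - y by rewrite opprB addrC addrA subrK.
  by rewrite opprD addrA -scalerN opprB.
apply: le_lt_trans (ler_normD _ _) _; rewrite !normrZ (ger0_norm t0).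
rewrite ger0_norm ?subr_ge0 //.
have : Num.max `|z - x| `|z - y| < r by rewrite gt_max xr.
apply: le_lt_trans; set m := Num.max _ _.
have -> : m = (1 - t) * m + t * m by ring.
by rewrite lerD // ler_wpM2l ?subr_ge0 // le_max lexx ?orbT.
Qed.

(** * Topology of the surface through its charts *)

Section ChartTopology.
Context {R : realType} {M : topologicalType} {A : set (chart R M)}.
Hypothesis surfM : smooth_surface A.
Implicit Types (c : chart R M) (z : R * R) (q : M) (O : set M).

Lemma exists_chart q : exists c z, [/\ A c, chart_dom c z & c z = q].
Proof.
have [_ _ _ cov _] := surfM; have [c Ac [z cz zq]] := cov q.
by exists c, z.
Qed.

Lemma open_chart_dom c : A c -> open (chart_dom c).
Proof. by have [_ _ tc _ _] := surfM => /tc[]. Qed.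

Lemma chart_continuous c z : A c -> chart_dom c z -> {for z, continuous c}.
Proof.
have [_ _ tc _ _] := surfM => /tc[oc cc _ _] cz.
have := cc; rewrite continuous_open_subspace // => /(_ z); apply; rewrite inE //.
Qed.

Lemma chart_open_image c (B : set (R * R)) : A c -> open B -> B `<=` chart_dom c ->
  open (c @` B).
Proof. by have [_ _ tc _ _] := surfM => /tc[_ _ _]; apply. Qed.

Lemma chart_nbhs_image c z (B : set (R * R)) : A c -> chart_dom c z -> nbhs z B ->
  nbhs (c z) (c @` B).
Proof.
move=> Ac cz zB; have : nbhs z (B `&` chart_dom c)^°.
  apply: nbhs_interior; apply: filterI => //; apply: open_nbhs_nbhs; split => //.
  exact: open_chart_dom.
set B' := _^° => zB'; have B'B : B' `<=` B `&` chart_dom c by exact: interior_subset.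
have oB' : open (c @` B').
  by apply: chart_open_image => //; [exact: open_interior|move=> y /B'B[]].
apply: (@filterS _ _ _ (c @` B')); first by move=> _ [y /B'B[By _] <-]; exists y.
by apply: open_nbhs_nbhs; split => //; exists z => //; exact: nbhs_singleton zB'.
Qed.

Lemma open_chart_preimage c O : A c -> open O -> open (chart_dom c `&` c @^-1` O).
Proof.
move=> Ac oO; rewrite openE => z [cz Oz].
apply: filterI; first by apply: open_nbhs_nbhs; split => //; exact: open_chart_dom.
by apply: (chart_continuous Ac cz); apply: open_nbhs_nbhs.
Qed.

Lemma immersion_continuous n (F : M -> 'rV[R]_n) : immersion A F -> continuous F.
Proof.
move=> immF q; have [c [z [Ac cz <-]]] := exists_chart q.
have [sF _] := immF c Ac.
have cF : {for z, continuous (F \o c)}.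
  by apply: differentiable_continuous; exact: (sF [::]).
move=> W /cF zW; have := chart_nbhs_image Ac cz zW.
by apply: filterS => _ [y Wy <-].
Qed.

(** Chart images of discs are connected neighbourhoods, so the surface is locally connected. This
    makes the end an open subset. *)
Lemma open_component (W : set M) q : open W -> open (connected_component W q).
Proof.
move=> oW; rewrite openE => q' Wq'.
have [c [z [Ac cz zq']]] := exists_chart q'.
have Wq'' := @connected_component_sub _ _ _ _ Wq'.
have : nbhs z (chart_dom c `&` c @^-1` W).
  apply: open_nbhs_nbhs; split; first exact: open_chart_preimage.
  by split => //=; rewrite zq'.
move=> /nbhs_ballP[r /= r0 rB].
have cB : connected (c @` ball z r).
  apply: connected_continuous_connected; first exact: segment_closed_connected
    (@segment_closed_ball _ _ z r).
  by apply: continuous_in_subspaceT => y; rewrite inE => /rB[cy _]; exact: chart_continuous.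
have : nbhs q' (c @` ball z r) by rewrite -zq'; apply: chart_nbhs_image => //; exact:
  nbhsx_ballx.
apply: filterS => q1 Bq1.
apply: (connected_component_trans Wq').
apply: (connected_component_max (B := c @` ball z r)) => //.
  by rewrite -zq'; exists z => //; exact: ballxx.
by move=> _ [y /rB[_ ?] <-].
Qed.

End ChartTopology.

Section SmoothMaps.
Context {R : realType} {W : normedModType R}.
Implicit Types (U : set (R * R)) (f g : R * R -> W) (L : R * R -> R * R).

(** Iterating D_v (g o L) = (D_(L v) g) o L carries all directions through [L]. *)
Lemma smooth_on_comp_linear U f L : open U -> (forall z, is_diff z L L) ->
  smooth_on U f -> smooth_on (L @^-1` U) (f \o L).
Proof.
move=> oU dL sf vs z Uz.
have dLz y : differentiable L y by have d := dL y; exact: ex_diff.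
have oLU : open (L @^-1` U).
  by apply: open_comp => // y _; apply: differentiable_continuous; exact: dLz.
have E y : U (L y) -> foldr (fun v g => 'D_v g) (f \o L) vs y =
    foldr (fun v g => 'D_v g) f (map L vs) (L y).
  elim: vs y => [//|v vs IH] y Uy /=.
  rewrite (derive_eq_on v oLU Uy IH).
  set g := foldr _ _ _; have dg : differentiable g (L y) by exact: sf.
  have dgL : differentiable (g \o L) y by exact: differentiable_comp.
  rewrite (deriveE v dgL) diff_comp //= (deriveE _ dg).
  by have d := dL y; rewrite [X in 'd g _ (X v)]diff_val.
apply: (differentiable_eq_on oLU Uz E).
by apply: (@differentiable_comp _ _ _ _ L) => //; exact: sf.
Qed.

Lemma smooth_onD U f g : open U -> smooth_on U f -> smooth_on U g ->
  smooth_on U (fun z => f z + g z).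
Proof.
move=> oU sf sg vs z Uz.
have E y : U y -> foldr (fun v g => 'D_v g) (fun z => f z + g z) vs y =
    foldr (fun v g => 'D_v g) f vs y + foldr (fun v g => 'D_v g) g vs y.
  elim: vs y => [//|v vs IH] y Uy /=.
  rewrite (derive_eq_on v oU Uy IH); apply: deriveD; apply: diff_derivable.
    exact: sf.
  exact: sg.
apply: (differentiable_eq_on oU Uz E).
by apply: differentiableD; [exact: sf|exact: sg].
Qed.

Lemma smooth_onS U U' f : U' `<=` U -> smooth_on U f -> smooth_on U' f.
Proof. by move=> U'U sf vs z /U'U; exact: sf. Qed.

End SmoothMaps.

(** * Orthonormal frames and the Euclidean norm *)

Section Orthonormal.
Context {R : realType} {n : nat}.
Implicit Types (V : 'M[R]_(2, n)) (x y a b : 'rV[R]_n).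

Lemma row_free2 V : \rank V = 2%N -> forall s t : R,
  s *: row 0 V + t *: row 1 V = 0 -> s = 0 /\ t = 0.
Proof.
move=> rV s t H; have fV : row_free V by rewrite /row_free rV.
pose D : 'rV[R]_2 := \row_i (if i == 0 then s else t).
have : D *m V = 0 *m V.
  by rewrite mul0mx mulmx_sum_row sum2 !mxE /= H.
move/(row_free_inj fV)/rowP => H'; split.
  by have := H' 0; rewrite !mxE.
by have := H' 1; rewrite !mxE.
Qed.

Lemma sub_rows2 V x : (x <= V)%MS <-> exists s t : R, x = s *: row 0 V + t *: row 1 V.
Proof.
split=> [/submxP[D ->]|[s [t ->]]].
  by exists (D 0 0), (D 0 1); rewrite mulmx_sum_row sum2.
by rewrite addmx_sub // scalemx_sub // row_sub.
Qed.

(** Gram-Schmidt. The triangular coefficients are exported because smoothness of the graph function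
    is given in the basis of the rows of [V] and must be carried over to [e1], [e2]. *)
Lemma orthobasis V : \rank V = 2%N -> exists e1 e2 : 'rV[R]_n, exists al be ga : R,
  [/\ [/\ dot e1 e1 = 1, dot e2 e2 = 1 & dot e1 e2 = 0],
      e1 = al *: row 0 V, e2 = be *: row 0 V + ga *: row 1 V &
      forall x, (x <= V)%MS <-> exists s t : R, x = s *: e1 + t *: e2].
Proof.
move=> rV; have fV := row_free2 rV.
set a := row 0 V in fV *; set b := row 1 V in fV *.
have D0 := gram_gt0 fV.
have E0 : 0 < dot a a.
  rewrite lt_neqAle dot_ge0 andbT eq_sym; apply/eqP => /dot_eq0 a0.
  by move: D0; rewrite a0 !dot0l !mul0r subrr ltxx.
set E := dot a a in E0 D0; set F := dot a b in D0; set G := dot b b in D0.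
(* [h] is the length of a, and [k] that of E b - F a, which is E times the part of b orthogonal to
   a. *)
pose h := Num.sqrt E; pose k := Num.sqrt (E * (E * G - F * F)).
have h0 : 0 < h by rewrite sqrtr_gt0.
have k0 : 0 < k by rewrite sqrtr_gt0 mulr_gt0.
have h2 : h * h = E by rewrite -expr2 sqr_sqrtr // ltW.
have k2 : k * k = E * (E * G - F * F) by rewrite -expr2 sqr_sqrtr // ltW // mulr_gt0.
have [hn kn En] : [/\ h != 0, k != 0 & E != 0] by rewrite !gt_eqF.
exists (h^-1 *: a), ((- F / k) *: a + (E / k) *: b), h^-1, (- F / k), (E / k).
have ba : dot b a = F by rewrite dotC.
split=> //.
  split; rewrite !(dotDl, dotDr, dotZl, dotZr) -/E -/G ?ba -/F.
  - by rewrite -h2; field.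
  - transitivity (E * (E * G - F * F) / (k * k)); first by field.
    by rewrite -k2; field.
  - by field; rewrite hn kn.
move=> x; rewrite sub_rows2 -/a -/b; split => -[s [t ->]].
  exists (h * (s + t * F / E)), (t * k / E).
  apply/rowP => i; rewrite !mxE; field.
  by rewrite hn kn En.
exists (s / h - t * F / k), (t * E / k).
by apply/rowP => i; rewrite !mxE; field; rewrite hn kn.
Qed.

Lemma cauchy_schwarz x y : dot x y * dot x y <= dot x x * dot y y.
Proof.
have [/dot_eq0 ->|y0] := eqVneq (dot y y) 0.
  by rewrite [dot x 0]dotC !dot0l !mulr0.
have ypos : 0 < dot y y by rewrite lt_neqAle eq_sym y0 dot_ge0.
have := dot_ge0 (dot y y *: x - dot x y *: y).
have -> : dot (dot y y *: x - dot x y *: y) (dot y y *: x - dot x y *: y) =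
    dot y y * (dot x x * dot y y - dot x y * dot x y).
  by rewrite !(dotBl, dotBr, dotZl, dotZr) [dot y x]dotC; ring.
by rewrite pmulr_rge0 // subr_ge0.
Qed.

Lemma dot_continuous y : continuous (fun x : 'rV[R]_n => dot x y).
Proof.
move=> x; apply: differentiable_continuous.
have -> : (fun x : 'rV[R]_n => dot x y) = \sum_i (fun x : 'rV[R]_n => x 0 i * y 0 i).
  by apply/funext => z; rewrite dotE fct_sumE.
apply: differentiable_sum => i; apply: differentiableM; last exact: differentiable_cst.
exact: differentiable_coord.
Qed.

Lemma enorm_ge0 x : 0 <= enorm x.
Proof. exact: sqrtr_ge0. Qed.

Lemma enorm_sqr x : enorm x * enorm x = dot x x.
Proof. by rewrite -expr2 sqr_sqrtr // dot_ge0. Qed.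

Lemma dot_le_enorm x y : `|dot x y| <= enorm x * enorm y.
Proof.
rewrite -(ler_pXn2r (n := 2)) ?nnegrE ?mulr_ge0 ?enorm_ge0 //.
rewrite real_normK ?num_real // !expr2 mulrACA !enorm_sqr.
exact: cauchy_schwarz.
Qed.

Lemma enormZ (s : R) x : enorm (s *: x) = `|s| * enorm x.
Proof.
rewrite /enorm dotZl dotZr mulrA sqrtrM -?expr2 ?sqr_ge0 // sqrtr_sqr.
by [].
Qed.

End Orthonormal.

Section AffineMap.
Context {R : realType} {n : nat}.
Variables (p a b : 'rV[R]_n).

Lemma is_diff_affine (z : R * R) :
  is_diff z (fun z : R * R => p + z.1 *: a + z.2 *: b) (fun v => v.1 *: a + v.2 *: b).
Proof.
have d1 := is_diff_fst z; have d2 := is_diff_snd z.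
have c1 : is_diff z (fun v : R * R => v.1 *: a) (fun v => v.1 *: a).
  have := @is_diff_comp _ _ _ _ (fst : R * R -> R) fst (fun s => s *: a) (fun s => s *:
    a) z d1 _.
  by apply; exact: is_diff_scalel.
have c2 : is_diff z (fun v : R * R => v.2 *: b) (fun v => v.2 *: b).
  have := @is_diff_comp _ _ _ _ (snd : R * R -> R) snd (fun s => s *: b) (fun s => s *:
    b) z d2 _.
  by apply; exact: is_diff_scalel.
have -> : (fun v : R * R => v.1 *: a + v.2 *: b) =
    ((0 : R * R -> 'rV[R]_n) + (fun v => v.1 *: a)) + (fun v => v.2 *: b).
  by apply/funext => v; rewrite !fctE /= add0r.
have c0 : is_diff z (cst p : R * R -> 'rV[R]_n) 0 by exact: is_diff_cst.
exact: (is_diffD (is_diffD c0 c1) c2).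
Qed.

Lemma open_enorm_affine (rho : R) :
  open [set z : R * R | rho < enorm (p + z.1 *: a + z.2 *: b)].
Proof.
pose P (z : R * R) := p + z.1 *: a + z.2 *: b.
have sP : smooth_on setT P by apply: smooth_on_affine; exact: is_diff_affine.
have cP : continuous (fun z => enorm (P z)).
  move=> z; apply: (@continuous_comp _ _ _ (fun z => dot (P z) (P z)) Num.sqrt).
    by apply: Cinf_setT_continuous; apply: Cinf_dot => //; exact: openT.
  exact: sqrt_continuous.
by apply: (@open_comp _ _ (fun z => enorm (P z)) [set x | rho < x]);
  [move=> z _; exact: cP|exact: open_gt].
Qed.

End AffineMap.

(** * From the graphical end to an open set with vanishing normal coordinates *)

Section ImmersedMinimal.
Context {R : realType} {n : nat} {M : topologicalType} {A : set (chart R M)}.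
Context {F : M -> 'rV[R]_n}.
Hypotheses (surfM : smooth_surface A) (immF : immersion A F) (minF : minimal A F).

Lemma immersion_ffdet_gt0 c z : A c -> chart_dom c z -> 0 < ffdet (F \o c) z.
Proof.
move=> Ac cz; have [sF inj] := immF Ac; have dF : differentiable (F \o c) z := sF [::] z cz.
apply: gram_gt0 => s t H.
have : 'd (F \o c) z ((s, t) : R * R) = 'd (F \o c) z 0.
  rewrite linear0; have -> : ((s, t) : R * R) = s *: ((1, 0) : R * R) + t *: ((0, 1) :
    R * R).
    by congr (_, _); rewrite /= /GRing.scale /= ?mulr0 ?mulr1 ?addr0 ?add0r.
  by rewrite linearD !linearZ /= -!deriveE //; rewrite ds.unlock dt.unlock in H.
by move/(inj z cz) => [-> ->].
Qed.

Lemma minimal_trace_tangent c z : A c -> chart_dom c z -> trace_tangent (F \o c) z.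
Proof.
move=> Ac cz; apply: trace_tangentP; first by rewrite gt_eqF // immersion_ffdet_gt0.
exact: minF.
Qed.

Section GraphicalEnd.
Context {p e1 e2 : 'rV[R]_n} {E : set M} {u : 'rV[R]_n -> 'rV[R]_n} {rho : R}.
Hypotheses (n1 : dot e1 e1 = 1) (n2 : dot e2 e2 = 1) (n12 : dot e1 e2 = 0).
Let P (z : R * R) := p + z.1 *: e1 + z.2 *: e2.
Let U := [set z | rho < enorm (P z)].
Hypotheses (oE : open E) (su : smooth_on U (u \o P)).
Hypothesis un : forall z, U z -> dot (u (P z)) e1 = 0 /\ dot (u (P z)) e2 = 0.
Hypothesis Egraph : forall q, E q -> exists2 z, U z & F q = P z + u (P z).
Hypothesis graphE : forall z, U z -> exists2 q, E q & F q = P z + u (P z).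
Hypothesis decayu : forall sg : R, 0 < sg -> exists r : R, forall z, U z ->
  r < enorm (P z) -> enorm (u (P z)) <= expR (- (sg * enorm (P z))).

Let X z := P z + u (P z).

Let smooth_P W : smooth_on W P.
Proof. by apply: smooth_on_affine; exact: is_diff_affine. Qed.

Let oU : open U. Proof. exact: open_enorm_affine. Qed.

Let sX : smooth_on U X.
Proof. by apply: smooth_onD => //; exact: smooth_P. Qed.

Let dP1 z : dot (P z) e1 = dot p e1 + z.1.
Proof. by rewrite /P !dotDl !dotZl n1 [dot e2 e1]dotC n12 mulr1 mulr0 addr0. Qed.
Let dP2 z : dot (P z) e2 = dot p e2 + z.2.
Proof. by rewrite /P !dotDl !dotZl n2 n12 mulr1 mulr0 addr0. Qed.

Let X1 z : U z -> dot (X z) e1 - dot p e1 = z.1.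
Proof. by move=> Uz; rewrite dotDl (un Uz).1 addr0 dP1 addrC addKr. Qed.
Let X2 z : U z -> dot (X z) e2 - dot p e2 = z.2.
Proof. by move=> Uz; rewrite dotDl (un Uz).2 addr0 dP2 addrC addKr. Qed.

(** Minimality is given in charts of [M]. On the part of a chart lying in the end, the tangential
    coordinates [g1], [g2] satisfy F o c = X o (g1, g2), which transfers the equation to the
    graph. *)
Let tX z : U z -> trace_tangent X z.
Proof.
move=> Uz; have [q Eq Fq] := graphE Uz.
have [c [w [Ac cw wq]]] := exists_chart surfM q.
pose N := chart_dom c `&` c @^-1` E.
have oN : open N by exact: (open_chart_preimage surfM).
have Nw : N w by split => //=; rewrite wq.
pose g1 y := dot (F (c y)) e1 - dot p e1; pose g2 y := dot (F (c y)) e2 - dot p e2.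
have sY : smooth_on N (F \o c).
  by apply: smooth_onS (proj1 (immF Ac)) => y [].
have gg y : N y -> exists2 z', U z' & F (c y) = X z' /\ (g1 y, g2 y) = z'.
  move=> [cy Ey]; have [z' Uz' H] := Egraph Ey; exists z' => //; split => //.
  by rewrite /g1 /g2 H -/(X z') X1 // X2 //; case: (z').
have -> : z = (g1 w, g2 w).
  by rewrite /g1 /g2 wq Fq -/(X z) X1 // X2 //; case: (z).
apply: (@trace_tangent_reparam R n U N X (F \o c) g1 g2 w) => //.
- by apply: CinfB; [apply: (Cinf_dotl oN _ sY)|exact: Cinf_cst].
- by apply: CinfB; [apply: (Cinf_dotl oN _ sY)|exact: Cinf_cst].
- by move=> y /gg[z' Uz' [_ ->]].
- by move=> y /gg[z' Uz' [H ->]].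
- exact: immersion_ffdet_gt0.
- exact: minimal_trace_tangent.
Qed.

Lemma end_normal_component_eq0 l : dot e1 l = 0 -> dot e2 l = 0 ->
  exists2 O : set M, open O /\ O !=set0 & forall q, O q -> dot (F q) l - dot p l = 0.
Proof.
move=> l1 l2.
pose kap := `|dot p e1| + `|dot p e2|.
have P1 z : `|z.1| <= enorm (P z) + `|dot p e1|.
  have := dot_le_enorm (P z) e1; rewrite {2}/enorm n1 sqrtr1 mulr1 dP1.
  by have := ler_normB (dot p e1 + z.1) (dot p e1); rewrite addrAC subrr add0r => ? ?; lra.
have P2 z : `|z.2| <= enorm (P z) + `|dot p e2|.
  have := dot_le_enorm (P z) e2; rewrite {2}/enorm n2 sqrtr1 mulr1 dP2.
  by have := ler_normB (dot p e2 + z.2) (dot p e2); rewrite addrAC subrr add0r => ? ?; lra.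
pose c0 := rho + `|dot p e1|.
have HU (z : R * R) : c0 < z.1 -> U z.
  rewrite /c0 /U /= => H; have := P1 z; have := ler_norm z.1; lra.
have vE z : U z -> dot (X z) l - dot p l = dot (u (P z)) l.
  by move=> Uz; rewrite /X /P !dotDl !dotZl l1 l2; ring.
have [c Hc] : exists c, forall z : R * R, c < z.1 -> dot (X z) l - dot p l = 0.
  apply: (@graph_end_vanish R n U X e1 e2 l (dot p e1) (dot p e2) (dot p l) c0) => //.
  (* The factor 2 pays for |z.1| + |z.2| <= 2 |P z| + kap; the extra 1 leaves a factor e^(-nn) that
     absorbs the constant [K]. *)
  move=> sg sg0; pose sg2 := 2 * (sg + 1).
  have sg20 : 0 < sg2 by rewrite mulr_gt0 // ltr_wpDl // ltW.
  have [r hr] := decayu sg20.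
  pose K := enorm l * expR ((sg + 1) * kap).
  exists (Num.max (2 * r + kap) K) => z cz; set nn := `|z.1| + `|z.2|; rewrite gt_max
    => /andP[nr nK].
  have Uz := HU _ cz.
  have nP : nn <= 2 * enorm (P z) + kap.
    by rewrite /nn /kap; have := P1 z; have := P2 z; lra.
  rewrite vE //; apply: le_trans (dot_le_enorm _ _) _.
  apply: (@le_trans _ _ (expR (- (sg2 * enorm (P z))) * enorm l)).
    by rewrite ler_wpM2r ?enorm_ge0 // hr //; lra.
  apply: (@le_trans _ _ (expR (- ((sg + 1) * (nn - kap))) * enorm l)).
    rewrite ler_wpM2r ?enorm_ge0 // ler_expR lerN2 /sg2 -mulrA [2 * _]mulrC -mulrA.
    by rewrite ler_pM2l; lra.
  rewrite (_ : - _ = (sg + 1) * kap + - ((sg + 1) * nn)); last by ring.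
  rewrite expRD mulrAC -[X in X * _]mulrC -/K.
  apply: (@le_trans _ _ (expR nn * expR (- ((sg + 1) * nn)))).
    rewrite ler_wpM2r ?expR_ge0 //; apply: le_trans (ltW nK) _.
    by apply: le_trans (expR_ge1Dx _); rewrite lerDr.
  by rewrite -expRD ler_expR; lra.
pose c' := Num.max c c0.
pose O := E `&` [set q | c' < dot (F q) e1 - dot p e1].
have cF := immersion_continuous surfM immF.
exists O.
  split.
    apply: openI => //.
    have cd : continuous (fun q => dot (F q) e1 - dot p e1).
      move=> q; apply: cvgB; last exact: cvg_cst.
      apply: (@continuous_comp _ _ _ F (fun x => dot x e1)); first exact: cF.
      exact: dot_continuous.
    by apply: (@open_comp _ _ (fun q => dot (F q) e1 - dot p e1) [set x | c' < x]);
      [move=> q _; exact: cd|exact: open_gt].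
  have Uz : U (c' + 1, 0).
    by apply: HU; rewrite /= ltr_pwDr // le_max lexx orbT.
  have [q Eq Fq] := graphE Uz; exists q; split => //=.
  by rewrite Fq -/(X _) X1 //= ltrDl.
move=> q [/Egraph[z Uz Fq]] /=; rewrite Fq -/(X z) X1 // gt_max => /andP[cz _].
exact: Hc.
Qed.
End GraphicalEnd.
End ImmersedMinimal.

(** * Unique continuation *)

Lemma connected_clopen (T : topologicalType) (Z : set T) : connected [set: T] ->
  open Z -> closed Z -> Z !=set0 -> Z = setT.
Proof.
move=> cT oZ cZ Z0; apply: cT => //; exists Z => //; by rewrite setTI.
Qed.

Section UniqueContinuation.
Context {R : realType} {n : nat} {M : topologicalType} {A : set (chart R M)}.
Context {F : M -> 'rV[R]_n}.
Hypotheses (surfM : smooth_surface A) (immF : immersion A F) (minF : minimal A F).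
Hypothesis connM : connected [set: M].

Lemma sqd_ball (z : R * R) (d : R) y : 0 < d -> sqd z y < d * d -> ball z d y.
Proof.
move=> d0; rewrite /sqd => H.
have H1 : `|y.1 - z.1| < d.
  rewrite -(ltr_pXn2r (n := 2)) ?nnegrE ?(ltW d0) // real_normK ?num_real // !expr2.
  by apply: le_lt_trans H; rewrite lerDl -expr2 sqr_ge0.
have H2 : `|y.2 - z.2| < d.
  rewrite -(ltr_pXn2r (n := 2)) ?nnegrE ?(ltW d0) // real_normK ?num_real // !expr2.
  by apply: le_lt_trans H; rewrite lerDr -expr2 sqr_ge0.
by split; rewrite /= -ball_normE /= distrC.
Qed.

Lemma ball_sqd (z : R * R) (d : R) y : ball z d y -> sqd z y < 2 * (d * d).
Proof.
move=> [] /=; rewrite -!ball_normE /= => H1 H2.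
have d0 : 0 <= d := le_trans (normr_ge0 _) (ltW H1).
have K1 : (z.1 - y.1) ^+ 2 < d ^+ 2 by rewrite -real_normK ?num_real // ltr_pXn2r ?nnegrE.
have K2 : (z.2 - y.2) ^+ 2 < d ^+ 2 by rewrite -real_normK ?num_real // ltr_pXn2r ?nnegrE.
by move: K1 K2; rewrite /sqd !expr2 => ? ?; lra.
Qed.

(** The interior of the zero set is nonempty, and it is closed: from a zero disc close to a limit
    point, [unique_continuation] spreads the zeros over a larger disc containing that point. *)
Lemma normal_component_eq0 (l : 'rV[R]_n) (a : R) (O : set M) :
  open O -> O !=set0 -> (forall q, O q -> dot (F q) l - a = 0) ->
  forall q, dot (F q) l - a = 0.
Proof.
move=> oO O0 FO q.
pose Z := [set q | dot (F q) l - a = 0]^°.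
suff ZT : Z = setT.
  have : Z q by rewrite ZT.
  by move=> /interior_subset.
apply: connected_clopen => //; first exact: open_interior.
  move=> q1 clq; rewrite /Z /interior /=.
  have [c [z1 [Ac cz zq]]] := exists_chart surfM q1.
  have sX : smooth_on (chart_dom c) (F \o c) by have [] := immF Ac.
  have oD : open (chart_dom c) by exact: (open_chart_dom surfM).
  set X := F \o c in sX *.
  (* With the tangent vectors at [z1] as linear functions, [jac] at [z1] is the Gram determinant,
     hence positive nearby. *)
  pose l1 := ds X z1; pose l2 := dt X z1.
  have Cj : Cinf (chart_dom c) (jac (X := X) (l1 := l1) (l2 := l2)).
    by apply: CinfB; apply: CinfM; apply: (Cinf_dotl oD); (exact: smooth_ds || exact:
      smooth_dt).
  have j1 : 0 < jac (X := X) (l1 := l1) (l2 := l2) z1.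
    have := immersion_ffdet_gt0 immF Ac cz.
    by rewrite /ffdet /jac /ffE /ffF /ffG -/X -/l1 -/l2 [dot l2 l1]dotC.
  have : nbhs z1 [set z | chart_dom c z /\ 0 < jac (X := X) (l1 := l1) (l2 := l2) z].
    apply: filterI; first exact: open_nbhs_nbhs.
    have cj : {for z1, continuous (jac (X := X) (l1 := l1) (l2 := l2))}.
      exact: (Cinf_continuous oD Cj).
    exact: (cvgr_gt _ cj _ j1).
  move=> /nbhs_ballP[r /= r0 rB].
  pose U := ball z1 r.
  have oU : open U by exact: ball_open.
  have UD : U `<=` chart_dom c by move=> z /rB[].
  have j0 z : U z -> 0 < jac (X := X) (l1 := l1) (l2 := l2) z by move=> /rB[].
  have sXU : smooth_on U X by exact: smooth_onS UD sX.
  have tX z : U z -> trace_tangent X z.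
    by move=> Uz; exact: (minimal_trace_tangent immF minF Ac (UD _ Uz)).
  pose k := min_coframe (X := X) (l1 := l1) (l2 := l2).
  have clk : closed_coframe U k by exact: closed_min_coframe.
  pose v z := dot (X z) l - a.
  have hv : frame_harmonic U k v.
    have [Cf Lf] := harmonic_min_coframe oU sXU tX j0 l; have Cb := Cinf_cst U (- a).
    split; first exact: CinfD.
    by move=> z Uz; rewrite (lapD oU clk Cf Cb Uz) (lap_cst oU _ Uz) Lf // addr0.
  (* Around a zero point within r / 4 of [z1], the Euclidean disc of radius r / 2 contains [z1] and
     stays in the sup-norm ball [U]. *)
  have r40 : 0 < r / 4 by rewrite divr_gt0.
  have [zs [zsB Zzs]] : exists zs, ball z1 (r / 4) zs /\ Z (c zs).
    have := chart_nbhs_image surfM Ac cz (nbhsx_ballx z1 _ r40).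
    by rewrite zq => /clq[q2 [Zq2 [y yB yq]]]; exists y; rewrite yq.
  have zsD : chart_dom c zs.
    by apply: UD; apply: le_ball zsB; rewrite ler_pdivrMr // ler_peMr ?ler1n // ltW.
  have : nbhs zs [set z | v z = 0].
    exact: (chart_continuous surfM Ac zsD Zzs).
  move=> /nbhs_ballP[e /= e0 eB].
  have [d [d0 de dr]] := exists_lt_min e0 r40.
  pose r' := r / 2 * (r / 2).
  have r'U : [set z | sqd zs z <= r'] `<=` U.
    move=> z /= H.
    have : ball zs (3 * r / 4) z.
      apply: sqd_ball; first by lra.
      by apply: le_lt_trans H _; rewrite /r'; nra.
    move=> H'; have := ball_triangle zsB H'.
    by rewrite (_ : r / 4 + _ = r) //; lra.
  have dr' : d * d < r' by rewrite /r' ltr_pM // ?ltW //; lra.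
  have w0 z : sqd zs z < d * d -> gsq k v z = 0.
    move=> H.
    have ez : ball zs e z by apply: le_ball (ltW de) _ _; exact: sqd_ball.
    have E y : ball zs e y -> v y = 0 by exact: eB.
    have be : open (ball zs e) by exact: ball_open.
    have dsv : ds v z = 0 by rewrite ds.unlock (derive_eq_on _ be ez E) derive_cst.
    have dtv : dt v z = 0 by rewrite dt.unlock (derive_eq_on _ be ez E) derive_cst.
    by rewrite /gsq /gdot /fd dsv dtv !mulr0 addr0 mulr0 addr0.
  have w1 := unique_continuation oU clk hv (mulr_gt0 d0 d0) dr' r'U w0.
  have v0 z : sqd zs z < r' -> v z = 0.
    move=> zr.
    have seg h : 0 <= h <= 1 -> sqd zs (zs + h *: (z - zs)) < r'.
      move=> /andP[h0 h1]; apply: le_lt_trans zr.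
      have -> : sqd zs (zs + h *: (z - zs)) = h * h * sqd zs z.
        by rewrite /sqd /= /GRing.scale /=; ring.
      by rewrite ler_piMl ?sqd_ge0 // mulr_ile1.
    have dv y : sqd zs y < r' -> differentiable v y.
      by move=> /ltW /r'U Uy; exact: (Cinf_differentiable oU (proj1 hv)).
    have [h h01|h h01 E] := @MVT_line _ _ v zs (z - zs).
      exact/dv/seg.
    have vzs : v zs = 0 by apply: eB; exact: ballxx.
    have Uh : U (zs + h *: (z - zs)) by apply: r'U; apply/ltW/seg.
    move: E; rewrite [zs + (z - zs)]addrC subrK vzs subr0 => ->.
    rewrite derive_dsdt; last exact/dv/seg.
    have := w1 _ (seg _ h01); rewrite /gsq /gdot -!expr2 => /eqP.
    rewrite paddr_eq0 ?sqr_ge0 // !sqrf_eq0 => /andP[/eqP f1 /eqP f2].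
    by rewrite (dsE clk _ Uh) (dtE clk _ Uh) f1 f2 !mul0r !addr0 !mulr0 addr0.
  have : nbhs z1 [set z | sqd zs z < r'].
    apply: open_nbhs_nbhs; split; first by apply: open_lt_Cinf; exact: Cinf_sqd.
    have := ball_sqd (ball_sym zsB); rewrite /=.
    by move/lt_trans; apply; rewrite /r'; nra.
  move=> /(chart_nbhs_image surfM Ac cz); rewrite zq.
  by apply: filterS => _ [z zr <-]; exact: v0.
have [q0 Oq0] := O0; exists q0; rewrite /Z /interior /=.
by apply: (filterS FO); exact: open_nbhs_nbhs.
Qed.
End UniqueContinuation.

(** * Complete flat surfaces *)

Section PlaneMaps.
Context {R : realType} {U : set (R * R)} {x y : R * R -> R}.
Hypotheses (oU : open U) (Cx : Cinf U x) (Cy : Cinf U y).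

Let dx z : U z -> differentiable x z. Proof. exact: Cinf_differentiable. Qed.
Let dy z : U z -> differentiable y z. Proof. exact: Cinf_differentiable. Qed.

(** A Jacobian with its two rows taken at different points, since the mean value theorem gives
    separate intermediate points for x and y. *)
Definition jac2 z w := ds x z * dt y w - dt x z * ds y w.

Lemma local_inj2 z0 : U z0 -> jac2 z0 z0 != 0 -> exists2 r : R, 0 < r &
  [/\ ball z0 r `<=` U, forall z, ball z0 r z -> jac2 z z != 0 &
      forall a b, ball z0 r a -> ball z0 r b -> x a = x b -> y a = y b -> a = b].
Proof.
move=> Uz0 j0.
have Cs : Cinf U (ds x) /\ Cinf U (ds y) by rewrite ds.unlock; split; exact: Cinf_derive.
have Ct : Cinf U (dt x) /\ Cinf U (dt y) by rewrite dt.unlock; split; exact: Cinf_derive.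
have c1 f : Cinf U f -> (f \o fst) cc @[cc --> (z0, z0)] --> f z0.
  move=> Cf; apply: continuous_comp; first exact: cvg_fst.
  exact: (Cinf_continuous oU Cf).
have c2 f : Cinf U f -> (f \o snd) cc @[cc --> (z0, z0)] --> f z0.
  move=> Cf; apply: continuous_comp; first exact: cvg_snd.
  exact: (Cinf_continuous oU Cf).
have cJ : jac2 cc.1 cc.2 @[cc --> (z0, z0)] --> jac2 z0 z0.
  apply: cvgB; apply: cvgM; [exact: c1 Cs.1|exact: c2 Ct.2|exact: c1 Ct.1|exact: c2 Cs.2].
have : nbhs (z0, z0) [set cc | jac2 cc.1 cc.2 != 0].
  exact: (cvgr_neq0 _ cJ j0).
move=> /nbhs_ballP[r1 /= r10 B1].
have /nbhs_ballP[r2 /= r20 B2] : nbhs z0 U by exact: open_nbhs_nbhs.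
have [r [r0 rr1 rr2]] := exists_lt_min r10 r20.
have rB1 c d : ball z0 r c -> ball z0 r d -> jac2 c d != 0.
  move=> Bc Bd; apply: (B1 (c, d)).
  by split => /=; [apply: le_ball Bc|apply: le_ball Bd]; exact: ltW.
have rB2 : ball z0 r `<=` U by move=> z Bz; apply: B2; apply: le_ball Bz; exact: ltW.
exists r => //; split => // [z Bz|a b Ba Bb xab yab]; first exact: rB1.
have seg h : 0 <= h <= 1 -> ball z0 r (a + h *: (b - a)).
  by move=> h01; apply: segment_closed_ball.
have [h h01|h h01 Ex] := @MVT_line _ _ x a (b - a); first exact/dx/rB2/seg.
have [h' h01'|h' h01' Ey] := @MVT_line _ _ y a (b - a); first exact/dy/rB2/seg.
move: Ex Ey; rewrite [a + (b - a)]addrC subrK xab yab !subrr.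
rewrite (derive_dsdt _ (dx (rB2 _ (seg _ h01)))) (derive_dsdt _ (dy (rB2 _ (seg _ h01')))).
set c := a + h *: _; set d := a + h' *: _ => Ex Ey.
have J : ds x c * dt y d - ds y d * dt x c != 0.
  by rewrite [ds y d * _]mulrC; exact: rB1 (seg _ h01) (seg _ h01').
have [X0 Y0] : (b - a).1 = 0 /\ (b - a).2 = 0.
  split; apply: (mulIf J); rewrite mul0r.
    transitivity (((b - a).1 * ds x c + (b - a).2 * dt x c) * dt y d
      - ((b - a).1 * ds y d + (b - a).2 * dt y d) * dt x c); first by ring.
    by rewrite -Ex -Ey !mul0r subrr.
  transitivity (((b - a).1 * ds y d + (b - a).2 * dt y d) * ds x c
      - ((b - a).1 * ds x c + (b - a).2 * dt x c) * ds y d); first by ring.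
  by rewrite -Ex -Ey !mul0r subrr.
apply/esym/eqP; rewrite -subr_eq0; apply/eqP.
by move: X0 Y0; case: (b - a) => ? ? /= -> ->.
Qed.

(* Points near (x z0, y z0) are attained where the squared distance to them is
   minimal on a small disc. *)
Lemma open_map2 z0 (W : set (R * R)) : U z0 -> jac2 z0 z0 != 0 -> nbhs z0 W ->
  nbhs (x z0, y z0) ((fun z => (x z, y z)) @` W).
Proof.
move=> Uz0 j0 zW; have [r r0 [rU rj rinj]] := local_inj2 Uz0 j0.
have /nbhs_ballP[r1 /= r10 B1] := zW.
have [d [d0 dr dr1]] := exists_lt_min r0 r10.
pose s := d / 2 * (d / 2); have s0 : 0 < s by rewrite !mulr_gt0 // divr_gt0.
have sB z : sqd z0 z <= s -> ball z0 d z.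
  by move=> H; apply: sqd_ball => //; apply: le_lt_trans H _; rewrite /s; nra.
pose K := [set z | sqd z0 z <= s]; pose S := K `&` [set z | - sqd z0 z <= - s].
have cK : compact K by exact: compact_sqd.
have cS : compact S.
  apply: compact_closedI => //; apply: closed_le_Cinf; apply: CinfN; exact: Cinf_sqd.
have KU : K `<=` U by move=> z /sB Bz; apply: rU; apply: le_ball Bz; exact: ltW.
have SU : S `<=` U by move=> z [/KU].
have S0 : S !=set0.
  exists (z0.1 + d / 2, z0.2); rewrite /S /K /sqd /=.
  by rewrite subrr mulr0 addr0 addrAC subrr add0r; split.
pose G (a b : R) z := (x z - a) * (x z - a) + (y z - b) * (y z - b).
have CG a b : Cinf U (G a b).
  by apply: CinfD; apply: CinfM; apply: CinfB => //; exact: Cinf_cst.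
have G0 a b z : 0 <= G a b z by rewrite /G addr_ge0 // -expr2 sqr_ge0.
have [p Sp pmin] := compact_max oU (CinfN (CG (x z0) (y z0))) cS SU S0.
set m := G (x z0) (y z0) p.
have m0 : 0 < m.
  rewrite lt_neqAle G0 andbT eq_sym; apply/eqP => /eqP.
  rewrite /m /G -!expr2 paddr_eq0 ?sqr_ge0 // !sqrf_eq0 !subr_eq0 => /andP[/eqP e1 /eqP e2].
  have pz : p = z0.
    apply: rinj => //; last exact: ballxx.
    by apply: le_ball (sB _ Sp.1); exact: ltW.
  by case: Sp => _ /=; rewrite pz /sqd !subrr !mulr0 addr0 oppr0 oppr_ge0 leNgt s0.
(* The image of the circle is at distance at least sqrt m from that of [z0]. A target within sqrt m
   / 2 of the latter is therefore nearest to an interior point of the disc. *)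
have : nbhs (x z0, y z0) [set w | sqd (x z0, y z0) w < m / 4].
  apply: open_nbhs_nbhs; split; first by apply: open_lt_Cinf; exact: Cinf_sqd.
  by rewrite /sqd /= !subrr !mulr0 addr0 divr_gt0.
apply: filterS => -[a b]; rewrite /sqd /= => ab.
have K0 : K !=set0 by exists z0; rewrite /K /sqd /= !subrr !mulr0 addr0 ltW.
have [q Kq qmin] := compact_max oU (CinfN (CG a b)) cK KU K0.
have Gq : G a b q < m / 4.
  apply: le_lt_trans ab.
  have := qmin z0; rewrite lerN2 => H; apply: le_trans (H _) _.
    by rewrite /K /sqd /= !subrr !mulr0 addr0 ltW.
  by rewrite /G; lra.
have nSq : sqd z0 q < s.
  rewrite lt_neqAle Kq andbT; apply/eqP => sq.
  have := pmin q; rewrite lerN2 => H.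
  have {}H : m <= G (x z0) (y z0) q by apply: H; split => //=; rewrite sq.
  have := sqr_ge0 (x q - a + (x z0 - a)); have := sqr_ge0 (y q - b + (y z0 - b)).
  rewrite !expr2; move: H Gq ab; rewrite /G => ? ? ? ? ?; lra.
have qmax : \forall z \near q, - G a b z <= - G a b q.
  have : nbhs q [set z | sqd z0 z < s].
    by apply: open_nbhs_nbhs; split => //; apply: open_lt_Cinf; exact: Cinf_sqd.
  by apply: filterS => z /ltW; exact: qmin.
have Uq := KU _ Kq.
have D v : 'D_v (G a b) q = 2 * ((x q - a) * 'D_v x q + (y q - b) * 'D_v y q).
  have dxa : differentiable (fun z => x z - a) q by apply: differentiableB => //; exact: dx.
  have dyb : differentiable (fun z => y z - b) q by apply: differentiableB => //; exact: dy.
  rewrite derive_lin2 // (derive_add _ (dx Uq)) ?(derive_add _ (dy Uq)) //.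
  by rewrite !derive_cst; ring.
(* At the interior minimum the residual is killed by the invertible Jacobian, hence zero. *)
have D0 v : (x q - a) * 'D_v x q + (y q - b) * 'D_v y q = 0.
  have [+ _] := local_max_derive v oU (CinfN (CG a b)) Uq qmax.
  have dG : differentiable (G a b) q by exact: (Cinf_differentiable oU (CG a b)).
  rewrite (derive_opp v dG) D => /eqP.
  by rewrite oppr_eq0 mulf_eq0 pnatr_eq0 /= => /eqP.
have jq : ds x q * dt y q - ds y q * dt x q != 0.
  rewrite [ds y q * _]mulrC; apply: rj; apply: le_ball (sB _ Kq); exact: ltW.
have e1 : (x q - a) * ds x q + (y q - b) * ds y q = 0 by rewrite ds.unlock; exact: D0.
have e2 : (x q - a) * dt x q + (y q - b) * dt y q = 0 by rewrite dt.unlock; exact: D0.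
have [X0 Y0] : x q - a = 0 /\ y q - b = 0.
  split; apply: (mulIf jq); rewrite mul0r.
    transitivity (((x q - a) * ds x q + (y q - b) * ds y q) * dt y q
       - ((x q - a) * dt x q + (y q - b) * dt y q) * ds y q); first by ring.
    by rewrite e1 e2 !mul0r subrr.
  transitivity (((x q - a) * dt x q + (y q - b) * dt y q) * ds x q
       - ((x q - a) * ds x q + (y q - b) * ds y q) * dt x q); first by ring.
  by rewrite e1 e2 !mul0r subrr.
exists q; first by apply: B1; apply: le_ball (sB _ Kq); exact: ltW.
by rewrite -[x q](subrK a) X0 -[y q](subrK b) Y0 !add0r.
Qed.
End PlaneMaps.

(** * Global inversion by growing sheets *)

Section Covering.
Context {R : realType} {M : topologicalType} {f : M -> R * R}.
Hypotheses (hM : hausdorff_space M) (connM : connected [set: M]).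
Hypothesis cf : continuous f.
Hypothesis fopen : forall q (W : set M), nbhs q W -> nbhs (f q) (f @` W).
Implicit Types (O : set M) (B : set (R * R)) (q a b : M) (y z w : R * R).

(* Since f is continuous and open, it then maps O homeomorphically onto B. *)
Definition sheet O B := [/\ open O, forall a b, O a -> O b -> f a = f b -> a = b &
  f @` O = B].

Let sheet_img O B a : sheet O B -> O a -> B (f a).
Proof. by move=> [_ _ <-] Oa; exists a. Qed.

Let sheet_lift O B y : sheet O B -> B y -> exists2 a, O a & f a = y.
Proof. by move=> [_ _ <-] [a Oa fa]; exists a. Qed.

(** Uniqueness of lifts. The image of the common part of the sheets is open, and closed in the
    intersection of [B1] and [B2] because distinct lifts of a point have disjoint neighbourhoods;
    that intersection is convex, hence connected. *)
Lemma sheet_unique O1 O2 B1 B2 : sheet O1 B1 -> sheet O2 B2 ->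
  segment_closed B1 -> segment_closed B2 -> O1 `&` O2 !=set0 ->
  forall a b, O1 a -> O2 b -> f a = f b -> a = b.
Proof.
move=> S1 S2 c1 c2 O12; have [ op1 i1 _] := S1; have [ op2 i2 _] := S2.
have hM' := hM; rewrite open_hausdorff in hM'.
pose C := f @` (O1 `&` O2).
have oC : open C.
  rewrite openE => _ [q Oq <-]; apply: fopen; apply: open_nbhs_nbhs; split => //.
  exact: openI.
pose D := (~` C)^°.
have CB : C `<=` B1 `&` B2.
  by move=> _ [q [ O1q O2q] <-]; split; [exact: sheet_img O1q|exact: sheet_img O2q].
have DC : B1 `&` B2 `&` ~` D `<=` C.
  move=> y [[B1y B2y] nDy]; apply: contrapT => nCy; apply: nDy.
  have [a O1a fa] := sheet_lift S1 B1y; have [b O2b fb] := sheet_lift S2 B2y.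
  have ab : a != b.
    by apply/eqP => ab; apply: nCy; exists a => //; split => //; rewrite ab.
  have [[Na Nb] [aN bN] [ oNa oNb /eqP NN]] := hM' a b ab.
  rewrite /D /interior /=.
  have Ha : nbhs y (f @` (Na `&` O1)).
    rewrite -fa; apply: fopen; apply: filterI; apply: open_nbhs_nbhs; split => //=.
    by rewrite inE in aN.
  have Hb : nbhs y (f @` (Nb `&` O2)).
    rewrite -fb; apply: fopen; apply: filterI; apply: open_nbhs_nbhs; split => //=.
    by rewrite inE in bN.
  apply: filterS (filterI Ha Hb) => z [[a' [Na' O1a'] <-] [b' [Nb' O2b'] fb']] [q [ O1q
    O2q] fq].
  have qa : q = a' by apply: i1.
  have qb : q = b' by apply: i2 => //; rewrite fb'.
  have : (Na `&` Nb) q by split; [rewrite qa|rewrite qb].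
  by rewrite NN.
have cB : connected (B1 `&` B2).
  apply: segment_closed_connected => y z t [? ?] [? ?] t01.
  by split; [exact: c1|exact: c2].
have CE : C = B1 `&` B2.
  apply: cB.
  - by have [q Oq] := O12; exists (f q), q.
  - by exists C => //; apply/seteqP; split => [y Cy|y []//]; split => //; exact: CB.
  - exists (~` D); first by apply: open_closedC; exact: open_interior.
    apply/seteqP; split => [y Cy|]; last exact: DC.
    by split; [exact: CB|move=> /interior_subset].
move=> a b O1a O2b fab.
have : C (f a).
  by rewrite CE; split; [exact: sheet_img O1a|rewrite fab; exact: sheet_img O2b].
move=> [q [ O1q O2q] fq].
rewrite -(i1 q a O1q O1a fq); apply: i2 => //; by rewrite fq.
Qed.

Lemma sheet_restrict O B B' : sheet O B -> open B' -> B' `<=` B ->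
  sheet (O `&` f @^-1` B') B'.
Proof.
move=> [ oO iO fO] oB' B'B; split.
- by apply: openI => //; apply: open_comp => // q _; exact: cf.
- by move=> a b [ Oa _] [ Ob _]; exact: iO.
- apply/seteqP; split => [_ [a [_ ?] <-]//|y B'y].
  by have := B'B _ B'y; rewrite -fO => -[a Oa fa]; exists a => //; split => //=; rewrite fa.
Qed.

Lemma sheet_bigcup (I : Type) (P : set I) (O : I -> set M) (B : I -> set (R * R)) :
  (forall i, P i -> sheet (O i) (B i)) ->
  (forall i j, P i -> P j -> forall a b, O i a -> O j b -> f a = f b -> a = b) ->
  sheet (\bigcup_(i in P) O i) (\bigcup_(i in P) B i).
Proof.
move=> SI IJ; split.
- by apply: bigcup_open => i /SI[].
- by move=> a b [i Pi Oa] [j Pj Ob]; exact: IJ Oa Ob.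
- apply/seteqP; split => [_ [a [i Pi Oa] <-]|y [i Pi Biy]].
    by exists i => //; exact: sheet_img (SI _ Pi) Oa.
  by have [a Oa fa] := sheet_lift (SI _ Pi) Biy; exists a => //; exists i.
Qed.

Hypothesis local_inj : forall q, exists2 O, nbhs q O &
  forall a b, O a -> O b -> f a = f b -> a = b.

Lemma local_sheet q : exists (r : R) O, [/\ 0 < r, O q & sheet O (ball (f q) r)].
Proof.
have [W qW iW] := local_inj q.
have oW : open W^° by exact: open_interior.
have qW' : W^° q by [].
have /nbhs_ballP[r /= r0 rB] : nbhs (f q) (f @` W^°).
  by apply: fopen; exact: open_nbhs_nbhs.
exists r, (W^° `&` f @^-1` ball (f q) r); split => //.
  by split => //=; exact: ballxx.
apply: (@sheet_restrict _ (f @` W^°)) => //; last exact: ball_open.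
by split => // a b /interior_subset Wa /interior_subset Wb; exact: iW.
Qed.

Lemma segment_closedT : segment_closed [set: R * R].
Proof. by []. Qed.

(** The form in which completeness enters: lifts over an open square have limits over its
    boundary. *)
Hypothesis lim_sheet : forall O y0 (r : R) y, sheet O (ball y0 r) -> 0 < r ->
  `|y - y0| <= r -> exists2 q, f q = y & closure O q.

(** The largest left end lies below the smallest right end. Coordinatewise this yields a common
    point of three pairwise intersecting squares, a property that round discs lack. *)
Lemma helly_itv (a b c r s t : R) :
  (exists x, `|a - x| < r /\ `|b - x| < s) -> (exists x, `|b - x| < s /\ `|c - x| < t) ->
  (exists x, `|a - x| < r /\ `|c - x| < t) ->
  exists x, [/\ `|a - x| < r, `|b - x| < s & `|c - x| < t].
Proof.
move=> [x [xa xb]] [y [yb yc]] [z [za zc]].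
pose lo := Num.max (a - r) (Num.max (b - s) (c - t)).
pose hi := Num.min (a + r) (Num.min (b + s) (c + t)).
move: xa xb yb yc za zc; rewrite !ltr_norml => /andP[? ?] /andP[? ?] /andP[? ?] /andP[?
  ?] /andP[? ?] /andP[? ?].
have lohi : lo < hi.
  rewrite /lo /hi !gt_max !lt_min; do ![apply/andP; split]; lra.
have [m lm mh] : exists2 m, lo < m & m < hi by exists ((lo + hi) / 2); lra.
move: lm mh; rewrite /lo /hi !gt_max !lt_min => /and3P[? ? ?] /and3P[? ? ?].
by exists m; rewrite !ltr_norml; split; apply/andP; split; lra.
Qed.

Lemma helly_ball (y1 y2 y3 : R * R) (r s t : R) : ball y1 r `&` ball y2 s !=set0 ->
  ball y2 s `&` ball y3 t !=set0 -> ball y1 r `&` ball y3 t !=set0 ->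
  exists w, [/\ ball y1 r w, ball y2 s w & ball y3 t w].
Proof.
move=> [u [[u1 u2] [u3 u4]]] [v [[v1 v2] [v3 v4]]] [w [[w1 w2] [w3 w4]]].
have [x1 [a1 a2 a3]] : exists x, [/\ `|y1.1 - x| < r, `|y2.1 - x| < s & `|y3.1 - x| < t].
  by apply: helly_itv; [exists u.1|exists v.1|exists w.1].
have [x2 [b1 b2 b3]] : exists x, [/\ `|y1.2 - x| < r, `|y2.2 - x| < s & `|y3.2 - x| < t].
  by apply: helly_itv; [exists u.2|exists v.2|exists w.2].
by exists (x1, x2).
Qed.

Lemma ball_prod_norm y w (r : R) : ball y r w <-> `|w - y| < r.
Proof. by rewrite -ball_normE /= distrC. Qed.

Lemma closed_ball_lebesgue y0 (r : R) B : 0 < r -> open B ->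
  (forall y, `|y - y0| <= r -> B y) -> exists2 d : R, 0 < d & ball y0 (r + d) `<=` B.
Proof.
move=> r0 oB KB.
pose I (a : R) := [set x : R | x \in `[a - r, a + r]].
have cK : compact (I y0.1 `*` I y0.2) by apply: compact_setX; exact: segment_compact.
have IK y : (I y0.1 `*` I y0.2) y -> `|y - y0| <= r.
  by rewrite /I => -[] /=; rewrite !in_itv /= -!lter_distl prod_normE ge_max => -> ->.
have key : \forall d \near (0 : R)^'+, (I y0.1 `*` I y0.2) `<=` (fun y => ball y d `<=` B).
  move/compact_near_coveringP : cK; apply.
  move=> y /IK /KB By.
  have /nbhs_ballP[e /= e0 eB] : nbhs y B by exact: open_nbhs_nbhs.
  have e20 : 0 < e / 2 by rewrite divr_gt0.
  exists (ball y (e / 2), [set d : R | d < e / 2]).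
    by split => /=; [exact: nbhsx_ballx|exact: nbhs_right_lt].
  move=> [z d] [/= zB dB] w wz; apply: eB.
  rewrite (splitr e); apply: ball_triangle zB _.
  by apply: le_ball wz; exact: ltW.
have [d [d0 dB]] := filter_ex (filterI (nbhs_right_gt (0 : R)) key).
exists d => //= w /ball_prod_norm wr.
have rd : 0 < r + d by rewrite addr_gt0.
(* Shrinking by t towards [y0] brings the ball of radius r + d into the closed ball of radius r and
   moves each point by less than d. *)
pose t := r / (r + d).
have t0 : 0 <= t by rewrite divr_ge0 // ltW.
have t1 : 1 - t = d / (r + d) by rewrite /t; field; rewrite gt_eqF.
have t10 : 0 < 1 - t by rewrite t1 divr_gt0.
apply: (dB (y0 + t *: (w - y0))).
  have H : `|t *: (w - y0)| <= r.
    rewrite normrZ ger0_norm // /t mulrAC ler_pdivrMr // ler_wpM2l ?(ltW r0) //.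
    exact: ltW.
  move: H; rewrite prod_normE ge_max => /andP[H1 H2].
  by split; rewrite /I /= in_itv /= -lter_distl addrAC subrr add0r.
apply/ball_prod_norm.
have -> : w - (y0 + t *: (w - y0)) = (1 - t) *: (w - y0).
  by rewrite scalerBl scale1r opprD addrA.
by rewrite normrZ gtr0_norm // t1 mulrAC ltr_pdivrMr // ltr_pM2l.
Qed.

(** All sheets over squares that meet [O] are glued. Where two of them overlap in the plane, Helly
    gives a point lying also over the square of [O]; both lifts agree there with that in [O], so the
    sheets are compatible. By [lim_sheet] they cover the closed square, and compactness leaves a
    margin d. *)
Lemma sheet_extend O y0 (r : R) : sheet O (ball y0 r) -> 0 < r ->
  exists O' (d : R), [/\ 0 < d, O `<=` O' & sheet O' (ball y0 (r + d))].
Proof.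
move=> SO r0.
pose P := [set i : set M * (R * R) * R | [/\ 0 < i.2, sheet i.1.1 (ball i.1.2 i.2) &
  i.1.1 `&` O !=set0]].
pose O' := \bigcup_(i in P) i.1.1; pose B' := \bigcup_(i in P) ball i.1.2 i.2.
have meet i : P i -> ball i.1.2 i.2 `&` ball y0 r !=set0.
  move=> [_ Si [q [iq Oq]]]; exists (f q).
  by split; [exact: sheet_img Si iq|exact: sheet_img SO Oq].
have S' : sheet O' B'.
  apply: sheet_bigcup => [i [] //|i j Pi Pj a b ia jb fab].
  have [_ Si iO] := Pi; have [_ Sj jO] := Pj.
  apply: (sheet_unique Si Sj _ _ _ ia jb fab); try exact: segment_closed_ball.
  have [w [w1 w2 w3]] : exists w, [/\ ball i.1.2 i.2 w, ball y0 r w & ball j.1.2 j.2 w].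
    apply: helly_ball; first exact: meet.
      by rewrite setIC; exact: meet.
    exists (f a); split; first exact: sheet_img Si ia.
    by rewrite fab; exact: sheet_img Sj jb.
  have [a1 ia1 fa1] := sheet_lift Si w1.
  have [b1 jb1 fb1] := sheet_lift Sj w3.
  have [c1 Oc1 fc1] := sheet_lift SO w2.
  have E1 : a1 = c1.
    apply: (sheet_unique Si SO) ia1 Oc1 _ => //; try exact: segment_closed_ball.
    by rewrite fa1 fc1.
  have E2 : b1 = c1.
    apply: (sheet_unique Sj SO) jb1 Oc1 _ => //; try exact: segment_closed_ball.
    by rewrite fb1 fc1.
  by exists a1; split => //; rewrite E1 -E2.
have oB' : open B' by apply: bigcup_open => i _; exact: ball_open.
have PO : P (O, y0, r).
  split => //=; have [a Oa _] := sheet_lift SO (ballxx y0 r0); by exists a.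
have [y yr|d d0 dB] := @closed_ball_lebesgue y0 r B' r0 oB'.
  have [q fq clq] := lim_sheet SO r0 yr.
  have [e [W [e0 Wq SW]]] := local_sheet q.
  exists (W, y, e); last exact: ballxx.
  split => //=; first by rewrite -fq.
  have [ oW _ _] := SW; have [a [Oa Wa]] := clq W (open_nbhs_nbhs (conj oW Wq)).
  by exists a.
exists (O' `&` f @^-1` ball y0 (r + d)), d; split => //.
  move=> q Oq; split; first by exists (O, y0, r).
  have /ball_prod_norm H := sheet_img SO Oq; apply/ball_prod_norm.
  by apply: lt_trans H _; rewrite ltrDl.
by apply: sheet_restrict S' _ dB; exact: ball_open.
Qed.

(** Sheets through [q0] over concentric squares agree. A finite supremum of their radii would itself
    be attained by the union and then exceeded by [sheet_extend]. *)
Lemma global_sheet q0 : exists2 O, O q0 & sheet O [set: R * R].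
Proof.
pose y0 := f q0.
pose P := [set i : set M * R | [/\ 0 < i.2, i.1 q0 & sheet i.1 (ball y0 i.2)]].
have Punique i j : P i -> P j -> forall a b, i.1 a -> j.1 b -> f a = f b -> a = b.
  move=> [_ iq Si] [_ jq Sj]; apply: (sheet_unique Si Sj); try exact: segment_closed_ball.
  by exists q0.
pose S := [set r : R | exists O, P (O, r)].
have S0 : S !=set0.
  by have [r [ O [r0 Oq SO]]] := local_sheet q0; exists r, O.
have unbounded : ~ has_ubound S.
  move=> hS; have hsS : has_sup S by split.
  pose s := sup S.
  have Sle r : S r -> r <= s by move=> Sr; exact: sup_upper_bound.
  have s0 : 0 < s.
    by have [r Sr] := S0; apply: lt_le_trans (Sle _ Sr); have [ O []] := Sr.
  have SU : sheet (\bigcup_(i in P) i.1) (ball y0 s).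
    have -> : ball y0 s = \bigcup_(i in P) ball y0 i.2.
      apply/seteqP; split => [y /ball_prod_norm ys|y [[ O r] Pi /= By]].
        have [r [ O PO] yr] := sup_gt S0 ys.
        by exists (O, r) => //=; apply/ball_prod_norm.
      by apply: le_ball By; apply: Sle; exists O.
    by apply: sheet_bigcup => // i [].
  have [ O' [d [d0 OO' S']]] := sheet_extend SU s0.
  have : s + d <= s.
    apply: Sle; exists O'; split => //=; first by rewrite addr_gt0.
    by apply: OO'; have [r [ O PO]] := S0; exists (O, r) => //; have [] := PO.
  by rewrite gerDl leNgt d0.
exists (\bigcup_(i in P) i.1).
  by have [r [ O PO]] := S0; exists (O, r) => //; have [] := PO.
have -> : [set: R * R] = \bigcup_(i in P) ball y0 i.2.
  apply/seteqP; split => // y _; apply: contrapT => nB; apply: unbounded.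
  exists `|y - y0| => r [ O PO]; rewrite leNgt; apply/negP => yr; apply: nB.
  by exists (O, r) => //; apply/ball_prod_norm.
by apply: sheet_bigcup => // i [].
Qed.

(** The global sheet is also closed: a local sheet at a closure point meets it and, by uniqueness of
    lifts, places that point in it. Connectedness makes it the whole surface. *)
Lemma covering_bijective : [set: M] !=set0 -> injective f /\ forall y, exists q, f q = y.
Proof.
move=> [q0 _]; have [ O Oq SO] := global_sheet q0.
have [ oO iO fO] := SO.
have OT : O = setT.
  apply: connected_clopen => //; last by exists q0.
  move=> b clb.
  have [r [W [r0 Wb SW]]] := local_sheet b.
  have [a Oa fa] := sheet_lift SO (I : [set: R * R] (f b)).
  have [ oW _ _] := SW; have WO := clb W (open_nbhs_nbhs (conj oW Wb)).
  by rewrite -(sheet_unique SO SW segment_closedT (@segment_closed_ball _ _ _ _) WO Oa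
    Wb fa).
split=> [a b fab|y]; first by apply: iO => //; rewrite OT.
by have [a _ fa] := sheet_lift SO (I : [set: R * R] y); exists a.
Qed.

End Covering.

(** * Lifted segments, intrinsic distance and completeness *)

Section Ramp.
Context {R : realType}.

(* A C^1 reparametrization of [0, 1] defined on all of R with values in [0, 1]. *)
Definition ramp (t : R) : R := (1 - cos (pi * t)) / 2.
Definition dramp (t : R) : R := pi / 2 * sin (pi * t).

Lemma is_derive_ramp (t : R) : is_derive t 1 ramp (dramp t).
Proof.
have d1 : is_derive t 1 (fun t : R => pi * t) pi.
  have := @is_deriveZ _ _ _ id pi t 1 1 _.
  by rewrite /GRing.scale /= mulr1; apply.
have d2 := is_derive1_comp (is_derive_cos (pi * t)) d1.
have d3 : is_derive t 1 (cst 1 - (cos \o (fun t : R => pi * t))) (0 - (- sin (pi * t) *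
  pi)).
  by apply: is_deriveB.
have d4 := @is_deriveZ _ _ _ _ (2^-1 : R) t 1 _ d3.
have -> : ramp = (2^-1 : R) \*: (cst 1 - (cos \o (fun t : R => pi * t))).
  by apply/funext => s; rewrite /ramp mulrC !fctE.
apply: is_derive_eq d4 _; rewrite /dramp /GRing.scale /=; ring.
Qed.

Lemma ramp0 : ramp 0 = 0.
Proof. by rewrite /ramp mulr0 cos0 subrr mul0r. Qed.

Lemma ramp1 : ramp 1 = 1.
Proof. by rewrite /ramp mulr1 cospi; lra. Qed.

Lemma ramp01 (t : R) : 0 <= ramp t <= 1.
Proof.
rewrite /ramp; have := cos_geN1 (pi * t); have := cos_le1 (pi * t).
by move=> ? ?; apply/andP; split; lra.
Qed.

Lemma continuous_ramp : continuous ramp.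
Proof.
move=> t; apply: differentiable_continuous; apply/derivable1_diffP.
by have [] := is_derive_ramp t.
Qed.

Lemma continuous_dramp : continuous dramp.
Proof.
move=> t; apply: cvgM; first exact: cvg_cst.
apply: (@continuous_comp _ _ _ (fun t : R => pi * t) sin); last exact: continuous_sin.
by apply: cvgM; [exact: cvg_cst|exact: cvg_id].
Qed.

Lemma dramp_le2 (t : R) : `|dramp t| <= 2.
Proof.
rewrite /dramp normrM; have := sin_le1 (pi * t); have := sin_geN1 (pi * t) => ? ?.
have s1 : `|sin (pi * t)| <= 1 by rewrite ler_norml; apply/andP.
have p2 : pi / 2 < 2 := pihalf_lt2 R.
have p0 : 0 <= (pi : R) / 2 by rewrite divr_ge0 // pi_ge0.
rewrite (ger0_norm p0) -[leRHS]mulr1; apply: ler_pM => //; exact: ltW.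
Qed.
End Ramp.

Section Complete.
Context {R : realType} {n : nat} {M : topologicalType} {F : M -> 'rV[R]_n}.
Context {p e1 e2 : 'rV[R]_n} {f : M -> R * R}.
Hypothesis Ff : forall q, F q = p + (f q).1 *: e1 + (f q).2 *: e2.
Hypotheses (cf : continuous f) (complF : complete_surface F).
Hypothesis fopen : forall q (W : set M), nbhs q W -> nbhs (f q) (f @` W).

(** The segment between the projections lifts through the inverse of f on [O], continuous as f is
    open. Run along [ramp], it has speed at most 2 |D|, because the derivative of [ramp] is at most
    pi / 2 < 2. *)
Lemma intrinsic_dist_sheet O (B : set (R * R)) (q1 q2 : M) :
  sheet (f := f) O B -> segment_closed B -> O q1 -> O q2 ->
  (intrinsic_dist F q1 q2 <= (2 * enorm ((f q2 - f q1).1 *: e1 + (f q2 - f q1).2 *: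
    e2))%:E)%E.
Proof.
move=> SO cB Oq1 Oq2; have [ oO iO fO] := SO.
have Bq q : O q -> B (f q) by move=> Oq; rewrite -fO; exists q.
pose d := f q2 - f q1; set D := _ + _.
pose ga (t : R) := f q1 + ramp t *: d.
have Bga t : B (ga t) by apply: cB; [exact: Bq|exact: Bq|exact: ramp01].
have ex t : exists q, O q /\ f q = ga t by have := Bga t; rewrite -fO => -[q Oq fq];
  exists q.
pose g t := sval (cid (ex t)).
have [Og fg] : (forall t, O (g t)) /\ (forall t, f (g t) = ga t).
  by split=> t; rewrite /g; case: cid => q [].
have cga : continuous ga.
  move=> t; apply: cvgD; first exact: cvg_cst.
  by apply: cvgZ; [exact: continuous_ramp|exact: cvg_cst].
have cg : continuous g.
  move=> t W gW; have : nbhs (ga t) (f @` (W `&` O)).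
    by rewrite -fg; apply: fopen; apply: filterI => //; exact: open_nbhs_nbhs.
  move=> /cga H; have {}H : nbhs t (ga @^-1` (f @` (W `&` O))) by [].
  suff : nbhs t (g @^-1` W) by [].
  apply: filterS H => s /= [b [Wb Ob] fb].
  by have -> : g s = b by apply: iO => //; rewrite fb fg.
have FgE : F \o g = fun t => F q1 + ramp t *: D.
  apply/funext => t /=; rewrite !Ff fg /ga /D /=.
  by apply/rowP => i; rewrite !mxE; rewrite /GRing.scale /=; ring.
have dFg (t : R) : derivable (F \o g) t 1 /\ derive1 (F \o g) t = dramp t *: D.
  have [dr1 dr2] := is_derive_ramp t; have /derivable1_diffP dr := dr1.
  rewrite FgE derive1E.
  have d1 : differentiable (fun t => ramp t *: D) t by exact: differentiableZl.
  have d2 : differentiable (fun t => F q1 + ramp t *: D) t by exact: differentiableD.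
  split; first exact: diff_derivable.
  rewrite deriveD; [|exact: derivable_cst|exact: diff_derivable].
  by rewrite derive_cst add0r (deriveE _ d1) diffZl //= -deriveE // dr2.
have C1g : C1_curve F g.
  split => //; first by move=> t; exact: (dFg t).1.
  have -> : derive1 (F \o g) = fun t => dramp t *: D by apply/funext => t; exact: (dFg t).2.
  by move=> t; apply: cvgZ; [exact: continuous_dramp|exact: cvg_cst].
have g0 : g 0 = q1 by apply: iO => //; rewrite fg /ga ramp0 scale0r addr0.
have g1 : g 1 = q2 by apply: iO => //; rewrite fg /ga ramp1 scale1r addrC subrK.
apply: (@le_trans _ _ (curve_length F g)).
  by apply: ereal_inf_lbound; exists g.
rewrite /curve_length.
have E (t : R) : enorm (derive1 (F \o g) t) = `|dramp t| * enorm D.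
  by rewrite (dFg t).2 enormZ.
under eq_integral do rewrite E.
apply: (@le_trans _ _ (\int[@lebesgue_measure R]_(t in `[0%R, 1%R]) (2 * enorm D)%:E)%E).
  apply: ge0_le_integral => //.
  - by move=> t _; rewrite lee_fin mulr_ge0 // enorm_ge0.
  - apply/measurable_EFinP; apply: measurable_funTS; apply: continuous_measurable_fun.
    move=> t; apply: cvgM; last exact: cvg_cst.
    by apply: cvg_norm; exact: continuous_dramp.
  - by move=> t _; rewrite lee_fin ler_wpM2r ?enorm_ge0 // dramp_le2.
rewrite integral_cst //= lebesgue_measure_itv /= lte_fin ltr01 -EFinB subr0.
by rewrite mule1.
Qed.

Lemma cauchy_bound (h c D eps : R) : 0 < h -> 0 <= D -> h * (2 * D + 1) < eps ->
  c <= h -> 2 * (c * D) < eps.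
Proof.
move=> h0 D0 H ch; have : c * D <= h * D by rewrite ler_wpM2r.
by move: h0 H => ? ? ?; lra.
Qed.

(** Points approaching y along the radius stay in the open square; their lifts form a Cauchy
    sequence by [intrinsic_dist_sheet], and its limit lies over y. *)
Lemma complete_lim_sheet O y0 (r : R) (y : R * R) : sheet (f := f) O (ball y0 r) ->
  0 < r -> `|y - y0| <= r -> exists2 q, f q = y & closure O q.
Proof.
move=> SO r0 yr; have [ oO iO fO] := SO.
pose c (i : nat) : R := 1 - harmonic i.
have h0 i : 0 < (harmonic i : R) by exact: harmonic_gt0.
have h1 i : (harmonic i : R) <= 1 by rewrite /harmonic invf_le1 // ler1n.
pose ys i := y0 + c i *: (y - y0).
have By i : ball y0 r (ys i).
  rewrite ball_prod_norm /ys addrC addKr normrZ ger0_norm ?subr_ge0 //.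
  apply: (@le_lt_trans _ _ (c i * r)); first by rewrite ler_wpM2l // subr_ge0.
  by rewrite gtr_pMl // /c ltrBlDr ltrDl.
have ex i : exists q, O q /\ f q = ys i by have := By i; rewrite -fO => -[q Oq fq];
  exists q.
pose q i := sval (cid (ex i)).
have [Oq fq] : (forall i, O (q i)) /\ (forall i, f (q i) = ys i).
  by split=> i; rewrite /q; case: cid => ? [].
have cys : ys @ \oo --> y.
  have -> : y = y0 + (1 - 0 : R) *: (y - y0) by rewrite subr0 scale1r addrC subrK.
  apply: cvgD; first exact: cvg_cst.
  apply: cvgZ; last exact: cvg_cst.
  by apply: cvgB; [exact: cvg_cst|exact: cvg_harmonic].
have [|qs cq] := complF (q := q).
  move=> eps eps0; set D0 := enorm ((y - y0).1 *: e1 + (y - y0).2 *: e2).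
  have D00 : 0 <= D0 by exact: enorm_ge0.
  have K0 : 0 < eps / (2 * D0 + 1) by rewrite divr_gt0 // ltr_wpDl // mulr_ge0.
  have [N _ HN] := cvgr_lt _ (@cvg_harmonic R) _ K0.
  exists N => i j Ni Nj.
  apply: le_lt_trans (intrinsic_dist_sheet SO (@segment_closed_ball _ _ y0 r) (Oq i)
    (Oq j)) _.
  rewrite lte_fin !fq.
  have -> : ys j - ys i = (c j - c i) *: (y - y0).
    by rewrite /ys opprD addrACA subrr add0r -scalerBl.
  have E (s : R) (d : R * R) : (s *: d).1 *: e1 + (s *: d).2 *: e2 = s *: (d.1 *: e1 +
    d.2 *: e2).
    by rewrite scalerDr !scalerA.
  rewrite E enormZ -/D0.
  have hN k : (N <= k)%N -> (harmonic k : R) <= harmonic N.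
    by move=> Nk; rewrite /harmonic lef_pV2 ?posrE ?ltr0n // ler_nat.
  have : `|c j - c i| <= harmonic N.
    have := hN i Ni; have := hN j Nj; have := h0 i; have := h0 j; rewrite /c => *.
    by rewrite ler_norml; apply/andP; split; lra.
  have := HN N (leqnn N); rewrite /= ltr_pdivlMr; last by rewrite ltr_wpDl // mulr_ge0.
  exact: cauchy_bound.
exists qs.
  have cfq : f \o q @ \oo --> f qs by apply: cvg_comp cq _; exact: cf.
  have fqE : f \o q = ys by apply/funext => i /=; exact: fq.
  rewrite fqE in cfq.
  by apply: (cvg_unique _ cfq cys).
move=> W /cq [N _ HN]; exists (q N); split; first exact: Oq.
by apply: (HN N); exact: leqnn.
Qed.
End Complete.

(** * Projection of the flat surface to the plane *)

Section FlatImage.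
Context {R : realType} {n : nat} {M : topologicalType} {A : set (chart R M)}.
Context {F : M -> 'rV[R]_n} {p e1 e2 : 'rV[R]_n}.
Hypotheses (surfM : smooth_surface A) (connM : connected [set: M]).
Hypotheses (immF : immersion A F) (complF : complete_surface F).
Hypotheses (n1 : dot e1 e1 = 1) (n2 : dot e2 e2 = 1) (n12 : dot e1 e2 = 0).

Lemma orthonormal_decomposition (x : 'rV[R]_n) :
  (forall l, dot e1 l = 0 -> dot e2 l = 0 -> dot x l = 0) ->
  x = dot x e1 *: e1 + dot x e2 *: e2.
Proof.
move=> H; pose l := x - (dot x e1 *: e1 + dot x e2 *: e2).
have n21 : dot e2 e1 = 0 by rewrite dotC.
have l1 : dot e1 l = 0.
  by rewrite /l dotBr dotDr !dotZr n1 n12 [dot e1 x]dotC mulr1 mulr0 addr0 subrr.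
have l2 : dot e2 l = 0.
  by rewrite /l dotBr dotDr !dotZr n2 n21 [dot e2 x]dotC mulr1 mulr0 add0r subrr.
have : dot l l = 0.
  by rewrite {1}/l dotBl dotDl !dotZl l1 l2 H // !mulr0 addr0 subrr.
by move/dot_eq0/eqP; rewrite subr_eq0 => /eqP.
Qed.

Hypothesis flat : forall l, dot e1 l = 0 -> dot e2 l = 0 ->
  forall q, dot (F q) l - dot p l = 0.

Let f q := (dot (F q) e1 - dot p e1, dot (F q) e2 - dot p e2).

Let Ff q : F q = p + (f q).1 *: e1 + (f q).2 *: e2.
Proof.
have H : F q - p = dot (F q - p) e1 *: e1 + dot (F q - p) e2 *: e2.
  by apply: orthonormal_decomposition => l l1 l2; rewrite dotBl; exact: flat.
by rewrite /f /= -!dotBl -addrA -H addrC subrK.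
Qed.

Let cf : continuous f.
Proof.
move=> q; have cF := immersion_continuous surfM immF.
have cd l : {for q, continuous (fun q => dot (F q) l - dot p l)}.
  apply: cvgB; last exact: cvg_cst.
  by apply: (@continuous_comp _ _ _ F (fun x => dot x l)); [exact: cF|exact:
    dot_continuous].
exact: (cvg_pair (cd e1) (cd e2)).
Qed.

Section InChart.
Context {c : chart R M}.
Hypothesis Ac : A c.
Let x z := dot (F (c z)) e1 - dot p e1.
Let y z := dot (F (c z)) e2 - dot p e2.

Let oD : open (chart_dom c). Proof. exact: (open_chart_dom surfM). Qed.
Let sX : smooth_on (chart_dom c) (F \o c). Proof. by have [] := immF Ac. Qed.

Lemma Cinf_flat_coord l : Cinf (chart_dom c) (fun z => dot (F (c z)) l - dot p l).
Proof. by apply: CinfB; [exact: (Cinf_dotl oD l sX)|exact: Cinf_cst]. Qed.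

(** The tangent vectors are combinations of [e1], [e2], so the Gram determinant is the square of
    this Jacobian. *)
Lemma flat_jac_neq0 z : chart_dom c z -> jac2 (x := x) (y := y) z z != 0.
Proof.
move=> cz; have := immersion_ffdet_gt0 immF Ac cz.
have dl l : differentiable (fun z => dot (F (c z)) l) z.
  exact: (Cinf_differentiable oD (Cinf_dotl oD l sX) cz).
have dE l v : 'D_v (fun z => dot (F (c z)) l - dot p l) z = 'D_v (fun z => dot (F (c
  z)) l) z.
  by rewrite (derive_add v (dl l)) // derive_cst addr0.
have dsE l : ds (fun z => dot (F (c z)) l - dot p l) z = dot (ds (F \o c) z) l.
  by rewrite -(ds_dotl l sX cz) ds.unlock dE.
have dtE l : dt (fun z => dot (F (c z)) l - dot p l) z = dot (dt (F \o c) z) l.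
  by rewrite -(dt_dotl l sX cz) dt.unlock dE.
have flat0 l v : dot e1 l = 0 -> dot e2 l = 0 ->
    'D_v (fun z => dot (F (c z)) l - dot p l) z = 0.
  move=> l1 l2; have -> : (fun z => dot (F (c z)) l - dot p l) = (fun=> 0).
    by apply/funext => w; exact: flat.
  exact: derive_cst.
have eS : ds (F \o c) z = ds x z *: e1 + ds y z *: e2.
  rewrite /x /y !dsE; apply: orthonormal_decomposition => l l1 l2.
  by rewrite -dsE ds.unlock; exact: flat0.
have eT : dt (F \o c) z = dt x z *: e1 + dt y z *: e2.
  rewrite /x /y !dtE; apply: orthonormal_decomposition => l l1 l2.
  by rewrite -dtE dt.unlock; exact: flat0.
have n21 : dot e2 e1 = 0 by rewrite dotC.
rewrite /ffdet /ffE /ffF /ffG eS eT !(dotDl, dotDr, dotZl, dotZr) n1 n2 n12 n21.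
move=> D0; apply/eqP => J; move: D0; rewrite /jac2 in J.
rewrite (_ : _ - _ = (ds x z * dt y z - dt x z * ds y z) ^+ 2); last by ring.
by rewrite J expr0n ltxx.
Qed.
End InChart.

Let fopen q (W : set M) : nbhs q W -> nbhs (f q) (f @` W).
Proof.
have [c [z [Ac cz <-]]] := exists_chart surfM q => qW.
have oD : open (chart_dom c) by exact: (open_chart_dom surfM).
have zW : nbhs z (c @^-1` W) by exact: (chart_continuous surfM Ac cz qW).
have := open_map2 oD (Cinf_flat_coord Ac e1) (Cinf_flat_coord Ac e2) cz
  (flat_jac_neq0 Ac cz) zW.
by apply: filterS => _ [w Ww <-]; exists (c w).
Qed.

Let local_inj (q : M) : exists2 O : set M, nbhs q O & forall a b, O a -> O b -> f a = f
  b -> a = b.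
Proof.
have [c [z [Ac cz <-]]] := exists_chart surfM q.
have oD : open (chart_dom c) by exact: (open_chart_dom surfM).
have [r r0 [_ _ inj]] := local_inj2 oD (Cinf_flat_coord Ac e1) (Cinf_flat_coord Ac e2) cz
  (flat_jac_neq0 Ac cz).
exists (c @` ball z r); first by apply: (chart_nbhs_image surfM) => //; exact: nbhsx_ballx.
by move=> _ _ [a Ba <-] [b Bb <-] [fx fy]; congr (c _); exact: inj.
Qed.

Lemma flat_complete_bijective : [set: M] !=set0 ->
  injective f /\ forall y, exists q, f q = y.
Proof.
have hM : hausdorff_space M by case: surfM.
apply: (covering_bijective hM connM cf fopen local_inj) => O y0 r y.
exact: (complete_lim_sheet Ff cf complF fopen).
Qed.
End FlatImage.

(** Eventual smallness below 1 for each rate sigma is the form of the decay used on the end. *)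
Lemma limf_esup_eq0_near (R : realType) (T : topologicalType) (f : T -> R)
    (G : set_system T) :
  limf_esup (fun x => (f x)%:E) G = 0%E -> exists2 W : set T, G W & forall x, W x -> f
    x < 1.
Proof.
move=> H; have : (limf_esup (fun x => (f x)%:E) G < 1%:E)%E by rewrite H lte_fin ltr01.
move/ereal_inf_lt => [_ [W GW <-] W1]; exists W => // x Wx.
rewrite -lte_fin; apply: le_lt_trans W1; apply: ereal_sup_ubound.
by exists x.
Qed.

Theorem theorem1p1 (R : realType) (n : nat)
  (M : topologicalType) (A : set (chart R M)) (F : M -> 'rV[R]_n)
  (surfM : smooth_surface A) (connM : connected [set: M])
  (immF : immersion A F) (minF : minimal A F) (complF : complete_surface F)
  (growF : exp_area_growth A F)
  (p : 'rV[R]_n) (V : 'M[R]_(2, n)) (rankV : \rank V = 2%N)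
  (e : set M -> set M) (e_end : is_end e)
  (K : set M) (cptK : compact K)
  (u : 'rV[R]_n -> 'rV[R]_n) (rho : R)
  (graphu : is_graph_outside_ball F (e K) p V u rho)
  (decayu : forall sigma : R, 0 < sigma ->
     limf_esup (fun x : 'rV[R]_n =>
       (enorm (expR (sigma * enorm x) *: u x))%:E) (plane_infty p V) = 0%E) :
  set_bij [set: M] (plane p V) F.
Proof.
have [e1 [e2 [al [be [ga [[n1 n2 n12] e1E e2E subV]]]]]] := orthobasis rankV.
have [su un [Ffun Finj Fsurj]] := graphu.
pose P (z : R * R) := p + z.1 *: e1 + z.2 *: e2.
have planeP x : plane p V x <-> exists z, x = P z.
  rewrite /plane /= subV /P; split => [[s [t E]]|[z ->]].
    by exists (s, t); rewrite /= -addrA -E addrC subrK.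
  by exists z.1, z.2; rewrite -(addrA p) (addrC p) addrK.
pose U := [set z | rho < enorm (P z)].
have UP z : U z -> plane p V (P z) /\ rho < enorm (P z).
  by move=> Uz; split => //; apply/planeP; exists z.
have hM : hausdorff_space M by case: surfM.
have oE : open (e K).
  have [eK _] := e_end; have [q _ ->] := eK K cptK.
  by apply: (open_component surfM); apply: closed_openC; exact: compact_closed.
have uV x : u x *m V^T = 0 -> dot (u x) e1 = 0 /\ dot (u x) e2 = 0.
  move=> H; have Hj j : dot (u x) (row j V) = 0.
    move/matrixP: H => /(_ 0 j); rewrite !mxE dotE => H.
    by rewrite -[RHS]H; apply: eq_bigr => i _; rewrite !mxE.
  by rewrite e2E e1E dotDr !dotZr !Hj !mulr0 addr0.
(* The linear map [L] converts coordinates in the orthonormal basis into coordinates in the rows of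
   [V]. *)
have suP : smooth_on U (u \o P).
  pose L (z : R * R) : R * R := (al * z.1 + be * z.2, ga * z.2).
  have dL z : is_diff z L L.
    have d1 := is_diff_fst z; have d2 := is_diff_snd z.
    have l1 : is_diff z (fun z : R * R => al * z.1 + be * z.2) (fun z => al * z.1 + be
      * z.2).
      exact: (is_diffD (is_diffZ al d1) (is_diffZ be d2)).
    have l2 : is_diff z (fun z : R * R => ga * z.2) (fun z => ga * z.2).
      exact: (is_diffZ ga d2).
    exact: is_diff_pair.
  have PL z : plane_param p V (L z) = P z.
    rewrite /plane_param /P /L /= e2E e1E; apply/rowP => i; rewrite !mxE; ring.
  pose U0 := plane_param p V @^-1` [set x | plane p V x /\ rho < enorm x].
  have oU0 : open U0.
    have -> : U0 = [set z | rho < enorm (p + z.1 *: row 0 V + z.2 *: row 1 V)].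
      apply/seteqP; split => z; first by case.
      move=> H; split => //; rewrite /plane /plane_param /=.
      by apply/sub_rows2; exists z.1, z.2; rewrite -(addrA p) (addrC p) addrK.
    exact: open_enorm_affine.
  have := smooth_on_comp_linear oU0 dL su.
  have -> : (u \o plane_param p V) \o L = u \o P.
    by apply/funext => z /=; rewrite PL.
  apply: smooth_onS => z /UP H; by rewrite /U0 /preimage /= PL.
have unP z : U z -> dot (u (P z)) e1 = 0 /\ dot (u (P z)) e2 = 0.
  by move=> /UP H; apply: uV; exact: un.
have Egraph q : e K q -> exists2 z, U z & F q = P z + u (P z).
  move=> /Ffun[x [/planeP[z ->] Uz] <-]; by exists z.
have graphE z : U z -> exists2 q, e K q & F q = P z + u (P z).
  move=> Uz; have [|q Eq Fq] := Fsurj (P z + u (P z)); last by exists q.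
  by exists (P z) => //; exact: UP.
have decP (sg : R) : 0 < sg -> exists r : R, forall z, U z ->
    r < enorm (P z) -> enorm (u (P z)) <= expR (- (sg * enorm (P z))).
  move=> /decayu/limf_esup_eq0_near[W [r _ rW] W1]; exists r => z Uz rz.
  have /W1 : W (P z) by apply: rW; split => //; apply/planeP; exists z.
  rewrite enormZ ger0_norm ?expR_ge0 // => /ltW.
  by rewrite expRN -ler_pdivlMl ?expR_gt0 // mulr1.
have flat l : dot e1 l = 0 -> dot e2 l = 0 -> forall q, dot (F q) l - dot p l = 0.
  move=> l1 l2.
  have [ O [ oO O0] FO] := end_normal_component_eq0 surfM immF minF n1 n2 n12 oE suP unP
    Egraph graphE decP l1 l2.
  exact: (normal_component_eq0 surfM immF minF connM oO O0 FO).
(* The component chosen by the end contains its base point, so the surface is nonempty, as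
   [flat_complete_bijective] requires. *)
have [q0 Eq0 _] : exists2 q, e K q & True.
  have [eK _] := e_end; have [q nKq ->] := eK K cptK.
  by exists q => //; exact: connected_component_refl.
have [inj surj] := flat_complete_bijective surfM connM immF complF n1 n2 n12 flat
  (ex_intro _ q0 I).
have FE q : F q = p + (dot (F q) e1 - dot p e1) *: e1 + (dot (F q) e2 - dot p e2) *: e2.
  have H : F q - p = dot (F q - p) e1 *: e1 + dot (F q - p) e2 *: e2.
    by apply: (orthonormal_decomposition n1 n2 n12) => l l1 l2; rewrite dotBl; exact: flat.
  by rewrite -!dotBl -addrA -H addrC subrK.
split.
- by move=> q _; apply/planeP; eexists (_, _); exact: FE.
- by move=> a b _ _ Fab; apply: inj; rewrite Fab.
- move=> x /planeP[z ->]; have [q qz] := surj z; exists q => //.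
  by rewrite FE /P -qz.
Qed.
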